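(* Let $f:\mathbb{R}^n\to\mathbf{Y}=[a,b]\subset\mathbb{R}$, $\mathbf{X}\subset\mathbb{R}^n$, and fix $d_x,d_y,d_\gamma\in\mathbb{N}$ and $\alpha>0$. Let $n_\theta$ denote the number of decision variables (as specified in the context) of the sample-based problem. Suppose that $\epsilon\in(0,1)$, $\delta\in(0,1)$ and $N\in\mathbb{N}$ are chosen such that $$\sum_{k=0}^{n_\theta-1}\binom{N}{k}\epsilon^k(1-\epsilon)^{N-k}\le\delta \qquad\text{(a)}$$ or $$N\ge\frac{1}{\epsilon}\left(n_\theta-1+\ln\frac1\delta+\sqrt{2(n_\theta-1)\ln\frac1\delta}\right)\qquad\text{(b)}$$ holds (condition (b) is sufficient for condition (a)). Let $\mathbf{x}_1,\ldots,\mathbf{x}_N$ be iid samples from a probability distribution $\mathbb{P}$ on $\mathbf{X}$, let $y_i=f(\mathbf{x}_i)$, let $(p,\gamma)$ be an optimal solution to the sample-based SOS problem defined in the context, and denote $$\gamma_{\max}:=\sup_{(\mathbf{x},y)\in\mathbf{X}\times[a,b]}\gamma(\mathbf{x},y).$$ Then with probability at least $1-\delta$ (taken over the sample $\mathbf{x}_1,\ldots,\mathbf{x}_N$ with joint distribution $\mathbb{P}\otimes\cdots\otimes\mathbb{P}$, $N$ times), we have $$\mathbb{P}\left(\left\{\mathbf{x}\in\mathbf{X} : |\hat f(\mathbf{x})-f(\mathbf{x})|\le\sqrt{\frac{\gamma_{\max}}{\alpha}}\right\}\right)>1-\epsilon,$$ where $\hat f$ is any measurable selection satisfying $\hat f(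\mathbf{x})\in\operatorname{Argmin}_{y\in\mathbf{Y}}p(\mathbf{x},y)$.
   Context: $\mathbb{R}[\cdot]_d$ denotes real polynomials of total degree at most $d$; $\Sigma_d[y]$ denotes the convex cone of sums of squares of polynomials in $y$, of degree at most $d$. $\operatorname{Argmin}_{y\in\mathbf{Y}}p(\mathbf{x},y)$ is the set of global minimizers of $p(\mathbf{x},\cdot)$ on $\mathbf{Y}=[a,b]$. The polynomial $p$ is parametrized as $p(\mathbf{x},y)=\sum_{k=1}^{d_y}h_k(\mathbf{x})y^k$ with $h_k\in\mathbb{R}[\mathbf{x}]_{d_x}$. Sample-based SOS problem, given data $(\mathbf{x}_i,y_i)_{i=1}^N$ with $y_i=f(\mathbf{x}_i)$: minimize $$\int_{\mathbf{X}\times[a,b]}\gamma(\mathbf{x},y)\,d\mathbf{x}\,dy$$ over $\gamma\in\mathbb{R}[\mathbf{x},y]_{d_\gamma}$, $(h_k\in\mathbb{R}[\mathbf{x}]_{d_x})_{k=1}^{d_y}$ and $(\sigma_{0,i},\sigma_{1,i})_{i=1}^N$ subject to, for $i=1,\ldots,N$, $\gamma(\mathbf{x}_i,y_i)\ge0$ and the identity of polynomials in $y$: for $d_y$ even, $$p(\mathbf{x}_i,y)-p(\mathbf{x}_i,y_i)+\gamma(\mathbf{x}_i,y_i)-\alpha(y-y_i)^2=\sigma_{0,i}+\sigma_{1,i}(b-y)(y-a),\quad \sigma_{0,i}\in\Sigma_{d_y}[y],\ \sigma_{1,i}\in\Sigma_{d_y-2}[y];$$ for $d_y$ odd, the right-hand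 side is replaced by $\sigma_{0,i}(y-a)+\sigma_{1,i}(b-y)$ with $\sigma_{0,i},\sigma_{1,i}\in\Sigma_{d_y-1}[y]$. This is the reformulation, via the classical certificate of nonnegativity of univariate polynomials on an interval, of the requirement that the left-hand side be nonnegative for all $y\in[a,b]$. The number $n_\theta$ is the number of decision variables of the equivalent formulation in which the first constraint is written as $\inf_{y\in[a,b]}\{p(\mathbf{x}_i,y)-p(\mathbf{x}_i,y_i)+\gamma(\mathbf{x}_i,y_i)-\alpha(y-y_i)^2\}\ge0$; i.e. the decision vector $\theta\in\mathbb{R}^{n_\theta}$ gathers exactly the coefficients of $(h_k)_{k=1}^{d_y}$ and of $\gamma$ (and not the $\sigma$'s).
   Formalization: The claim fails for an arbitrary optimal solution; here (p,γ) is the unique optimal solution, or the one strictly minimizing a fixed convex tie-break function among optimal solutions. X and f are taken measurable, and every γ of degree at most d_γ integrable on X×[a,b]. *)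

(* Defs.v *)
From HB Require Import structures.
From mathcomp Require Import all_boot all_order all_algebra.
From mathcomp.multinomials Require mpoly.
(* The notations of mpoly clash with those of MathComp-Analysis; its canonical
   structures and constants are still needed. *)
Import -(notations) mpoly.
From mathcomp Require Import all_classical all_reals all_analysis.

Set Implicit Arguments.
Unset Strict Implicit.
Unset Printing Implicit Defensive.

Import Order.TTheory GRing.Theory Num.Theory.
Import numFieldNormedType.Exports.

Local Open Scope classical_set_scope.
Local Open Scope ring_scope.

Section TupleMeasure.
Context (d : measure_display) (T : measurableType d) (R : realType).

Fixpoint tuple_measure (mu : set T -> \bar R) (n : nat) :
    set (n.-tuple T) -> \bar R :=
  match n with
  | 0 => \d_([tuple] : 0.-tuple T)
  | m.+1 => pushforward (mu \x (@tuple_measure mu m))%E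
              (fun z : T * m.-tuple T => [tuple of z.1 :: z.2])
  end.

End TupleMeasure.
Arguments tuple_measure {d T R} mu n.

Notation "''R[' R ]^ n" := (n.-tuple (measurableTypeR R))
  (at level 8, n at level 2, format "''R[' R ]^ n") : type_scope.

Definition lebesgue_tuple (R : realType) (n : nat) : set 'R[R]^n -> \bar R :=
  tuple_measure (@lebesgue_measure R) n.
Arguments lebesgue_tuple : clear implicits.

Section SampleProblem.
Context (R : realType) (n : nat).
Implicit Types (x : 'R[R]^n) (y : R).

(* The polynomials (h_1, ..., h_dy) and gamma. The function component maps
   k : 'I_dy to h_(k+1); the last variable of gamma is y. *)
Definition decision (dy : nat) : Type :=
  ({ffun 'I_dy -> mpoly n R} * mpoly n.+1 R)%type.

Definition mdegree_le (m d : nat) (q : mpoly m R) : Prop :=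
  (mmeasure (@mdeg m) q <= d.+1)%N.

Definition decision_space (dx dy dg : nat) : set (decision dy) :=
  [set th : decision dy | (forall k, mdegree_le dx (th.1 k)) /\ mdegree_le dg th.2].

(* The monomials of degree at most d in m variables form the finite type
   [bmultinom m d.+1], so this is dy * 'C(n + dx, n) + 'C(n.+1 + dg, n.+1). *)
Definition n_theta (dx dy dg : nat) : nat :=
  (dy * #|{: bmultinom n dx.+1}| + #|{: bmultinom n.+1 dg.+1}|)%N.

Definition p_at dy (th : decision dy) x : {poly R} :=
  \sum_(k < dy) meval (tnth x) (th.1 k) *: 'X^(k.+1).

Definition gamma_at dy (th : decision dy) x y : R :=
  meval (tnth [tuple of rcons x y]) th.2.

(* Sums of squares of degree < m: the strict bound makes the cone of degree
   d - 2 be {0} when d < 2, despite truncated subtraction. *)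
Definition sos_lt (m : nat) (q : {poly R}) : Prop :=
  (exists s : seq {poly R}, q = \sum_(r <- s) r ^+ 2) /\ (size q <= m)%N.

Definition interval_certificate (a b : R) (d : nat) (q : {poly R}) : Prop :=
  exists s0 s1 : {poly R},
    if odd d then
      [/\ sos_lt d s0, sos_lt d s1
        & q = s0 * ('X - a%:P) + s1 * (b%:P - 'X)]
    else
      [/\ sos_lt d.+1 s0, sos_lt d.-1 s1
        & q = s0 + s1 * ((b%:P - 'X) * ('X - a%:P))].

Definition sample_constraint (a b alpha : R) dy (th : decision dy) x y : Prop :=
  0 <= gamma_at th x y /\
  interval_certificate a b dy
    (p_at th x - (p_at th x).[y]%:P + (gamma_at th x y)%:P
     - alpha *: ('X - y%:P) ^+ 2).

Definition objective (X : set 'R[R]^n) (a b : R) dy (th : decision dy) : \bar R :=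
  (\int[(lebesgue_tuple R n) \x (@lebesgue_measure R)]_(z in X `*` `[a, b])
     (gamma_at th z.1 z.2)%:E)%E.

Definition feasible (f : 'R[R]^n -> R) (a b alpha : R) (dx dy dg N : nat)
    (xs : N.-tuple 'R[R]^n) (th : decision dy) : Prop :=
  decision_space dx dg th /\
  forall i : 'I_N, sample_constraint a b alpha th (tnth xs i) (f (tnth xs i)).

Definition optimal (X : set 'R[R]^n) (f : 'R[R]^n -> R) (a b alpha : R)
    (dx dy dg N : nat) (xs : N.-tuple 'R[R]^n) (th : decision dy) : Prop :=
  feasible f a b alpha dx dg xs th /\
  forall th' : decision dy, feasible f a b alpha dx dg xs th' ->
    (objective X a b th <= objective X a b th')%E.

(* The optimal solution singled out by the tie-break function t. For constant t
   this says that th is the unique optimal solution; without a tie-break rule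
   the generalization bound fails, as h does not occur in the objective. *)
Definition selected_optimal (X : set 'R[R]^n) (f : 'R[R]^n -> R)
    (a b alpha : R) (dx dy dg N : nat) (t : decision dy -> R)
    (xs : N.-tuple 'R[R]^n) (th : decision dy) : Prop :=
  optimal X f a b alpha dx dg xs th /\
  forall th' : decision dy, optimal X f a b alpha dx dg xs th' -> th' <> th -> t th < t th'.

Definition gamma_max (X : set 'R[R]^n) (a b : R) dy (th : decision dy) : \bar R :=
  ereal_sup [set (gamma_at th z.1 z.2)%:E | z in X `*` `[a, b]].

End SampleProblem.

Definition argmin (T : Type) (R : realType) (D : set T) (g : T -> R) : set T :=
  [set y | D y /\ forall z, D z -> g y <= g z].

(* Main.v *)
(* Markov-Lukacs turns the certificates into nonnegativity on [a, b], so the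
   problem minimizes a linear objective over an intersection of closed convex
   sets C_x of decisions, with ties broken by the convex function t. A point with
   p = 2 alpha y^2 and a large constant gamma is interior to every C_x, and is
   moved to the origin.

   The bound then follows Campi and Garatti, by counting. Fix n samples and ask
   for how many of their N-element subsets the optimum violates at least k of the
   remaining constraints. After scaling each C_x by a generic factor close to 1,
   which destroys no violation, distinct irredundant subfamilies have distinct
   optima; by Radon's theorem they have at most n_theta members, so every subset
   is determined by its basis and the count is a hypergeometric tail. By
   exchangeability this bounds the probability that N samples produce a decision
   violating a fraction eps of fresh ones, and n -> oo gives the binomial tail
   (a). Strictly convex objectives on large boxes, converging to the
   lexicographic one, provide the unique measurable optima used there.

   Finally, at y = fhat x the constraint reads
   alpha (fhat x - f x)^2 <= gamma (x, f x) + p (x, fhat x) - p (x, f x),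
   which is at most gamma_max. *)
Require Import Defs.
From HB Require Import structures.
From mathcomp Require Import all_boot all_order all_algebra fingroup perm.
From mathcomp.multinomials Require mpoly.
From mathcomp Require Import zify ring lra.

Set Implicit Arguments.
Unset Strict Implicit.
Unset Printing Implicit Defensive.

(** * Counting violations in finite samples *)

(** Write [n_theta] as d + 1. The count is rigid once every set of constraints has a single basis:
    bases are padded to size d + 1 by the smallest remaining indices, each set then has exactly one
    padded basis, and the number of (d+1)-sets with j violators is a binomial coefficient whatever
    the program is. Degeneracy is removed inside the count only, by a scaling chosen for one fixed
    sample. Violation is measured by a strict increase of the optimal value. Unlike membership of
    the optimum in a constraint set, such an increase visibly survives a small scaling, and it is
    measurable because values are decided at rational points. The good event is built from the
    approximating programs alone, before any optimal decision is named. Passing to the lexicographic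
    limit replaces eps by thresholds slightly below it; continuity of the binomial tail recovers the
    loss. *)

(** Both sides count N-sets with at most d elements in a block of size L. Moving one element into
    that block loses exactly the sets that contain it and have d elements in the old block. *)
Lemma pascal_telescope (L m N d : nat) : d < N ->
  \sum_(i < d.+1) 'C(L, i) * 'C(m.+1, N - i) =
  \sum_(i < d.+1) 'C(L.+1, i) * 'C(m, N - i) + 'C(L, d) * 'C(m, N - d.+1).
Proof.
elim: d => [|d IH] dN.
  rewrite !big_ord_recr !big_ord0 /= !bin0 !add0n !mul1n subn0.
  by case: N dN => // N _; rewrite binS subn1.
rewrite big_ord_recr /= IH; last exact: ltnW.
rewrite [in RHS]big_ord_recr /=.
have -> : N - d.+1 = (N - d.+2).+1 by lia.
by rewrite !binS; lia.
Qed.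

(** The right side counts N-subsets of an ordered n-set with at most d elements among the first d +
    k. The left side sorts them by the position j + d, counted from 0, of their (d+1)-st smallest
    element. *)
Lemma hypergeometric_tail (n N d k : nat) : d < N -> d + k <= n ->
  \sum_(k <= j < (n - d)) 'C(j + d, d) * 'C(n - d.+1 - j, N - d.+1) =
  \sum_(i < d.+1) 'C(d + k, i) * 'C(n - (d + k), N - i).
Proof.
move=> dN dkn.
have [r nE] : exists r, n = d + k + r by exists (n - (d + k)); lia.
elim: r k nE {dkn} => [|r IH] k nE.
  rewrite big_geq; last by lia.
  rewrite big1 // => i _; rewrite nE addn0 subnn (@bin_small 0) ?muln0//.
  by rewrite subn_gt0 (leq_trans (ltn_ord i)).
rewrite (_ : n - (d + k) = r.+1); last by lia.
rewrite big_ltn; last by lia.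
rewrite (IH k.+1); last by lia.
rewrite pascal_telescope // addnS addnC (_ : n - (d + k).+1 = r); last by lia.
by congr (_ + _ * 'C(_, _)); rewrite ?(addnC k); lia.
Qed.

Lemma hypergeometric_total (n N d : nat) : d < N -> d <= n ->
  \sum_(0 <= j < (n - d)) 'C(j + d, d) * 'C(n - d.+1 - j, N - d.+1) = 'C(n, N).
Proof.
move=> dN dn; rewrite hypergeometric_tail// ?addn0//.
rewrite -[in RHS](subnKC dn) -binomial.Vandermonde.
rewrite [RHS](bigID (fun i : 'I_N.+1 => i < d.+1)) /= [X in _ + X]big1 ?addn0.
  rewrite (big_ord_widen_cond N.+1 xpredT (fun i => 'C(d, i) * 'C(n - d, N - i)))//.
  by lia.
by move=> i; rewrite -leqNgt => di; rewrite bin_small.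
Qed.

(** * Sets counted by their unique supports *)

Section ViolatorCount.
Variables (I : finType) (d : nat) (viol : {set I} -> {set I}).
Hypothesis viol_disjoint : forall K : {set I}, [disjoint K & viol K].
Let n := #|I|.

Definition supports (K S : {set I}) :=
  [&& #|K| == d.+1, K \subset S & [disjoint viol K & S]].

Hypothesis supports_exists : forall S : {set I}, d < #|S| -> exists K, supports K S.
Hypothesis supports_unique : forall K K' S, supports K S -> supports K' S -> K = K'.

(** Such an S is K together with N - d - 1 elements outside K and [viol K]. *)
Lemma card_supported (K : {set I}) N : #|K| = d.+1 -> d < N ->
  #|[set S | supports K S & #|S| == N]| = 'C(n - d.+1 - #|viol K|, N - d.+1).
Proof.
move=> cK dN.
have cKv : #|~: (K :|: viol K)| = n - d.+1 - #|viol K|.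
  have := cardsC (K :|: viol K); rewrite cardsU.
  have /eqP -> : K :&: viol K == set0 by rewrite setI_eq0.
  by rewrite cards0 cK -/n; lia.
rewrite -cKv -(cards_draws (~: (K :|: viol K)) (N - d.+1)).
rewrite -[RHS](card_in_imset (f := fun A : {set I} => K :|: A)); last first.
  move=> A B; rewrite !inE => /andP[AK _] /andP[BK _] /setP AB.
  apply/setP => x; move: (AB x); rewrite !inE.
  case: (boolP (x \in K)) => // xK _.
  by apply/idP/idP => [/(subsetP AK)|/(subsetP BK)]; rewrite !inE xK.
congr #|pred_of_set _|; apply/setP => S; rewrite !inE; apply/idP/imsetP.
  move=> /andP[/and3P[_ KS vS] /eqP cS]; exists (S :\: K); last first.
    by rewrite -{1}(setIidPr KS) setID.
  rewrite inE; apply/andP; split; last by rewrite cardsD (setIidPr KS) cS cK.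
  apply/subsetP => x; rewrite !inE => /andP[xK xS]; rewrite (negPf xK)/=.
  by apply/negP => xv; move/disjoint_setI0/setP/(_ x): vS; rewrite !inE xv xS.
move=> [A]; rewrite inE => /andP[AK /eqP cA] ->.
have KA : K :&: A = set0.
  apply/setP => x; rewrite !inE; apply/negP => /andP[xK xA].
  by move/subsetP: AK => /(_ x xA); rewrite !inE xK.
rewrite /supports cK eqxx subsetUl /= cardsU KA cards0 cK cA.
rewrite [X in _ && X](_ : _ = true) ?andbT; last by apply/eqP; lia.
rewrite -setI_eq0; apply/eqP/setP => x; rewrite !inE.
apply/negP => /andP[xv /orP[xK|xA]].
  by move/disjoint_setI0/setP/(_ x): (viol_disjoint K); rewrite !inE xK xv.
by move/subsetP: AK => /(_ x xA); rewrite !inE xv orbT.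
Qed.

(** Sort the N-sets by their unique support, then the supports by their number of violators. *)
Lemma card_supported_pred (p : pred nat) N : d < N ->
  #|[set S : {set I} | (#|S| == N) && [exists K, supports K S && p #|viol K|]]| =
  \sum_(0 <= j < (n - d) | p j)
     #|[set K : {set I} | #|K| == d.+1 & #|viol K| == j]| *
     'C(n - d.+1 - j, N - d.+1).
Proof.
move=> dN.
transitivity (\sum_(K : {set I} | (#|K| == d.+1) && p #|viol K|)
    'C(n - d.+1 - #|viol K|, N - d.+1)).
  transitivity (\sum_(K : {set I} | (#|K| == d.+1) && p #|viol K|)
      \sum_(S : {set I} | (#|S| == N) && supports K S) 1); last first.
    apply: eq_bigr => K /andP[/eqP cK _]; rewrite sum1_card -(card_supported cK dN).
    by apply: eq_card => S; rewrite !inE andbC.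
  rewrite (exchange_big_dep (fun S : {set I} => #|S| == N)) /=; last first.
    by move=> K S _ /andP[].
  rewrite -sum1_card big_mkcond/= [RHS]big_mkcond/=; apply: eq_bigr => S _.
  rewrite inE; case: eqP => //= cS.
  have [K /andP[sK pK]|noK] := pickP (fun K => supports K S && p #|viol K|).
    rewrite (bigD1 K) /= ?big1.
    - by rewrite ifT//; apply/existsP; exists K; rewrite sK.
    - by move=> K' /andP[/andP[_ /(supports_unique sK)->]]; rewrite eqxx.
    - by rewrite pK sK; case/and3P: sK => ->.
  rewrite ifF; last by apply/existsP => -[K]; rewrite noK.
  rewrite big1// => K /andP[/andP[_ pK] sK].
  by have := noK K; rewrite sK pK.
rewrite big_mkord (partition_big (fun K : {set I} => inord #|viol K| : 'I_n.+1)
  (fun j => p j && (j < n - d))) /=; last first.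
  move=> K /andP[/eqP cK pK].
  have h : #|viol K| < n - d.
    have := max_card (pred_of_set (K :|: viol K)); rewrite cardsU -/n.
    by rewrite disjoint_setI0// cards0 cK; lia.
  by rewrite inordK ?pK//; lia.
rewrite [RHS](big_ord_widen_cond n.+1 p (fun j =>
     #|[set K : {set I} | #|K| == d.+1 & #|viol K| == j]| *
     'C(n - d.+1 - j, N - d.+1))); last by lia.
apply: eq_bigr => j /andP[pj jn].
rewrite -sum_nat_const; apply: congr_big => //.
  move=> K; rewrite inE -val_eqE/= inordK; last by rewrite ltnS max_card.
  by case: eqP => //= _; case: eqP => [->|]; rewrite ?pj ?andbF.
by move=> K; rewrite -val_eqE/= inordK ?ltnS ?max_card// => /andP[_ /eqP->].
Qed.

(** Every set of size n - j has exactly one support, so the counts for 0, ..., j satisfy a linear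
    equation whose last coefficient is 1 and whose later terms vanish. By [hypergeometric_total] the
    binomials satisfy the same triangular system. *)
Lemma card_violated (j : nat) : j < n - d ->
  #|[set K : {set I} | #|K| == d.+1 & #|viol K| == j]| = 'C(j + d, d).
Proof.
elim/ltn_ind: j => j IH jn.
have dN : d < n - j by lia.
have := card_supported_pred xpredT dN.
have -> : [set S : {set I} | (#|S| == n - j) &&
     [exists K, supports K S && true]] = [set S : {set I} | #|S| == n - j].
  apply/setP => S; rewrite !inE; case: eqP => //= cS.
  have [|K sK] := supports_exists (S := S); first by rewrite cS.
  by apply/existsP; exists K; rewrite sK.
have -> : #|[set S : {set I} | #|S| == n - j]| = 'C(n, n - j).
  by rewrite -(card_draws I (n - j)).
rewrite -(@hypergeometric_total n _ d)//; last by lia.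
rewrite !(@big_cat_nat _ _ _ j.+1 0 (n - d))//= ![in X in _ = X + _]big_nat_recr//=.
rewrite ![in X in X + _ = _]big_nat_recr//=.
rewrite [X in _ + _ + X = _]big_nat_cond [X in _ + _ + X = _]big1; last first.
  by move=> i /andP[/andP[ji jn'] _]; rewrite (@bin_small (n - _ - i)) ?muln0//; lia.
rewrite [X in _ = _ + _ + X]big_nat_cond [X in _ = _ + _ + X]big1; last first.
  by move=> i /andP[/andP[ji jn'] _]; rewrite (@bin_small (n - _ - i)) ?muln0//; lia.
rewrite (_ : n - d.+1 - j = n - j - d.+1) ?binn; last by lia.
rewrite !muln1 !addn0.
have -> : \sum_(0 <= i < j) #|[set K : {set I} | #|K| == d.+1 & #|viol K| == i]| *
     'C(n - d.+1 - i, n - j - d.+1) =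
  \sum_(0 <= i < j) 'C(i + d, d) * 'C(n - d.+1 - i, n - j - d.+1).
  by rewrite !big_nat; apply: eq_bigr => i /andP[_ ij]; rewrite IH//; lia.
by move=> /addnI.
Qed.

Lemma card_supported_violated N k : d < N -> d + k <= n ->
  #|[set S : {set I} | (#|S| == N) && [exists K, supports K S && (k <= #|viol K|)]]| =
  \sum_(i < d.+1) 'C(d + k, i) * 'C(n - (d + k), N - i).
Proof.
move=> dN dkn; rewrite (card_supported_pred (leq k) dN) -hypergeometric_tail//.
rewrite [RHS](@big_nat_widenl _ _ _ k 0)// big_nat_cond [RHS]big_nat_cond.
by apply: eq_bigr => j /andP[/andP[_ jn] _]; rewrite card_violated.
Qed.
End ViolatorCount.

(** * Padded bases in a nondegenerate program *)

Section NondegenerateViolations.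
Variables (n d : nat) (V : eqType) (opt : {set 'I_n} -> V) (ok : V -> pred 'I_n).
Hypothesis opt_ok : forall (S : {set 'I_n}) i, i \in S -> ok (opt S) i.
Hypothesis opt_eq : forall S S' : {set 'I_n}, S \subset S' ->
  (forall i, i \in S' -> ok (opt S) i) -> opt S' = opt S.

Definition critical (K : {set 'I_n}) := [forall i in K, opt (K :\ i) != opt K].

Hypothesis critical_card : forall K, critical K -> #|K| <= d.+1.
Hypothesis critical_inj : forall K K', critical K -> critical K' ->
  opt K = opt K' -> K = K'.

Lemma exists_critical (S : {set 'I_n}) :
  exists K : {set 'I_n}, [/\ K \subset S, critical K & opt K = opt S].
Proof.
pose P (K : {set 'I_n}) := (K \subset S) && (opt K == opt S).
have PS : P S by rewrite /P subxx eqxx.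
case: (arg_minnP (fun K : {set 'I_n} => #|K|) PS) => K /andP[KS /eqP oK] minK.
exists K; split=> //; apply/forall_inP => i iK; apply/eqP => oKi.
have /minK : P (K :\ i) by rewrite /P (subset_trans (subD1set K i) KS) oKi oK eqxx.
by rewrite [leqRHS](_ : _ = #|K|.-1) ?(cardsD1 i K) ?iK//; lia.
Qed.

(** The choice made by [pick] is unambiguous: [critical_inj] leaves a single candidate. *)
Definition basis (S : {set 'I_n}) : {set 'I_n} :=
  odflt set0 [pick K : {set 'I_n} | [&& K \subset S, critical K & opt K == opt S]].

Lemma basisP (S : {set 'I_n}) :
  [/\ basis S \subset S, critical (basis S) & opt (basis S) = opt S].
Proof.
rewrite /basis; case: pickP => [K /and3P[? ? /eqP]//|].
have [K [KS cK oK]] := exists_critical S.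
by move=> /(_ K); rewrite KS cK oK eqxx.
Qed.

(** Padding by the smallest available indices makes the extension canonical. *)
Lemma initial_extension (B S : {set 'I_n}) m : B \subset S -> #|B| <= m <= #|S| ->
  exists K : {set 'I_n}, [/\ B \subset K, K \subset S, #|K| = m &
    forall y z, y \in K :\: B -> z \in S :\: K -> y < z].
Proof.
move=> BS; elim: m => [|m IH] /andP[Bm mS].
  by exists B; split=> //; [lia | move=> y z; rewrite setDv in_set0].
move: Bm; rewrite leq_eqVlt => /orP[/eqP Bm|Bm].
  by exists B; split=> // y z; rewrite setDv in_set0.
have [|K [BK KS cK iK]] := IH; first by rewrite -ltnS Bm ltnW.
have [x xSK] : exists x, x \in S :\: K.
  by apply/set0Pn; rewrite -card_gt0 cardsD (setIidPr KS); lia.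
case: (arg_minnP (fun x : 'I_n => x : nat) xSK) => {xSK}x xSK minx.
have [xS xK] : x \in S /\ x \notin K by have : x \in S :\: K := xSK; rewrite inE => /andP[].
exists (x |: K); split.
- exact: subset_trans BK (subsetUr _ _).
- by rewrite subUset sub1set xS.
- by rewrite cardsU1 xK cK.
move=> y z; rewrite !inE negb_or => /andP[yB /orP[/eqP->|yK]] /andP[/andP[zx zK] zS].
  by rewrite ltn_neqAle eq_sym zx; apply: minx; change (z \in S :\: K); rewrite inE zK.
by apply: iK; rewrite !inE ?yB ?zK.
Qed.

(** The second alternative forbids indices below a padding element: adding one would change the
    padding, and so the support, even when it leaves the optimum alone. *)
Definition viol (K : {set 'I_n}) :=
  [set z | (z \notin K) && (~~ ok (opt K) z || [exists y in K :\: basis K, z < y])].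

Lemma viol_disjoint (K : {set 'I_n}) : [disjoint K & viol K].
Proof.
rewrite -setI_eq0; apply/eqP/setP => z; rewrite !inE.
by case: (z \in K).
Qed.

Lemma basis_eq (K S : {set 'I_n}) : opt K = opt S -> basis K = basis S.
Proof.
move=> oKS; have [_ cK oK] := basisP K; have [_ cS oS] := basisP S.
by apply: critical_inj => //; rewrite oK oS.
Qed.

Lemma supportsP (K S : {set 'I_n}) : supports d viol K S ->
  [/\ #|K| = d.+1, K \subset S, opt K = opt S &
      forall y z, y \in K :\: basis S -> z \in S :\: K -> y < z].
Proof.
case/and3P => /eqP cK KS dvS.
have nv z : z \in S -> z \notin viol K.
  by move=> zS; move/disjoint_setI0/setP/(_ z): dvS; rewrite in_setI zS andbT in_set0 => ->.
have oKS : opt K = opt S.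
  apply/esym/opt_eq => // z zS; have := nv z zS; rewrite !inE.
  by case: (boolP (z \in K)) => [/opt_ok//|_]/=; rewrite negb_or negbK => /andP[].
split=> // y z yK; rewrite !inE => /andP[zK zS]; have := nv z zS; rewrite !inE zK/=.
rewrite negb_or => /andP[_]; rewrite negb_exists => /forallP/(_ y).
rewrite (basis_eq oKS) yK/= -leqNgt leq_eqVlt => /orP[/eqP/val_inj yz|//].
by move: yK zK; rewrite inE yz => /andP[_ ->].
Qed.

Lemma supports_exists (S : {set 'I_n}) : d < #|S| -> exists K, supports d viol K S.
Proof.
move=> dS; have [BS cB oB] := basisP S.
have [|K [BK KS cK iK]] := @initial_extension (basis S) S d.+1 BS.
  by rewrite critical_card.
have oKS : opt K = opt S.
  by rewrite -oB; apply: opt_eq => // i iK'; rewrite oB opt_ok// (subsetP KS).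
exists K; rewrite /supports cK eqxx KS /= -setI_eq0; apply/eqP/setP => z.
rewrite !inE; apply/negP => /andP[/andP[zK zv] zS].
move: zv; rewrite oKS opt_ok//= => /exists_inP[y]; rewrite (basis_eq oKS) => yK.
have := iK y z yK; rewrite inE zK zS => /(_ isT); lia.
Qed.

(** Both supports contain the basis of S. If they differ, an index in one only and an index in the
    other only are padding, and each would have to be smaller than the other. *)
Lemma supports_unique (K K' S : {set 'I_n}) :
  supports d viol K S -> supports d viol K' S -> K = K'.
Proof.
wlog KK' : K K' / ~~ (K \subset K') => [H sK sK'|].
  have [KK'|/H->//] := boolP (K \subset K').
  have [cK _ _ _] := supportsP sK; have [cK' _ _ _] := supportsP sK'.
  by apply/eqP; rewrite eqEcard KK' cK cK' leqnn.
move=> /supportsP[cK KS oK iK] /supportsP[cK' K'S oK' iK'].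
have [y yK yK'] := subsetPn KK'.
have [z zK' zK] : exists2 z, z \in K' & z \notin K.
  apply/subsetPn; apply: contra KK' => K'K.
  by rewrite (_ : K' = K)//; apply/eqP; rewrite eqEcard K'K cK cK' leqnn.
have BK : basis S \subset K by rewrite -(basis_eq oK); case: (basisP K).
have BK' : basis S \subset K' by rewrite -(basis_eq oK'); case: (basisP K').
have yz : y < z.
  apply: iK; rewrite !inE ?yK ?zK ?andbT/= ?(subsetP K'S)//.
  by apply: contra yK' => /(subsetP BK').
suff : z < y by lia.
apply: iK'; rewrite !inE ?zK' ?yK' ?andbT/= ?(subsetP KS)//.
by apply: contra zK => /(subsetP BK).
Qed.

(** The support K of S has the same optimum, so the true violators of S belong to [viol K]; the
    indices forbidden for the sake of the padding only enlarge the count. *)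
Lemma card_violated_le N k : d < N -> d + k <= n ->
  #|[set S : {set 'I_n} | (#|S| == N) &&
      (k <= #|[set z | (z \notin S) && ~~ ok (opt S) z]|)]| <=
  \sum_(i < d.+1) 'C(d + k, i) * 'C(n - (d + k), N - i).
Proof.
move=> dN dkn; have := @card_supported_violated _ d viol viol_disjoint
  supports_exists supports_unique N k dN.
rewrite card_ord => <-//; apply/subset_leq_card/subsetP => S; rewrite !inE.
move=> /andP[/eqP cS kv]; rewrite cS eqxx/=.
have [|K sK] := @supports_exists S; first by rewrite cS.
apply/existsP; exists K; rewrite sK (leq_trans kv)//.
have [_ KS oK _] := supportsP sK.
apply/subset_leq_card/subsetP => z; rewrite !inE oK => /andP[zS ->].
by rewrite (contra (subsetP KS z)).
Qed.
End NondegenerateViolations.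

Import -(notations) mpoly.
From mathcomp Require Import all_classical all_reals all_analysis.
From mathcomp Require Import measurable_realfun.

Import Order.TTheory GRing.Theory Num.Theory.
Import numFieldNormedType.Exports.

Local Open Scope classical_set_scope.
Local Open Scope ring_scope.

(** * Finite convex programs *)

Section Convexity.
Context {R : realType} {V : lmodType R}.

Definition cvx_set (A : set V) :=
  forall x y s, A x -> A y -> 0 <= s -> s <= 1 -> A (s *: x + (1 - s) *: y).

Definition cvx_fun (J : V -> R) :=
  forall x y s, 0 <= s -> s <= 1 -> J (s *: x + (1 - s) *: y) <= s * J x + (1 - s) * J y.

(** Weights are not normalized and points of weight 0 are unrestricted: this is the form in which
    Radon's argument delivers them. *)
Lemma cvx_set_sum (A : set V) (I : finType) (w : I -> R) (v : I -> V) :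
  cvx_set A -> (forall i, 0 <= w i) -> (forall i, w i != 0 -> A (v i)) ->
  0 < \sum_i w i -> A ((\sum_i w i)^-1 *: \sum_i w i *: v i).
Proof.
move=> cA w0 wA; elim: (index_enum I) => [|i r IH].
  by rewrite big_nil ltxx.
rewrite !big_cons; set W := \sum_(_ <- r) _; set X := \sum_(_ <- r) _.
have W0 : 0 <= W by apply: sumr_ge0.
have [wi0|wi] := eqVneq (w i) 0.
  by rewrite wi0 scale0r !add0r; exact: IH.
have wi_gt0 : 0 < w i by rewrite lt_neqAle eq_sym wi w0.
have [W00|WN0] := eqVneq W 0.
  have -> : X = 0.
    apply: big1_seq => j /andP[_ jr].
    have /eqP : W == 0 by rewrite W00.
    rewrite /W => /eqP; rewrite psumr_eq0// => /allP/(_ j jr)/= /eqP->.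
    by rewrite scale0r.
  by rewrite W00 !addr0 scalerA mulVf// scale1r => _; exact: wA.
have W_gt0 : 0 < W by rewrite lt_neqAle eq_sym WN0.
move=> S_gt0; have SN0 : w i + W != 0 by rewrite gt_eqF.
have := cA (v i) (W^-1 *: X) (w i / (w i + W)) (wA i wi) (IH W_gt0).
rewrite divr_ge0 ?w0 ?(ltW S_gt0)// ler_pdivrMr// mul1r lerDl W0 => /(_ isT isT).
congr A; rewrite scalerDr !scalerA; congr (_ *: _ + _ *: _); first by rewrite mulrC.
by field; rewrite SN0.
Qed.

Lemma cvx_sublevel (J : V -> R) c : cvx_fun J -> cvx_set [set w | J w < c].
Proof.
move=> cJ x y s /= xc yc s0 s1; apply: le_lt_trans (cJ x y s s0 s1) _.
have [->|sN0] := eqVneq s 0; first by rewrite mul0r add0r subr0 mul1r.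
have sp : 0 < s by rewrite lt_neqAle eq_sym sN0.
have : s * J x < s * c by rewrite ltr_pM2l.
have : (1 - s) * J y <= (1 - s) * c by rewrite ler_wpM2l ?subr_ge0// ltW.
by move=> h1 h2; rewrite (lt_le_trans (ltr_leD h2 h1))// -mulrDl addrC subrK mul1r.
Qed.

Lemma cvx_set_scale (A : set V) (l : R) w :
  cvx_set A -> A 0 -> A w -> 0 <= l <= 1 -> A (l *: w).
Proof.
move=> cA A0 Aw /andP[l0 l1].
by have := cA w 0 l Aw A0 l0 l1; rewrite scaler0 addr0.
Qed.
End Convexity.

Lemma linear_dependence (F : fieldType) (n m : nat) (K : {set 'I_n})
    (v : 'I_n -> 'rV[F]_m) : (m < #|K|)%N ->
  exists w : 'I_n -> F, [/\ forall i, i \notin K -> w i = 0,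
    \sum_i w i *: v i = 0 & exists i, w i != 0].
Proof.
move=> mK; pose M := \matrix_(i < #|K|) v (enum_val i).
have : kermx M != 0.
  by rewrite -mxrank_eq0 mxrank_ker -lt0n subn_gt0 (leq_ltn_trans (rank_leq_col _)).
move=> /rowV0Pn[u /sub_kermxP uM u0].
exists (fun i => \sum_(j | enum_val j == i) u 0 j); split.
- move=> i iK; rewrite big_pred0// => j; apply/negP => /eqP ji.
  by move: iK; rewrite -ji enum_valP.
- transitivity (u *m M); last by [].
  rewrite mulmx_sum_row (partition_big (fun j : 'I_#|K| => enum_val j) xpredT)//=.
  apply: eq_bigr => i _; rewrite scaler_suml; apply: eq_bigr => j /eqP ji.
  by rewrite rowK ji.
- have /rV0Pn[j uj] := u0.
  exists (enum_val j); rewrite (big_pred1 j)// => k.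
  by rewrite (inj_eq enum_val_inj).
Qed.

Section Minimizer.
Context {R : realType} {d : nat}.
Notation V := 'rV[R]_d.+1.
Variable J : V -> R.
Hypothesis cvxJ : cvx_fun J.
Hypothesis contJ : continuous J.
Hypothesis strictJ : forall x y, x != y ->
  J (2^-1 *: x + (1 - 2^-1) *: y) < 2^-1 * J x + (1 - 2^-1) * J y.

Definition minimizer (A : set V) : V :=
  xget 0 [set w | A w /\ forall w', A w' -> J w <= J w'].

Lemma minimizerP (A : set V) : compact A -> A !=set0 ->
  A (minimizer A) /\ forall w, A w -> J (minimizer A) <= J w.
Proof.
move=> cA A0; rewrite /minimizer; case: xgetP => [w -> //|noP].
have [c] := EVT_min_rV A0 cA (continuous_subspaceT contJ).
rewrite inE => Ac cmin; exfalso; apply: (noP c); split=> // w Aw.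
by apply: cmin; rewrite inE.
Qed.

Lemma minimizer_unique (A : set V) w : compact A -> cvx_set A ->
  A w -> J w <= J (minimizer A) -> w = minimizer A.
Proof.
move=> cA cvA Aw Jw; have [|mA minA] := minimizerP cA; first by exists w.
apply/eqP/negPn/negP => wN; have := strictJ wN; apply/negP; rewrite -leNgt.
have h : (2^-1 : R) <= 1 by lra.
have h0 : (0 : R) <= 2^-1 by [].
have := minA _ (cvA _ _ _ Aw mA h0 h); lra.
Qed.

Section Constraints.
Variables (n : nat) (B : set V) (D : 'I_n -> set V).
Hypotheses (compB : compact B) (cvxB : cvx_set B) (B0 : B 0).
Hypotheses (closedD : forall i, closed (D i)) (cvxD : forall i, cvx_set (D i))
  (D0 : forall i, D i 0).

Definition region (S : {set 'I_n}) : set V :=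
  [set w | B w /\ forall i, i \in S -> D i w].

Definition opt (S : {set 'I_n}) := minimizer (region S).

Lemma region_compact S : compact (region S).
Proof.
rewrite (_ : region S = B `&` \bigcap_(i in [set i | i \in S]) D i)//.
by apply: compact_closedI => //; apply: closed_bigI => i _.
Qed.

Lemma region_cvx S : cvx_set (region S).
Proof.
move=> x y s [Bx Dx] [By Dy] s0 s1; split=> [|i iS]; first exact: cvxB.
by apply: cvxD => //; [exact: Dx | exact: Dy].
Qed.

Lemma region0 S : region S 0. Proof. by split. Qed.

Lemma optP S : region S (opt S) /\ forall w, region S w -> J (opt S) <= J w.
Proof. by apply: minimizerP; [exact: region_compact | exists 0; exact: region0]. Qed.

Lemma opt_uniq S w : region S w -> J w <= J (opt S) -> w = opt S.
Proof. by apply: minimizer_unique; [exact: region_compact | exact: region_cvx]. Qed.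

Definition ok (w : V) : pred 'I_n := fun i => `[< D i w >].

Lemma opt_ok (S : {set 'I_n}) i : i \in S -> ok (opt S) i.
Proof. by move=> iS; apply/asboolP; have [[_ /(_ i iS)]] := optP S. Qed.

Lemma opt_extend (S S' : {set 'I_n}) : S \subset S' ->
  (forall i, i \in S' -> ok (opt S) i) -> opt S' = opt S.
Proof.
move=> SS' oS; have [[Bo _] minS] := optP S; have [[Bo' oS'] minS'] := optP S'.
apply: opt_uniq; first by split=> // i /(fintype.subsetP SS')/oS'.
by apply: minS'; split=> // i /oS/asboolP.
Qed.

Lemma opt_sub (S S' : {set 'I_n}) : S \subset S' -> J (opt S) <= J (opt S').
Proof.
move=> SS'; have [_ minS] := optP S; have [[Bo' oS'] _] := optP S'.
by apply: minS; split=> // i /(fintype.subsetP SS')/oS'.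
Qed.

(* Radon's argument: a dependence among the vectors [opt (K :\ i) - opt K]
   splits K into two parts whose hulls meet, and the common point would satisfy
   all constraints of K and be better than [opt K]. *)
Lemma critical_card (K : {set 'I_n}) : critical opt K -> (#|K| <= d.+1)%N.
Proof.
move=> /forall_inP crK; rewrite leqNgt; apply/negP => dK.
pose phi i := opt (K :\ i); pose th := opt K.
have [Bth Dth] : region K th by case: (optP K).
have phiB i : B (phi i) by case: (optP (K :\ i)) => -[].
have phiD i j : j \in K -> j != i -> D j (phi i).
  by move=> jK ji; case: (optP (K :\ i)) => -[_ + _]; apply; rewrite !inE ji.
have phiJ i : i \in K -> J (phi i) < J th.
  move=> iK; rewrite lt_neqAle opt_sub ?subD1set// andbT.
  apply: contraNneq (crK i iK) => Jphi; rewrite eq_sym; apply/eqP/opt_uniq.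
    by split=> // j; rewrite inE => /andP[_ /Dth].
  by rewrite -/(phi i) Jphi.
have [w0 [w0K w0s [i1 w0i]]] := linear_dependence (fun i => phi i - th) dK.
(* The dependence is linear, not affine, so its coefficients need not sum to 0. The sign is chosen
   so that the negative part is at least as heavy; the surplus [b - a] will be carried by [th]. *)
have [w [wK ws [i0 wi] wle]] : exists w : 'I_n -> R,
    [/\ forall i, i \notin K -> w i = 0, \sum_i w i *: (phi i - th) = 0,
        exists i, w i != 0 & \sum_i w i <= 0].
  have [w0le|w0gt] := leP (\sum_i w0 i) 0; first by exists w0; split=> //; exists i1.
  exists (fun i => - w0 i); split.
  - by move=> i iK; rewrite w0K ?oppr0.
  - by under eq_bigr do rewrite scaleNr; rewrite sumrN w0s oppr0.
  - by exists i1; rewrite oppr_eq0.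
  - by rewrite sumrN oppr_le0 ltW.
pose p i := Num.max (w i) 0; pose m i := Num.max (- w i) 0.
have pm i : w i = p i - m i.
  by rewrite /p /m; case: (leP (w i) 0); case: (leP (- w i) 0); lra.
have p0 i : 0 <= p i by rewrite le_max lexx orbT.
have m0 i : 0 <= m i by rewrite le_max lexx orbT.
have pN0 i : p i != 0 -> i \in K /\ 0 < w i.
  rewrite /p; case: (leP (w i) 0) => [|wi0]; first by rewrite eqxx.
  by move=> _; split=> //; apply: contraTT wi0 => /wK ->; rewrite ltxx.
have mN0 i : m i != 0 -> i \in K /\ w i < 0.
  rewrite /m; case: (leP (- w i) 0) => [|wi0]; first by rewrite eqxx.
  move=> _; rewrite oppr_gt0 in wi0; split=> //.
  by apply: contraTT wi0 => /wK ->; rewrite ltxx.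
set a := \sum_i p i; set b := \sum_i m i.
have ab : a <= b.
  by rewrite -subr_le0 /a /b -sumrB; under eq_bigr do rewrite -pm.
have a0 : 0 <= a by apply: sumr_ge0.
have b0 : 0 < b.
  rewrite lt_neqAle sumr_ge0// andbT eq_sym; apply/eqP => b0.
  have a00 : a = 0 by apply/eqP; rewrite eq_le a0 andbT -b0.
  move/eqP: b0; rewrite psumr_eq0// => /allP/(_ i0 (mem_index_enum _))/= /eqP mi.
  move/eqP: a00; rewrite psumr_eq0// => /allP/(_ i0 (mem_index_enum _))/= /eqP pi.
  by move: wi; rewrite pm mi pi subr0 eqxx.
(* [rho] averages only points strictly better than [th], hence beats it; [rhoE] also writes it as an
   average of the positive part and [th]. *)
pose rho := b^-1 *: \sum_i m i *: phi i.
have rhoE : b *: rho = \sum_i p i *: phi i + (b - a) *: th.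
  rewrite /rho scalerA divff ?gt_eqF// scale1r; apply/eqP; rewrite -subr_eq0 -oppr_eq0.
  rewrite opprB; apply/eqP; rewrite -[RHS]ws.
  have -> : \sum_i w i *: (phi i - th) =
      \sum_i (p i *: phi i - m i *: phi i - (p i *: th - m i *: th)).
    by apply: eq_bigr => i _; rewrite pm scalerBr !scalerBl.
  rewrite !sumrB -!scaler_suml -/a -/b scalerBl opprB.
  by rewrite addrAC.
have rhoJ : J rho < J th.
  apply: (cvx_set_sum (cvx_sublevel (c := J th) cvxJ)) => // i /mN0[iK _].
  exact: phiJ.
have rhoR : region K rho.
  split=> [|j jK]; first exact: (cvx_set_sum cvxB).
  (* Among the averaged points only [phi j] may violate constraint j, and it occurs in at most one
     of the two representations of [rho]: the other one is used. *)
  have [mj|/mN0[_ wj]] := eqVneq (m j) 0.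
    apply: (cvx_set_sum (@cvxD j)) => // i mi; apply: phiD => //.
    by apply: contraNneq mi => <-; rewrite mj.
  have -> : rho = b^-1 *: (\sum_i p i *: phi i + (b - a) *: th).
    by rewrite -rhoE scalerA mulVf ?gt_eqF// scale1r.
  have [a00|aN0] := eqVneq a 0.
    have -> : \sum_i p i *: phi i = 0.
      rewrite big1// => i _; move/eqP: a00; rewrite psumr_eq0//.
      by move=> /allP/(_ i (mem_index_enum _))/= /eqP ->; rewrite scale0r.
    by rewrite a00 subr0 add0r scalerA mulVf ?gt_eqF// scale1r; exact: Dth.
  have -> : b^-1 *: (\sum_i p i *: phi i + (b - a) *: th) =
      (a / b) *: (a^-1 *: \sum_i p i *: phi i) + (1 - a / b) *: th.
    rewrite scalerDr !scalerA; congr (_ *: _ + _ *: _); field; rewrite ?aN0 gt_eqF//.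
  apply: cvxD; [|exact: Dth|exact: divr_ge0 (ltW _)|by rewrite ler_pdivrMr// mul1r].
  apply: (cvx_set_sum (@cvxD j)) => //; last by rewrite lt_neqAle eq_sym aN0.
  move=> i /pN0[iK wi0]; apply: phiD => //; apply: contraTneq wi0 => <-.
  by rewrite -leNgt ltW.
have [_ /(_ _ rhoR)] := optP K.
by rewrite leNgt rhoJ.
Qed.

End Constraints.
End Minimizer.

(** * Removal of degeneracy by generic scaling *)

(** Each bad event meets every line in direction [coord q] at most once, so it covers at most a
    fraction 1/M of the grid, and fewer than M such events cannot cover it. *)
Lemma generic_choice (n M : nat) (Q : finType) (bad : Q -> pred {ffun 'I_n -> 'I_M})
    (coord : Q -> 'I_n) :
  (forall q g g', bad q g -> bad q g' ->
     (forall j, j != coord q -> g j = g' j) -> g = g') ->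
  (#|Q| < M)%N -> exists g, forall q, ~~ bad q g.
Proof.
move=> bad1 QM.
have [/existsP[g /forallP gP]|/existsPn noP] :=
  boolP [exists g, [forall q, ~~ bad q g]]; first by exists g.
pose T := #|{: {ffun 'I_n -> 'I_M}}|.
have T0 : (0 < T)%N.
  by rewrite /T card_ffun !card_ord expn_gt0; apply/orP; left; lia.
have cbad q : (#|bad q| * M <= T)%N.
  rewrite -[X in (_ * X)%N](card_ord M) -cardX.
  pose F (gm : {ffun 'I_n -> 'I_M} * 'I_M) : {ffun 'I_n -> 'I_M} :=
    [ffun j => if j == coord q then gm.2 else gm.1 j].
  rewrite -(card_in_imset (f := F)) ?max_card//.
  move=> [g m] [g' m']; rewrite !inE/= => /andP[bg _] /andP[bg' _] /ffunP FE.
  congr (_, _); last by have := FE (coord q); rewrite !ffunE eqxx.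
  by apply: (bad1 q) => // j /negPf jq; have := FE j; rewrite !ffunE jq.
have : (T <= \sum_q #|bad q|)%N.
  rewrite /T -sum1_card (eq_bigr (fun q => \sum_(g | bad q g) 1)%N); last first.
    by move=> q _; rewrite sum1_card.
  rewrite (exchange_big_dep xpredT)//=; apply: leq_sum => g _.
  have := noP g; rewrite negb_forall => /existsP[q]; rewrite negbK => bq.
  by rewrite (bigD1 q).
have : ((\sum_q #|bad q|) * M <= #|Q| * T)%N.
  by rewrite big_distrl/= -sum_nat_const leq_sum.
nia.
Qed.

Section Perturbation.
Context {R : realType} {d : nat}.
Notation V := 'rV[R]_d.+1.
Variable J : V -> R.
Hypothesis cvxJ : cvx_fun J.
Hypothesis contJ : continuous J.
Hypothesis strictJ : forall x y, x != y ->
  J (2^-1 *: x + (1 - 2^-1) *: y) < 2^-1 * J x + (1 - 2^-1) * J y.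
Variables (n : nat) (B : set V) (C : 'I_n -> set V).
Hypotheses (compB : compact B) (cvxB : cvx_set B) (B0 : B 0).
Hypotheses (closedC : forall i, closed (C i)) (cvxC : forall i, cvx_set (C i))
  (nbhsC : forall i, nbhs (0 : V) (C i)).

Let C0 i : C i 0. Proof. exact: (nbhs_singleton (nbhsC i)). Qed.

(** A factor in ]0, 1] enlarges the set, which is convex and contains 0. *)
Definition scaled (lam : 'I_n -> R) (i : 'I_n) : set V := [set w | C i (lam i *: w)].

Lemma scaled_closed lam i : closed (scaled lam i).
Proof.
apply: preimage_closed (@closedC i) => x _.
exact: (@scaler_continuous R V (lam i) x).
Qed.

Lemma scaled_cvx lam i : cvx_set (scaled lam i).
Proof.
move=> x y s Cx Cy s0 s1; rewrite /scaled/= scalerDr !scalerA.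
by rewrite !(mulrC (lam i)) -!scalerA; exact: cvxC.
Qed.

Lemma scaled0 lam i : scaled lam i 0. Proof. by rewrite /scaled/= scaler0. Qed.

Let Opt lam := opt J B (scaled lam).

Let OptP lam S := optP contJ compB B0 (@scaled_closed lam) (scaled0 lam) S.

(* The segment from the optimum of K towards a strictly better point that
   violates only constraint i stays in the slightly larger copy of [C i]. *)
Lemma critical_scale (lam : 'I_n -> R) (K : {set 'I_n}) i l :
  critical (Opt lam) K -> i \in K -> 0 < lam i -> lam i < l ->
  ~ C i (l *: Opt lam K).
Proof.
move=> /forall_inP crK iK lam0 laml Cl.
set th := Opt lam K in Cl *; pose phi := Opt lam (K :\ i).
have [[Bth Dth] minK] := OptP lam K; rewrite -/th in Bth Dth minK.
have [[Bphi Dphi] minKi] := OptP lam (K :\ i); rewrite -/phi in Bphi Dphi minKi.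
have Jphi : J phi < J th.
  rewrite lt_neqAle minKi ?andbT; last first.
    by split=> // j; rewrite inE => /andP[_ /Dth].
  apply: contraNneq (crK i iK) => JE; rewrite eq_sym; apply/eqP.
  apply: (opt_uniq contJ strictJ) => //.
  - exact: scaled_closed.
  - exact: scaled_cvx.
  - by split=> // j; rewrite inE => /andP[_ /Dth].
  - by rewrite -/phi JE.
have l0 : 0 < l by exact: lt_trans laml.
(* This is where 0 must be interior: [phi] may violate constraint i, but a small multiple of it does
   not. *)
have [mu mu0 Cmu] : exists2 mu : R, 0 < mu & C i (mu *: phi).
  have : \forall mu \near 0^'+, C i ((mu : R) *: phi).
    apply: (@cvg_at_right_filter _ _ (fun mu : R => mu *: phi)).
      by apply: cvgZr_tmp; exact: cvg_id.
    by rewrite scale0r; exact: nbhsC.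
  move=> near0; near (0 : R)^'+ => mu.
  exists mu; first by near: mu; exact: nbhs_right_gt.
  by near: mu.
(* s is chosen so that the two weights below add up to at most 1 *)
pose s := (1 - lam i / l) / (1 - lam i / l + lam i / mu).
have r1 : lam i / l < 1 by rewrite ltr_pdivrMr// mul1r.
have r2 : 0 < lam i / mu by rewrite divr_gt0.
have s0 : 0 < s by rewrite divr_gt0//; lra.
have s1 : s <= 1 by rewrite ler_pdivrMr ?mul1r; lra.
pose w := (1 - s) *: th + s *: phi.
have cw : w = s *: phi + (1 - s) *: th by rewrite /w addrC.
have Jw : J w < J th.
  rewrite cw; apply: le_lt_trans (cvxJ _ _ (ltW s0) s1) _.
  by rewrite -subr_gt0 [ltRHS](_ : _ = s * (J th - J phi)); [rewrite mulr_gt0// subr_gt0 | ring].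
suff : region B (scaled lam) K w by move=> /minK; rewrite leNgt Jw.
split=> [|j jK]; first by rewrite cw; apply: cvxB; rewrite ?(ltW s0).
have [->|ji] := eqVneq j i; last first.
  rewrite cw; apply: scaled_cvx => //; [|exact: Dth|exact: ltW].
  by apply: Dphi; rewrite !inE ji.
rewrite /scaled/=.
pose a := lam i * (1 - s) / l; pose b := lam i * s / mu.
have a0 : 0 <= a by rewrite divr_ge0 ?mulr_ge0 ?(ltW lam0) ?(ltW l0)// subr_ge0.
have b0 : 0 < b by rewrite divr_gt0// mulr_gt0.
have ab1 : a + b <= 1.
  have : s * (1 - lam i / l + lam i / mu) = 1 - lam i / l.
    by rewrite /s mulfVK// gt_eqF//; lra.
  rewrite (_ : a = lam i / l * (1 - s)); last by rewrite /a; ring.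
  by rewrite (_ : b = lam i / mu * s); [nra | rewrite /b; ring].
have -> : lam i *: w = (a + b) *: ((a / (a + b)) *: (l *: th) +
    (1 - a / (a + b)) *: (mu *: phi)).
  have ab0 : a + b != 0 by rewrite gt_eqF//; lra.
  rewrite /w !scalerDr !scalerA; congr (_ *: _ + _ *: _).
    by rewrite (mulrC (a + b)) divfK// /a divfK// gt_eqF.
  rewrite (_ : (a + b) * _ = b); last by rewrite mulrBr mulr1 [(a + b) * _]mulrC divfK// addrAC subrr add0r.
  by rewrite /b divfK// gt_eqF.
apply: cvx_set_scale => //; last by rewrite ab1 andbT; lra.
apply: cvxC => //; first by rewrite divr_ge0//; lra.
by rewrite ler_pdivrMr; lra.
Unshelve. all: by end_near. Qed.

Lemma generic_scaling (e : R) : 0 < e < 1 ->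
  exists lam : 'I_n -> R, (forall i, 1 - e < lam i <= 1) /\
    forall K K', critical (Opt lam) K -> critical (Opt lam) K' ->
      Opt lam K = Opt lam K' -> K = K'.
Proof.
move=> /andP[e0 e1]; pose Q := ({set 'I_n} * 'I_n)%type; pose M := #|{: Q}|.+1.
pose lam (g : {ffun 'I_n -> 'I_M}) i : R := 1 - e * (g i)%:R / M%:R.
have M0 : 0 < M%:R :> R by rewrite ltr0n.
have lam_bd g i : 1 - e < lam g i <= 1.
  apply/andP; split; last by rewrite /lam gerBl divr_ge0 ?mulr_ge0// ltW.
  rewrite /lam ltrD2l ltrN2 -mulrA gtr_pMr// ltr_pdivrMr// mul1r ltr_nat.
  exact: ltn_ord.
have lam_inj g g' i : lam g i = lam g' i -> g i = g' i.
  move=> /addrI/oppr_inj/(mulIf (invr_neq0 (lt0r_neq0 M0)))/(mulfI (lt0r_neq0 e0)).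
  by move=> /eqP; rewrite eqr_nat => /eqP/val_inj.
(* A pair (K, i) with i outside K is bad when the optimum of K is radially extremal for the scaled
   constraint i. That optimum does not depend on [lam i], so at most one value of [lam i] is bad. *)
pose bad (q : Q) (g : {ffun 'I_n -> 'I_M}) := `[< [/\ q.2 \notin q.1,
  C q.2 (lam g q.2 *: Opt (lam g) q.1) &
  forall l, lam g q.2 < l -> ~ C q.2 (l *: Opt (lam g) q.1)] >].
have [||g gP] := @generic_choice n M Q bad (fun q => q.2).
- move=> q g g' /asboolP[qq Cq Nq] /asboolP[_ Cq' Nq'] gg'.
  have OE : Opt (lam g) q.1 = Opt (lam g') q.1.
    rewrite /Opt /opt; congr minimizer; apply/seteqP; split=> w [Bw Dw]; split=> // j jq.
      have := Dw j jq; rewrite /scaled/= /lam gg'//.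
      by apply: contraNneq qq => <-.
    have := Dw j jq; rewrite /scaled/= /lam gg'//.
    by apply: contraNneq qq => <-.
  apply/ffunP => j; have [->|/gg'//] := eqVneq j q.2.
  apply: lam_inj; have [lt|lt|//] := ltgtP (lam g q.2) (lam g' q.2).
    by case: (Nq _ lt); rewrite OE.
  by case: (Nq' _ lt); rewrite -OE.
- by rewrite /M.
exists (lam g); split=> // K K'.
wlog : K K' / ~~ (K \subset K') => [H cK cK' oK|].
  have [KK'|/H->//] := boolP (K \subset K').
  have [K'K|/H->//] := boolP (K' \subset K).
  by apply/eqP; rewrite finset.eqEsubset KK'.
(* By [critical_scale] the optimum of K is radially extremal for constraint i; being also the
   optimum of K', it would make (K', i) bad. *)
move=> /subsetPn[i iK iK'] cK _ oK; exfalso.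
have := gP (K', i); rewrite /bad/= => /asboolP; apply; split=> //=.
  by rewrite -oK; have [[_ /(_ i iK)]] := OptP (lam g) K.
move=> l ll; rewrite -oK; apply: critical_scale => //.
by have /andP[h _] := lam_bd g i; apply: lt_trans h; rewrite subr_gt0.
Qed.

Let one : 'I_n -> R := fun=> 1.
Let val S := J (Opt one S).

Lemma scaled_opt_le lam S : (forall i, 0 <= lam i <= 1) -> J (Opt lam S) <= val S.
Proof.
move=> lam01; have [[Bw Dw] _] := OptP one S; have [_ minS] := OptP lam S.
apply: minS; split=> // i /Dw; rewrite /scaled/= scale1r => Cw.
exact: cvx_set_scale.
Qed.

(** Shrinking the scaled optimum by 1 - e makes it feasible for the original sets, and convexity of
    J between it and 0 bounds the cost. *)
Lemma scaled_opt_ge lam (e : R) S : 0 < e < 1 -> (forall i, 1 - e < lam i <= 1) ->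
  val S <= (1 - e) * J (Opt lam S) + e * J 0.
Proof.
move=> /andP[e0 e1] lam01; have [_ minS] := OptP one S.
have [[Bw Dw] _] := OptP lam S.
have e01 : 0 <= 1 - e <= 1 by apply/andP; split; lra.
have h : region B (scaled one) S ((1 - e) *: Opt lam S).
  split=> [|i /Dw]; first exact: cvx_set_scale.
  have /andP[l0 l1] := lam01 i.
  rewrite /scaled/= scale1r => Cw.
  have -> : (1 - e) *: Opt lam S = ((1 - e) / lam i) *: (lam i *: Opt lam S).
    by rewrite scalerA mulfVK// gt_eqF//; lra.
  apply: cvx_set_scale => //; rewrite divr_ge0 ?ler_pdivrMr ?mul1r; lra.
apply: (le_trans (minS _ h)); have /andP[h0 h1] := e01.
have := cvxJ (Opt lam S) 0 h0 h1; rewrite scaler0 addr0.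
by move/le_trans; apply; rewrite subKr.
Qed.

Lemma card_violations_le N k : (d < N)%N -> (d + k <= n)%N ->
  (#|[set S : {set 'I_n} | (#|S| == N) &&
      (k <= #|[set z | (z \notin S) && (val S < val (z |: S))%R]|)]%SET| <=
  \sum_(i < d.+1) 'C(d + k, i) * 'C(n - (d + k), N - i))%N.
Proof.
move=> dN dkn.
(* Only finitely many pairs (S, z) occur, so one e works for all: every strict increase of the value
   is then too large to be lost in the scaling. *)
have [e e01 eP] : exists2 e : R, 0 < e < 1 & forall q : {set 'I_n} * 'I_n,
    val q.1 < val (q.2 |: q.1) -> e * (J 0 - val q.1) < val (q.2 |: q.1) - val q.1.
  have : \forall e \near (0 : R)^'+, forall q : {set 'I_n} * 'I_n,
    val q.1 < val (q.2 |: q.1) -> e * (J 0 - val q.1) < val (q.2 |: q.1) - val q.1.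
    apply: filter_forall => q; have [lt|] := boolP (val q.1 < val (q.2 |: q.1)).
      pose g := J 0 - val q.1; pose h := val (q.2 |: q.1) - val q.1.
      have h0 : 0 < h by rewrite subr_gt0.
      have c0 : 0 < `|g| + 1 by rewrite ltr_wpDl.
      near=> e => _; rewrite -/g -/h.
      have e0 : 0 < e by near: e; exact: nbhs_right_gt.
      apply: (@le_lt_trans _ _ (e * (`|g| + 1))).
        by rewrite ler_pM2l// (le_trans (ler_norm _))// lerDl.
      by rewrite -ltr_pdivlMr//; near: e; apply: nbhs_right_lt; rewrite divr_gt0.
    by move=> _; near=> e.
  move=> near0; near (0 : R)^'+ => e; exists e; last by near: e.
  by apply/andP; split; near: e; [exact: nbhs_right_gt|exact: nbhs_right_lt].
have [lam [lam01 crit_inj]] := generic_scaling e01.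
have /andP[e0 e1] := e01.
have lam_01 i : 0 <= lam i <= 1.
  by have /andP[h ->] := lam01 i; rewrite andbT; lra.
have sc := @scaled_closed lam; have sv := @scaled_cvx lam; have sz := scaled0 lam.
apply: leq_trans (card_violated_le (ok := ok (scaled lam)) _ _ _ crit_inj dN dkn).
- apply/subset_leq_card/fintype.subsetP => S; rewrite !inE => /andP[->]/=.
  move=> /leq_trans; apply; apply/subset_leq_card/fintype.subsetP => z.
  rewrite !inE => /andP[zS vz]; rewrite zS/=; apply/negP => oz.
  have OE : Opt lam (z |: S) = Opt lam S.
    apply: (opt_extend contJ strictJ) => //; first exact: finset.subsetUr.
    move=> i /setU1P[->|iS]; first exact: oz.
    by have [[_ /(_ i iS) Di] _] := OptP lam S; apply/asboolP.
  have h1 := scaled_opt_le S lam_01.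
  have h2 := scaled_opt_ge (z |: S) e01 lam01.
  have := eP (S, z) vz; rewrite /= => h3; rewrite OE in h2.
  have : (1 - e) * J (Opt lam S) <= (1 - e) * val S by rewrite ler_wpM2l//; lra.
  lra.
- by move=> S i iS; apply: (opt_ok contJ).
- by move=> S S' SS' oS; apply: (opt_extend contJ strictJ).
- by move=> K; apply: (critical_card cvxJ contJ strictJ).
Unshelve. all: by end_near. Qed.
End Perturbation.

(** * Product measures on tuples *)

Lemma measurable_pattern d (T : measurableType d) (I : finType) (E : I -> set T)
    (Q : {set I} -> bool) : (forall i, measurable (E i)) ->
  measurable [set x | Q [set i | `[< E i x >]]%SET].
Proof.
move=> mE.
pose F (S : {set I}) := \bigcap_(i in [set: I]) (if i \in S then E i else ~` E i).
rewrite (_ : mkset _ = \bigcup_(S in [set S | Q S]) F S).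
  apply: fin_bigcup_measurable; first exact: finite_finset.
  move=> S _; apply: fin_bigcap_measurable; first exact: finite_finset.
  by move=> i _; case: ifP => _; [exact: mE | exact: measurableC].
apply/seteqP; split=> x /=.
  move=> Qx; exists [set i | `[< E i x >]]%SET => // i _.
  by rewrite inE; case: asboolP.
move=> [S QS FS]; rewrite (_ : finset _ = S)//.
apply/setP => i; rewrite inE; have := FS i Logic.I; case: ifP => _; first exact: asboolT.
exact: asboolF.
Qed.

Section TupleMeasureTheory.
Context (d : measure_display) (T : measurableType d) (R : realType).
Variable P : probability T R.
Local Open Scope ereal_scope.

Let cons_pair m (z : T * m.-tuple T) : m.+1.-tuple T := [tuple of z.1 :: z.2].

Let measurable_cons_pair m : measurable_fun [set: T * m.-tuple T] (@cons_pair m).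
Proof. exact: measurable_cons. Qed.

HB.instance Definition _ m := isMeasurableFun.Build _ _ _ _ (@cons_pair m)
  (@measurable_cons_pair m).

Let dirac_nil : probability (0.-tuple T) R := \d_([tuple] : 0.-tuple T).

(** The recursion of [tuple_measure], with the probability structure carried along. *)
Fixpoint tuple_probability (n : nat) : probability (n.-tuple T) R :=
  match n with
  | 0 => dirac_nil
  | m.+1 => distribution (P \x tuple_probability m) (@cons_pair m)
  end.

Lemma tuple_measureE n : tuple_measure P n = tuple_probability n.
Proof. by elim: n => [|n IH] //=; rewrite IH. Qed.

Notation PT := tuple_probability.

Let measurable_consS m (A : set (m.+1.-tuple T)) : measurable A ->
  measurable (@cons_pair m @^-1` A).
Proof. by move=> mA; rewrite -[X in measurable X]setTI; exact: measurable_cons_pair. Qed.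

Lemma measurable_cons_section m (A : set (m.+1.-tuple T)) (x : T) : measurable A ->
  measurable [set w : m.-tuple T | A [tuple of x :: w]].
Proof.
move=> mA; have := measurable_xsection x (measurable_consS mA).
by congr measurable; apply/seteqP; split=> w; rewrite /xsection/= inE.
Qed.

Lemma measurable_fun_cons_section m (A : set (m.+1.-tuple T)) : measurable A ->
  measurable_fun setT ((fun x => PT m [set w : m.-tuple T | A [tuple of x :: w]]) : T -> \bar R).
Proof.
move=> mA; have := measurable_fun_xsection (PT m) (measurable_consS mA).
congr (measurable_fun _ _); apply/funext => x; congr (PT m _).
by apply/seteqP; split=> w; rewrite /xsection/= inE.
Qed.

Lemma tuple_probabilityS m (A : set (m.+1.-tuple T)) :
  PT m.+1 A = \int[P]_(x in setT) PT m [set w : m.-tuple T | A [tuple of (x : T) :: w]].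
Proof.
apply: eq_integral => x _ /=; congr (PT m _).
by apply/seteqP; split=> w; rewrite /xsection/= inE.
Qed.

Lemma measurable_box n (A : 'I_n -> set T) : (forall i, measurable (A i)) ->
  measurable [set w : n.-tuple T | forall i, A i (tnth w i)].
Proof.
move=> mA; rewrite (_ : mkset _ =
    \bigcap_(i in [set: 'I_n]) ((fun w : n.-tuple T => tnth w i) @^-1` A i)).
  apply: fin_bigcap_measurable; first exact: finite_finset.
  by move=> i _; rewrite -[X in measurable X]setTI; exact: measurable_tnth.
by apply/seteqP; split=> w /= h i; [move=> _; exact: h | exact: h].
Qed.

Lemma tuple_probability_box n (A : 'I_n -> set T) : (forall i, measurable (A i)) ->
  PT n [set w | forall i, A i (tnth w i)] = \prod_(i < n) P (A i).
Proof.
elim: n A => [|n IH] A mA.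
  rewrite big_ord0 /= diracE mem_set//; by case.
rewrite tuple_probabilityS big_ord_recl.
rewrite (eq_integral (fun x => (\1_(A ord0) x)%:E * \prod_(i < n) P (A (lift ord0 i)))).
  rewrite ge0_integralZr//=.
  - by rewrite integral_indic// setIT.
  - by apply/measurable_EFinP; exact: measurable_indic.
  - by apply: prode_ge0 => i _.
move=> x _; rewrite indicE; have [/set_mem xA|xA] := boolP (x \in A ord0).
  rewrite mul1e -IH//; congr (PT n _); apply/seteqP; split=> w /= h i.
    by have := h (lift ord0 i); rewrite tnthS.
  by case: (unliftP ord0 i) => [j ->|->//]; rewrite tnthS; exact: h.
rewrite mul0e (_ : mkset _ = set0) ?measure0//.
by apply/seteqP; split=> w //= /(_ ord0)/mem_set; rewrite (negPf xA).
Qed.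

(** Boxes form a generating pi-system, and on a box a permutation only reorders the factors of
    [tuple_probability_box]. *)
Lemma tuple_probability_perm n (s : {perm 'I_n}) (A : set (n.-tuple T)) :
  measurable A -> PT n [set w | A [tuple tnth w (s i) | i < n]] = PT n A.
Proof.
pose f (w : n.-tuple T) := [tuple tnth w (s i) | i < n].
have mf : measurable_fun setT f.
  apply/measurable_fun_tnthP => i.
  rewrite (_ : _ \o _ = fun w => tnth w (s i)); first exact: measurable_tnth.
  by apply/funext => w /=; rewrite tnth_mktuple.
pose F : {mfun (n.-tuple T) >-> (n.-tuple T)} := mfun_Sub (mem_set mf).
move=> mA.
pose G : set (set (n.-tuple T)) := [set B | exists2 A : 'I_n -> set T,
  forall i, measurable (A i) & B = [set w | forall i, A i (tnth w i)]].
apply: (measure_unique G (fun=> setT) _ _ _ _ (distribution (PT n) F) (PT n)) => //.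
- apply/seteqP; split.
    apply: smallest_sub; first exact: smallest_sigma_algebra.
    move=> B; rewrite -bigcup_seq => -[i _ [C mC <-]]; apply: sub_sigma_algebra.
    exists (fun j => if j == i then C else setT) => [j|]; first by case: ifP.
    rewrite setTI; apply/seteqP; split=> w /= h.
      by move=> j; case: eqP => // ->.
    by have := h i; rewrite eqxx.
  apply: smallest_sub; first exact: sigma_algebra_measurable.
  by move=> _ [C mC ->]; exact: measurable_box.
- move=> _ _ [C mC ->] [D mD ->]; exists (fun i => C i `&` D i).
    by move=> i; exact: measurableI.
  by apply/seteqP; split=> w /= => [[h1 h2] i|h]; split=> // i; have [] := h i.
- by move=> _; exists (fun=> setT) => //; apply/seteqP; split.
- by rewrite bigcup_const//; exists 0.
- move=> _ [C mC ->]; rewrite [RHS](tuple_probability_box mC).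
  transitivity (PT n [set w | forall i, C ((s^-1)%g i) (tnth w i)]); last first.
    rewrite (@tuple_probability_box n (fun i => C ((s^-1)%g i)))// (reindex_inj (@perm_inj _ s))/=.
    by apply: eq_bigr => i _; rewrite permK.
  congr (PT n _); apply/seteqP; split=> w /= h i.
    by have := h ((s^-1)%g i); rewrite tnth_mktuple permKV.
  by rewrite tnth_mktuple; have := h (s i); rewrite permK.
- by move=> _; apply: le_lt_trans (ltry 1); exact: probability_le1.
Qed.

(** A one-sided Fubini argument that conditions on the first n coordinates one at a time. *)
Lemma tuple_probability_split n m (A : set ((n + m).-tuple T)) (B : set (n.-tuple T))
    (p : R) : (0 <= p)%R -> measurable A -> measurable B ->
  (forall x, B x -> p%:E <= PT m [set y | A (cat_tuple x y)]) ->
  p%:E * PT n B <= PT (n + m) A.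
Proof.
move=> p0; elim: n A B => [|n IH] A B mA mB H.
  rewrite /= diracE; have [/set_mem B0|_] := boolP (_ \in B); last by rewrite mule0.
  rewrite mule1; apply: le_trans (H _ B0) _; rewrite le_eqVlt; apply/orP; left.
  apply/eqP; congr (PT m _); apply/seteqP; split=> y /=.
    by congr A; exact: val_inj.
  by congr A; exact: val_inj.
rewrite [X in X <= _](_ : _ = \int[P]_x (p%:E * PT n [set w : n.-tuple T | B [tuple of (x : T) :: w]])).
  rewrite [leRHS]tuple_probabilityS; apply: ge0_le_integral => //.
  - by move=> x _; rewrite mule_ge0.
  - apply: measurable_funeM; exact: measurable_fun_cons_section.
  - exact: (@measurable_fun_cons_section (n + m)%N).
  move=> x _; apply: IH.
  - exact: (@measurable_cons_section (n + m)%N).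
  - exact: measurable_cons_section.
  move=> w Bw; apply: le_trans (H _ Bw) _; rewrite le_eqVlt; apply/orP; left.
  apply/eqP; congr (PT m _); apply/seteqP; split=> y /=; congr A; exact: val_inj.
rewrite tuple_probabilityS ge0_integralZl//.
exact: measurable_fun_cons_section.
Qed.

(* Chernoff's exponential-moment bound, obtained by conditioning on the first
   coordinate. *)
Lemma tuple_probability_count m k (W : set T) (e c : R) : measurable W ->
  (0 <= e)%R -> e%:E <= P W -> (1 <= c)%R ->
  PT m [set w | (#|[set i | `[< W (tnth w i) >]]%SET| < k)%N] <=
  (c ^+ k * (e / c + 1 - e) ^+ m)%:E.
Proof.
move=> mW e0 eW c1.
have c0 : (0 < c)%R by exact: lt_le_trans c1.
have mE n l : measurable [set w : n.-tuple T |
    (#|[set i | `[< W (tnth w i) >]]%SET| < l)%N].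
  apply: (measurable_pattern (E := fun i => (fun w : n.-tuple T => tnth w i) @^-1` W)
    (fun S => #|S| < l)%N).
  by move=> i; rewrite -[X in measurable X]setTI; exact: measurable_tnth.
have W1 : P W <= 1 by exact: probability_le1.
have e1 : (e <= 1)%R by rewrite -lee_fin (le_trans eW).
set b := (e / c + 1 - e)%R.
have b0 : (0 <= b)%R by rewrite /b -addrA addr_ge0 ?divr_ge0 ?subr_ge0// ltW.
have cnt n x (w : n.-tuple T) :
    #|[set i | `[< W (tnth [tuple of x :: w] i) >]]%SET| =
    (`[< W x >] + #|[set i | `[< W (tnth w i) >]]%SET|)%N.
  rewrite -!sum1_card big_mkcond big_ord_recl [in RHS]big_mkcond/=.
  congr (_ + _)%N; first by rewrite inE tnth0; case: (`[< W x >]).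
  by apply: congr_big => // i _; rewrite !inE tnthS.
elim: m k => [|m IH] k.
  rewrite expr0 mulr1; apply: (@le_trans _ _ 1); first by apply: probability_le1; exact: mE.
  by rewrite lee_fin exprn_ege1.
pose K := (c ^+ k * b ^+ m)%R.
have K0 : (0 <= K)%R by rewrite mulr_ge0 ?exprn_ge0// ltW.
have [v vE] : exists v : R, P W = v%:E.
  by exists (fine (P W)); rewrite fineK// fin_num_measure.
have PC : P (~` W) = (1 - v)%:E by rewrite probability_setC// vE EFinB.
have mWC : measurable (~` W) by exact: measurableC.
rewrite tuple_probabilityS.
apply: (@le_trans _ _ (\int[P]_(x in setT)
    ((K / c)%:E * (\1_W x)%:E + K%:E * (\1_(~` W) x)%:E))).
  apply: ge0_le_integral => //.
  - exact: (@measurable_fun_cons_section m).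
  - apply: emeasurable_funD; apply: measurable_funeM; apply/measurable_EFinP;
      exact: measurable_indic.
  move=> x _; have [Wx|Wx] := pselect (W x).
    rewrite indicE mem_set// indicE memNset; last exact.
    rewrite mule1 mule0 adde0.
    (* A hit lowers the threshold from k + 1 to k and costs one factor c; at threshold 0 the event
       is empty. *)
    case: k @K K0 => [|k] K K0.
      rewrite (_ : mkset _ = set0) ?measure0 ?lee_fin ?divr_ge0// ?ltW//.
      by apply/seteqP; split.
    have -> : (K / c = c ^+ k * b ^+ m)%R.
      by rewrite /K exprSr [X in (X / _)%R]mulrAC mulfK// gt_eqF.
    have -> : [set w : m.-tuple T | (#|[set i | `[< W (tnth [tuple of x :: w] i) >]]%SET| < k.+1)%N] =
        [set w : m.-tuple T | (#|[set i | `[< W (tnth w i) >]]%SET| < k)%N].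
      by apply/seteqP; split=> w /=; rewrite cnt asboolT.
    exact: IH.
  rewrite indicE memNset// indicE mem_set// mule0 mule1 add0e.
  have -> : [set w : m.-tuple T | (#|[set i | `[< W (tnth [tuple of x :: w] i) >]]%SET| < k)%N] =
      [set w : m.-tuple T | (#|[set i | `[< W (tnth w i) >]]%SET| < k)%N].
    by apply/seteqP; split=> w /=; rewrite cnt asboolF.
  exact: IH.
rewrite ge0_integralD//; last first.
- by apply: measurable_funeM; apply/measurable_EFinP; exact: measurable_indic.
- by move=> x _; rewrite mule_ge0// lee_fin.
- by apply: measurable_funeM; apply/measurable_EFinP; exact: measurable_indic.
- by move=> x _; rewrite mule_ge0// lee_fin divr_ge0// ltW.
rewrite ge0_integralZl_EFin//; last first.
- by rewrite divr_ge0// ltW.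
- by apply/measurable_EFinP; exact: measurable_indic.
rewrite ge0_integralZl_EFin//; last by apply/measurable_EFinP; exact: measurable_indic.
rewrite !integral_indic// !setIT.
rewrite [X in _ * X + _]vE [X in _ + _ * X]PC -!EFinM -EFinD lee_fin.
rewrite exprS mulrCA -/K.
rewrite vE lee_fin in eW.
(* Since [K / c <= K], replacing e by the true probability v >= e can only lower the bound. *)
have : (0 <= (v - e) * (K - K / c))%R.
  by rewrite mulr_ge0 ?subr_ge0// ler_pdivrMr// ler_peMr.
have -> : (b * K = e * (K / c) + K - e * K)%R by rewrite /b; ring.
by move: (K / c)%R => t; nra.
Qed.
End TupleMeasureTheory.

(** * Binomial tails *)

Lemma ffact_le_exp (n m : nat) : (n ^_ m <= n ^ m)%N.
Proof.
by elim: m => [|m IH] //; rewrite ffactnSr expnSr leq_mul// leq_subr.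
Qed.

Lemma ffact_ge_exp (n m i : nat) : (i <= n)%N -> (m ^ i <= (n + m) ^_ i)%N.
Proof.
elim: i => [|i IH] // ni; rewrite ffactnSr expnSr leq_mul ?IH//; first exact: ltnW.
by lia.
Qed.

Section BinomialTail.
Context {R : realType}.
Implicit Types (e c : R) (N m k : nat).

Definition binomial_tail N m e : R :=
  \sum_(k < m) 'C(N, k)%:R * e ^+ k * (1 - e) ^+ (N - k).

Lemma binomial_tail_total N m e : (N < m)%N -> 0 <= e <= 1 -> 1 <= binomial_tail N m e.
Proof.
move=> Nm /andP[e0 e1].
have -> : 1 = ((1 - e) + e) ^+ N by rewrite subrK expr1n.
rewrite exprDn /binomial_tail (big_ord_widen m
  (fun i => (1 - e) ^+ (N - i) * e ^+ i *+ 'C(N, i)))//.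
rewrite big_mkcond/=; apply: ler_sum => i _; case: ifP => _.
  by rewrite le_eqVlt -mulr_natl; apply/orP; left; apply/eqP; ring.
by rewrite !mulr_ge0 ?exprn_ge0// subr_ge0.
Qed.

(** Markov's inequality for c^(-X) with X binomial: each term i <= m gains a factor c^(m - i) >= 1,
    and the full sum is a binomial expansion. *)
Lemma binomial_tail_chernoff N m e c : 0 <= e <= 1 -> 1 <= c ->
  binomial_tail N m.+1 e <= c ^+ m * (e / c + 1 - e) ^+ N.
Proof.
move=> /andP[e0 e1] c1; have c0 : 0 < c by exact: lt_le_trans c1.
rewrite (_ : e / c + 1 - e = (1 - e) + e / c); last by ring.
rewrite exprDn mulr_sumr /binomial_tail.
pose F i := 'C(N, i)%:R * e ^+ i * (1 - e) ^+ (N - i).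
pose G i := c ^+ m * ((1 - e) ^+ (N - i) * (e / c) ^+ i *+ 'C(N, i)).
pose L := (m.+1 + N.+1)%N.
rewrite (big_ord_widen L F) ?leq_addr// (big_ord_widen L G) ?leq_addl//.
rewrite big_mkcond [leRHS]big_mkcond/=; apply: ler_sum => i _.
have G0 : 0 <= G i.
  rewrite /G mulr_ge0 ?exprn_ge0 ?(ltW c0)// mulrn_wge0// mulr_ge0// exprn_ge0//.
    by rewrite subr_ge0.
  by rewrite divr_ge0// ltW.
case: ifP => im; case: ifP => iN //.
  rewrite /F /G expr_div_n -[in leRHS]mulr_natl.
  rewrite (_ : _ * (_ * _) =
    (c ^+ m / c ^+ i) * ('C(N, i)%:R * e ^+ i * (1 - e) ^+ (N - i))); last by ring.
  rewrite ler_peMl ?mulr_ge0 ?exprn_ge0 ?subr_ge0//.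
  by rewrite ler_pdivlMr ?exprn_gt0// mul1r ler_weXn2l.
by rewrite /F bin_small ?mul0r// ltnNge -ltnS iN.
Qed.

Lemma expR_ge1Dxx (r : R) : 0 <= r -> 1 + r + r ^+ 2 / 2 <= expR r.
Proof.
move=> r0; rewrite /expR.
have -> : 1 + r + r ^+ 2 / 2 = series (exp_coeff r) 3.
  rewrite /series/= !big_nat_recr//= big_geq// /exp_coeff/= add0r.
  by rewrite expr0 expr1 !divr1.
apply: nondecreasing_cvgn_le; last exact: is_cvg_series_exp_coeff.
by apply: nondecreasing_series => n _ _; exact: exp_coeff_ge0.
Qed.

Lemma sample_size_sufficient N m e delta : (0 < m)%N -> 0 < e < 1 -> 0 < delta < 1 ->
  e^-1 * (m%:R - 1 + ln delta^-1 + Num.sqrt (2 * (m%:R - 1) * ln delta^-1)) <= N%:R ->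
  binomial_tail N m e <= delta.
Proof.
case: m => // m _ /andP[e0 e1] /andP[d0 d1].
rewrite -natr1 addrK mulrC ler_pdivrMr//; set L := ln _ => hN.
have dE : delta = expR (- L) by rewrite /L lnV ?posrE// opprK lnK ?posrE.
have L0 : 0 < L by rewrite ln_gt0// invf_gt1.
have e01 : 0 <= e <= 1 by rewrite !ltW.
have [m0|m_gt0] := posnP m.
  move: hN; rewrite m0 add0r mulr0 mul0r sqrtr0 addr0 => hN.
  rewrite /binomial_tail big_ord1 bin0 mul1r expr0 mul1r subn0 dE.
  apply: (@le_trans _ _ (expR (- e) ^+ N)).
    by rewrite lerXn2r ?nnegrE ?expR_ge0 ?subr_ge0 ?(ltW e1)//; exact: expR_ge1Dx.
  by rewrite -expRM_natl ler_expR mulrN lerN2.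
have mR : 0 < m%:R :> R by rewrite ltr0n.
(* After the case analysis m stands for [n_theta] - 1. This r gives L = m r^2 / 2, so the hypothesis
   reads N e >= m (1 + r + r^2 / 2), and Chernoff's bound with c = exp r needs only 1 + r + r^2 / 2
   <= exp r. *)
pose r := Num.sqrt (2 * L / m%:R).
have r0 : 0 <= r by exact: sqrtr_ge0.
have r2 : r ^+ 2 = 2 * L / m%:R by rewrite sqr_sqrtr// divr_ge0 ?mulr_ge0// ltW.
have LE : L = m%:R * (r ^+ 2 / 2) by rewrite r2; field; rewrite gt_eqF.
have sE : Num.sqrt (2 * m%:R * L) = m%:R * r.
  rewrite (_ : 2 * m%:R * L = (m%:R * r) ^+ 2); last by rewrite exprMn r2; field; rewrite gt_eqF.
  by rewrite sqrtr_sqr ger0_norm// mulr_ge0// ltW.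
have c1 : 1 <= expR r by rewrite -expR0 ler_expR.
apply: le_trans (binomial_tail_chernoff N m e01 c1) _.
pose g := 1 - expR (- r).
have g0 : 0 <= g by rewrite subr_ge0 -expR0 ler_expR oppr_le0.
have h1 : (e / expR r + 1 - e) ^+ N <= expR (- (e * g)) ^+ N.
  rewrite -expRN (_ : _ - e = 1 + - (e * g)); last by rewrite /g; ring.
  rewrite lerXn2r ?nnegrE ?expR_ge0//; last exact: expR_ge1Dx.
  rewrite (_ : _ + _ = (1 - e) + e * expR (- r)); last by rewrite /g; ring.
  by rewrite addr_ge0 ?subr_ge0 ?mulr_ge0 ?expR_ge0// ltW.
apply: (@le_trans _ _ (expR r ^+ m * expR (- (e * g)) ^+ N)).
  by rewrite ler_wpM2l// exprn_ge0// expR_ge0.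
rewrite -!expRM_natl -expRD dE ler_expR.
have h2 : (1 + r + r ^+ 2 / 2) * expR (- r) <= 1.
  by rewrite expRN ler_pdivrMr ?expR_gt0// mul1r expR_ge1Dxx.
have h3 : m%:R * (r + r ^+ 2 / 2) <= m%:R * ((1 + r + r ^+ 2 / 2) * g).
  by rewrite ler_pM2l// /g mulrBr mulr1; lra.
have h4 : m%:R * (1 + r + r ^+ 2 / 2) * g <= N%:R * e * g.
  rewrite ler_wpM2r//; move: hN; rewrite sE.
  by rewrite {1}LE !mulrDr mulr1; lra.
rewrite LE; move: h3 h4; rewrite !mulrA !mulrDr; nra.
Qed.

(** Drawing without replacement is compared with drawing with replacement: in the numerator falling
    factorials are at most powers; in the denominator (N + M)^N exceeds the falling factorial by at
    most the factor ((N + M) / M)^N. *)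
Lemma hypergeometric_le_binomial_tail N M L d : (d < N)%N -> (0 < M)%N ->
  (L <= N + M)%N ->
  (\sum_(i < d.+1) 'C(L, i) * 'C(N + M - L, N - i))%:R / 'C(N + M, N)%:R <=
  (1 + N%:R / M%:R) ^+ N * binomial_tail N d.+1 (L%:R / (N + M)%:R) :> R.
Proof.
move=> dN M0 LNM; set n := (N + M)%N.
have nR : 0 < n%:R :> R by rewrite ltr0n /n; lia.
have MR : 0 < M%:R :> R by rewrite ltr0n.
have CR : 0 < 'C(n, N)%:R :> R by rewrite ltr0n bin_gt0 /n leq_addr.
have FR : 0 < N`!%:R :> R by rewrite ltr0n fact_gt0.
have T0 : 0 <= binomial_tail N d.+1 (L%:R / n%:R).
  apply: sumr_ge0 => i _; rewrite !mulr_ge0 ?exprn_ge0 ?divr_ge0//.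
  by rewrite subr_ge0 ler_pdivrMr// mul1r ler_nat.
rewrite ler_pdivrMr// -(ler_pM2r FR).
have h1 : (\sum_(i < d.+1) 'C(L, i) * 'C(n - L, N - i))%:R * N`!%:R <=
    n%:R ^+ N * binomial_tail N d.+1 (L%:R / n%:R).
  rewrite natr_sum mulr_suml mulr_sumr; apply: ler_sum => i _.
  have iN : (i <= N)%N by apply: ltnW; apply: leq_trans (ltn_ord i) _.
  have -> : n%:R ^+ N * ('C(N, i)%:R * (L%:R / n%:R) ^+ i *
      (1 - L%:R / n%:R) ^+ (N - i)) = ('C(N, i) * (L ^ i * (n - L) ^ (N - i)))%:R :> R.
    rewrite -{1}(subnK iN) exprD !natrM !natrX natrB// !expr_div_n.
    rewrite (_ : 1 - L%:R / n%:R = (n%:R - L%:R) / n%:R); last by field; rewrite gt_eqF.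
    rewrite expr_div_n; field; rewrite !expf_neq0// gt_eqF//.
  rewrite -natrM ler_nat -(bin_fact iN).
  rewrite (_ : (_ * _ * _)%N = 'C(N, i) * (('C(L, i) * i`!) *
    ('C(n - L, N - i) * (N - i)`!)))%N; last by ring.
  by rewrite !bin_ffact leq_mul2l leq_mul ?orbT// ffact_le_exp.
apply: le_trans h1 _.
rewrite [leRHS](_ : _ = (1 + N%:R / M%:R) ^+ N * ('C(n, N)%:R * N`!%:R) *
  binomial_tail N d.+1 (L%:R / n%:R)); last by ring.
rewrite ler_wpM2r//.
have -> : 1 + N%:R / M%:R = n%:R / M%:R :> R.
  by rewrite /n natrD; field; rewrite gt_eqF.
rewrite expr_div_n mulrAC ler_pdivlMr ?exprn_gt0// ler_wpM2l ?exprn_ge0//.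
by rewrite -natrX -natrM ler_nat bin_ffact ffact_ge_exp.
Qed.

Lemma binomial_tail_continuous N m : continuous (binomial_tail N m).
Proof.
rewrite (_ : binomial_tail N m =
  horner (\sum_(k < m) ('C(N, k)%:R%:P * 'X^k * (1 - 'X) ^+ (N - k)))).
  exact: continuous_horner.
apply/funext => e; rewrite /binomial_tail horner_sum; apply: eq_bigr => i _.
by rewrite !hornerE.
Qed.

(** The error term decays exponentially in M when k is about kap M with kap < e, but not for kap =
    e. The limit M -> oo is therefore taken at fixed kap, and kap tends to e afterwards. *)
Lemma binomial_tail_limit (b e : R) N d : (d < N)%N -> 0 <= b -> 0 < e < 1 ->
  (forall M k (c : R), (k <= M)%N -> 1 <= c ->
    b * (1 - c ^+ k * (e / c + 1 - e) ^+ M) <=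
    (\sum_(i < d.+1) 'C(d + k, i) * 'C(N + M - (d + k), N - i))%:R / 'C(N + M, N)%:R) ->
  b <= binomial_tail N d.+1 e.
Proof.
move=> dN b0 /andP[e0 e1] H.
suff Hk kap : 0 < kap < e -> b <= binomial_tail N d.+1 kap.
  apply: (@ler_cvg_to _ (e^'-) _ R (fun=> b) (binomial_tail N d.+1)).
  - exact: cvg_cst.
  - exact: (cvg_at_left_filter (@binomial_tail_continuous N d.+1 e)).
  near=> kap; apply: Hk; apply/andP; split; near: kap; last exact: nbhs_left_lt.
  exact: nbhs_left_gt.
move=> /andP[k0 ke].
(* This makes [kap * c] the midpoint of kap and e, hence the decay rate [s] below positive. *)
pose eta := (e / kap - 1) / 2; pose c := 1 + eta.
have eta0 : 0 < eta by rewrite divr_gt0// subr_gt0 ltr_pdivlMr// mul1r.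
have c1 : 1 <= c by rewrite lerDl ltW.
have c0 : 0 < c by exact: lt_le_trans c1.
have kce : kap * c < e.
  by rewrite /c /eta (_ : kap * _ = (kap + e) / 2); [lra | field; rewrite gt_eqF].
pose s := eta * (e / c - kap).
have s0 : 0 < s by rewrite mulr_gt0// subr_gt0 ltr_pdivlMr.
pose k M := Num.truncn (kap * M%:R).
have kM M : (k M)%:R <= kap * M%:R < (k M)%:R + 1.
  by rewrite natr1; apply: truncn_itv; rewrite mulr_ge0// ltW.
have kleM M : (k M <= M)%N.
  rewrite -(ler_nat R); have /andP[h _] := kM M; apply: le_trans h _.
  by rewrite ler_piMl//; lra.
have hq M : c ^+ k M * (e / c + 1 - e) ^+ M <= expR (- s) ^+ M.
  have h1 : c ^+ k M <= expR (eta * (kap * M%:R)).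
    apply: (@le_trans _ _ (expR eta ^+ k M)).
      by rewrite lerXn2r ?nnegrE ?expR_ge0 ?(ltW c0)//; exact: expR_ge1Dx.
    rewrite -expRM_natl ler_expR mulrC ler_pM2l//.
    by have /andP[] := kM M.
  have h2 : (e / c + 1 - e) ^+ M <= expR (- (eta * (e / c))) ^+ M.
    rewrite (_ : _ - e = 1 + - (eta * (e / c))); last first.
      by rewrite /c; field; rewrite gt_eqF.
    rewrite lerXn2r ?nnegrE ?expR_ge0//; last exact: expR_ge1Dx.
    rewrite (_ : _ + _ = e / c + (1 - e)); last by rewrite /c; field; rewrite gt_eqF.
    by rewrite addr_ge0 ?divr_ge0 ?subr_ge0 ?ltW.
  have h3 : 0 <= (e / c + 1 - e) ^+ M.
    by rewrite exprn_ge0// -addrA addr_ge0 ?divr_ge0 ?subr_ge0 ?ltW.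
  apply: (@le_trans _ _ (expR (eta * (kap * M%:R)) * expR (- (eta * (e / c))) ^+ M)).
    by apply: ler_pM => //; rewrite exprn_ge0// ltW.
  rewrite -!expRM_natl -expRD ler_expR /s; lra.
pose x M := (d + k M)%:R / (N + M)%:R : R.
have xk : x M @[M --> \oo] --> kap.
  apply/cvgrPdist_le => eps eps0; near=> M.
  have M0 : 0 < M%:R :> R by rewrite ltr0n; near: M; exact: nbhs_infty_gt.
  have nM : 0 < (N + M)%:R :> R by rewrite natrD ltr_wpDl.
  pose K := d%:R + 1 + N%:R : R.
  have K0 : 0 < K by rewrite /K -addrA ltr_wpDl// ltr_pwDl.
  have KM : K <= eps * M%:R.
    rewrite mulrC -ler_pdivrMr//; near: M; exact: nbhs_infty_ger.
  rewrite /x (_ : kap - _ = (kap * (N + M)%:R - (d + k M)%:R) / (N + M)%:R); last first.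
    by rewrite mulrBl mulfK// gt_eqF.
  rewrite normrM [X in _ * X]gtr0_norm ?invr_gt0// ler_pdivrMr//.
  have /andP[h1 h2] := kM M.
  have hN : kap * N%:R <= N%:R by rewrite ler_piMl//; lra.
  have hN0 : 0 <= kap * N%:R by rewrite mulr_ge0// ltW.
  have heN : 0 <= eps * N%:R by rewrite mulr_ge0// ltW.
  have d0 : 0 <= d%:R :> R by [].
  rewrite !natrD; move: KM; rewrite /K => KM.
  by rewrite ler_norml; apply/andP; split; lra.
apply: (@ler_cvg_to _ \oo _ _
  (fun M => b * (1 - expR (- s) ^+ M))
  (fun M => (1 + N%:R * M%:R^-1) ^+ N * binomial_tail N d.+1 (x M))).
- rewrite -[X in _ --> X]mulr1; apply: cvgM; first exact: cvg_cst.
  rewrite -[X in _ --> X]subr0; apply: cvgB; first exact: cvg_cst.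
  by apply: cvg_expr; rewrite ger0_norm ?expR_ge0// -expR0 ltr_expR oppr_lt0.
- rewrite -[X in _ --> X]mul1r; apply: cvgM; last first.
    exact: (cvg_comp _ _ xk (@binomial_tail_continuous N d.+1 kap)).
  have h : (1 + N%:R * M%:R^-1 : R) @[M --> \oo] --> (1 : R).
    rewrite -[X in _ --> X]addr0; apply: cvgD; first exact: cvg_cst.
    rewrite -[X in _ --> X](mulr0 N%:R); apply: cvgM; first exact: cvg_cst.
    apply/gtr0_cvgV0; last exact: cvgr_idn.
    by near=> M; rewrite ltr0n; near: M; exact: nbhs_infty_gt.
  by have := cvg_comp _ _ h (@exprn_continuous R N 1); rewrite expr1n.
near=> M.
have M0 : (0 < M)%N by near: M; exact: nbhs_infty_gt.
apply: (@le_trans _ _ (b * (1 - c ^+ k M * (e / c + 1 - e) ^+ M))).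
  by rewrite ler_wpM2l// lerD2l lerN2.
apply: le_trans (H M (k M) c (kleM M) c1) _.
apply: hypergeometric_le_binomial_tail => //.
by have := kleM M; lia.
Unshelve. all: by end_near. Qed.
End BinomialTail.

(** * Certificates on an interval *)

Section MarkovLukacs.
Context {R : realType}.
Implicit Types (p q r s : {poly R}) (a b c : R).

Lemma horner_ge0_right p c e : c < e -> (forall y, c < y < e -> 0 <= p.[y]) -> 0 <= p.[c].
Proof.
move=> ce H; apply: (@ler_cvg_to _ (c^'+) _ R (fun=> 0) (horner p)).
- exact: cvg_cst.
- exact: (cvg_at_right_filter (@continuous_horner _ p c)).
near=> y; apply: H; apply/andP; split; near: y; [exact: nbhs_right_gt|exact: nbhs_right_lt].
Unshelve. all: by end_near. Qed.

Lemma horner_ge0_left p c e : e < c -> (forall y, e < y < c -> 0 <= p.[y]) -> 0 <= p.[c].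
Proof.
move=> ce H; apply: (@ler_cvg_to _ (c^'-) _ R (fun=> 0) (horner p)).
- exact: cvg_cst.
- exact: (cvg_at_left_filter (@continuous_horner _ p c)).
near=> y; apply: H; apply/andP; split; near: y; [exact: nbhs_left_gt|exact: nbhs_left_lt].
Unshelve. all: by end_near. Qed.

(* Sums of squares s with [deg s + k <= d]; the implication makes every bound
   hold for the zero polynomial, so that the cases [d < k] need no care. *)
Definition sos_deg (k d : nat) s :=
  (exists l : seq {poly R}, s = \sum_(r <- l) r ^+ 2) /\
  (s != 0 -> (size s + k <= d.+1)%N).

Lemma sos_degD k d s t : sos_deg k d s -> sos_deg k d t -> sos_deg k d (s + t).
Proof.
move=> [[l sE] ds] [[l' tE] dt]; split; first by exists (l ++ l'); rewrite big_cat sE tE.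
have [->|s0] := eqVneq s 0; first by rewrite add0r.
have [->|t0] := eqVneq t 0; first by rewrite addr0.
by move=> _; have := size_polyD s t; move: (ds s0) (dt t0); lia.
Qed.

Lemma sos_degM k k' d d' s t : sos_deg k d s -> sos_deg k' d' t ->
  sos_deg (k + k') (d + d') (s * t).
Proof.
move=> [[l sE] ds] [[l' tE] dt]; split.
  exists [seq x * y | x <- l, y <- l']; rewrite sE tE big_allpairs_dep mulr_suml.
  by apply: eq_bigr => x _; rewrite mulr_sumr; apply: eq_bigr => y _; rewrite exprMn.
rewrite mulf_eq0 negb_or => /andP[s0 t0]; rewrite size_mul//.
have := ds s0; have := dt t0; move: s0 t0; rewrite -!size_poly_gt0.
by move: (size s) (size t) => x y; lia.
Qed.

Lemma sos_deg_sqr r k : (size r <= k.+1)%N -> sos_deg 0 k.*2 (r ^+ 2).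
Proof.
move=> rk; split; first by exists [:: r]; rewrite big_seq1.
by move=> _; have := size_poly_exp_leq r 2; lia.
Qed.

Lemma sos_deg_shift k k' d d' s : (k' + d = k + d')%N ->
  sos_deg k d s -> sos_deg k' d' s.
Proof. by move=> h [ls ds]; split=> // s0; have := ds s0; lia. Qed.

Lemma sos_deg0 k d : sos_deg k d 0.
Proof. by split; [exists [::]; rewrite big_nil | rewrite eqxx]. Qed.

Lemma sos_ltE k d m s : (m = d.+1 - k)%N -> sos_lt m s <-> sos_deg k d s.
Proof.
move=> ->; split=> -[ls ds]; split=> //.
  by move=> s0; rewrite -size_poly_gt0 in s0; lia.
by have [->|/ds] := eqVneq s 0; [rewrite size_poly0 | lia].
Qed.

Lemma certificate_even a b d q : ~~ odd d -> interval_certificate a b d q <->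
  exists s0 s1, [/\ sos_deg 0 d s0, sos_deg 2 d s1
    & q = s0 + s1 * ((b%:P - 'X) * ('X - a%:P))].
Proof.
move=> /negPf od; rewrite /interval_certificate od.
split=> -[s0 [s1 [h0 h1 qE]]]; exists s0, s1; split=> //.
- by apply: (iffLR (@sos_ltE 0 d d.+1 _ _)) => //; lia.
- by apply: (iffLR (@sos_ltE 2 d d.-1 _ _)) => //; lia.
- by apply: (iffRL (@sos_ltE 0 d d.+1 _ _)) => //; lia.
- by apply: (iffRL (@sos_ltE 2 d d.-1 _ _)) => //; lia.
Qed.

Lemma certificate_odd a b d q : odd d -> interval_certificate a b d q <->
  exists s0 s1, [/\ sos_deg 1 d s0, sos_deg 1 d s1
    & q = s0 * ('X - a%:P) + s1 * (b%:P - 'X)].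
Proof.
move=> od; rewrite /interval_certificate od.
split=> -[s0 [s1 [h0 h1 qE]]]; exists s0, s1; split=> //.
- by apply: (iffLR (@sos_ltE 1 d d _ _)) => //; lia.
- by apply: (iffLR (@sos_ltE 1 d d _ _)) => //; lia.
- by apply: (iffRL (@sos_ltE 1 d d _ _)) => //; lia.
- by apply: (iffRL (@sos_ltE 1 d d _ _)) => //; lia.
Qed.

Lemma certificateD a b d p q : interval_certificate a b d p ->
  interval_certificate a b d q -> interval_certificate a b d (p + q).
Proof.
have [od|ed] := boolP (odd d).
  move=> /certificate_odd-/(_ od)[s0 [s1 [h0 h1 ->]]].
  move=> /certificate_odd-/(_ od)[t0 [t1 [g0 g1 ->]]].
  apply/certificate_odd => //; exists (s0 + t0), (s1 + t1).
  by split; [exact: sos_degD | exact: sos_degD | ring].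
move=> /certificate_even-/(_ ed)[s0 [s1 [h0 h1 ->]]].
move=> /certificate_even-/(_ ed)[t0 [t1 [g0 g1 ->]]].
apply/certificate_even => //; exists (s0 + t0), (s1 + t1).
by split; [exact: sos_degD | exact: sos_degD | ring].
Qed.

Let sz_u a : (size ('X - a%:P)%R <= 2)%N. Proof. by rewrite size_XsubC. Qed.
Let sz_w b : (size (b%:P - 'X)%R <= 2)%N.
Proof. by rewrite -opprB size_polyN size_XsubC. Qed.

(** With u = y - a and w = b - y, the even generators are 1 and u w, the odd ones u and w. A product
    of two generators is a generator of the parity of d + d', up to factors u^2 and w^2 that the
    sums of squares absorb. *)
Lemma certificateM a b d d' p q : interval_certificate a b d p ->
  interval_certificate a b d' q -> interval_certificate a b (d + d') (p * q).
Proof.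
wlog : d d' p q / odd d' ==> odd d => [H cp cq|].
  have [/H|] := boolP (odd d' ==> odd d); first exact.
  by rewrite negb_imply => /andP[od ed]; rewrite addnC mulrC; apply: H => //; rewrite od implybT.
set u := 'X - a%:P; set w := b%:P - 'X.
have su : sos_deg 0 2 (u ^+ 2) by exact: (@sos_deg_sqr _ 1 (sz_u a)).
have sw : sos_deg 0 2 (w ^+ 2) by exact: (@sos_deg_sqr _ 1 (sz_w b)).
have [od|ed] := boolP (odd d); have [od'|ed'] := boolP (odd d') => // _.
- move=> /certificate_odd-/(_ od)[s0 [s1 [h0 h1 ->]]].
  move=> /certificate_odd-/(_ od')[t0 [t1 [g0 g1 ->]]].
  apply/certificate_even; first by rewrite oddD od od'.
  exists (s0 * t0 * u ^+ 2 + s1 * t1 * w ^+ 2), (s0 * t1 + s1 * t0); split.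
  + by apply: sos_degD; [have := sos_degM (sos_degM h0 g0) su
      | have := sos_degM (sos_degM h1 g1) sw]; apply: sos_deg_shift; lia.
  + by apply: sos_degD; [have := sos_degM h0 g1 | have := sos_degM h1 g0];
      apply: sos_deg_shift; lia.
  + by rewrite -/u -/w; ring.
- move=> /certificate_odd-/(_ od)[s0 [s1 [h0 h1 ->]]].
  move=> /certificate_even-/(_ ed')[t0 [t1 [g0 g1 ->]]].
  apply/certificate_odd; first by rewrite oddD od (negPf ed').
  exists (s0 * t0 + s1 * t1 * w ^+ 2), (s1 * t0 + s0 * t1 * u ^+ 2); split.
  + by apply: sos_degD; [have := sos_degM h0 g0
      | have := sos_degM (sos_degM h1 g1) sw]; apply: sos_deg_shift; lia.
  + by apply: sos_degD; [have := sos_degM h1 g0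
      | have := sos_degM (sos_degM h0 g1) su]; apply: sos_deg_shift; lia.
  + by rewrite -/u -/w; ring.
- move=> /certificate_even-/(_ ed)[s0 [s1 [h0 h1 ->]]].
  move=> /certificate_even-/(_ ed')[t0 [t1 [g0 g1 ->]]].
  apply/certificate_even; first by rewrite oddD (negPf ed) (negPf ed').
  exists (s0 * t0 + s1 * t1 * u ^+ 2 * w ^+ 2), (s0 * t1 + s1 * t0); split.
  + by apply: sos_degD; [have := sos_degM h0 g0
      | have := sos_degM (sos_degM (sos_degM h1 g1) su) sw]; apply: sos_deg_shift; lia.
  + by apply: sos_degD; [have := sos_degM h0 g1 | have := sos_degM h1 g0];
      apply: sos_deg_shift; lia.
  + by rewrite -/u -/w; ring.
Qed.

(** The identity 1 = ((y - a) + (b - y)) / (b - a) certifies 1 in degree 1, and products of it reach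
    every degree, odd ones included. *)
Lemma certificate_const a b d c : a < b -> 0 <= c -> interval_certificate a b d c%:P.
Proof.
move=> ab c0; rewrite -[d]add0n -[c%:P]mulr1.
have sosC k e x : 0 <= x -> (k <= e)%N -> sos_deg k e (x%:P : {poly R}).
  move=> x0 ke; split; first by exists [:: (Num.sqrt x)%:P]; rewrite big_seq1 -rmorphXn/= sqr_sqrtr.
  by move=> _; apply: leq_trans (leq_add (size_polyC_leq1 x) ke) _.
apply: certificateM.
  apply/certificate_even => //; exists c%:P, 0; split; [exact: sosC|exact: sos_deg0|].
  by rewrite mul0r addr0.
elim: d => [|d IH].
  apply/certificate_even => //; exists 1%:P, 0; split; [exact: sosC|exact: sos_deg0|].
  by rewrite mul0r addr0.
rewrite -addn1 -[1]mulr1; apply: certificateM => //.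
have ba : b - a != 0 by rewrite subr_eq0 gt_eqF.
have ba0 : 0 <= (b - a)^-1 by rewrite invr_ge0 subr_ge0 ltW.
apply/certificate_odd => //; exists ((b - a)^-1)%:P, ((b - a)^-1)%:P.
split; [exact: sosC|exact: sosC|].
rewrite -mulrDr (_ : 'X - a%:P + (b%:P - 'X) = (b - a)%:P); last by rewrite polyCB; ring.
by rewrite -polyCM mulVf.
Qed.

Lemma certificate0 a b d : interval_certificate a b d 0.
Proof.
have [od|ed] := boolP (odd d).
  by apply/certificate_odd => //; exists 0, 0; split; [exact: sos_deg0..|rewrite !mul0r addr0].
by apply/certificate_even => //; exists 0, 0; split; [exact: sos_deg0..|rewrite !mul0r addr0].
Qed.

Lemma certificate_left a b : interval_certificate a b 1 ('X - a%:P).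
Proof.
apply/certificate_odd => //; exists 1, 0; split; [|exact: sos_deg0|by rewrite mul0r mul1r addr0].
by split; [exists [:: 1]; rewrite big_seq1 expr1n | rewrite size_poly1].
Qed.

Lemma certificate_right a b : interval_certificate a b 1 (b%:P - 'X).
Proof.
apply/certificate_odd => //; exists 0, 1; split; [exact: sos_deg0| |by rewrite mul0r mul1r add0r].
by split; [exists [:: 1]; rewrite big_seq1 expr1n | rewrite size_poly1].
Qed.

Lemma certificate_sqr a b c : interval_certificate a b 2 (('X - c%:P) ^+ 2).
Proof.
apply/certificate_even => //; exists (('X - c%:P) ^+ 2), 0.
split; [exact: (@sos_deg_sqr _ 1 (sz_u c)) | exact: sos_deg0 | by rewrite mul0r addr0].
Qed.

Lemma certificate_ge0 a b d q y : interval_certificate a b d q -> a <= y <= b -> 0 <= q.[y].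
Proof.
move=> cq /andP[ay yb].
have sos0 k e s : sos_deg k e s -> 0 <= s.[y].
  move=> [[l ->] _]; rewrite horner_sum; apply: sumr_ge0 => r _.
  by rewrite horner_exp sqr_ge0.
have [od|ed] := boolP (odd d).
  move: cq => /certificate_odd-/(_ od)[s0 [s1 [/sos0 h0 /sos0 h1 ->]]].
  by rewrite !hornerE addr_ge0 ?mulr_ge0 ?subr_ge0.
move: cq => /certificate_even-/(_ ed)[s0 [s1 [/sos0 h0 /sos0 h1 ->]]].
by rewrite !hornerE addr_ge0 ?mulr_ge0 ?subr_ge0.
Qed.

(* Subtracting its minimum over the interval gives the polynomial a root there,
   and the corresponding factor can be divided out. *)
Theorem markov_lukacs a b d q : a < b -> (size q <= d.+1)%N ->
  (forall y, a <= y <= b -> 0 <= q.[y]) -> interval_certificate a b d q.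
Proof.
move=> ab; elim/ltn_ind: d q => -[|d] IH q sq q0.
  rewrite (size1_polyC sq); apply: certificate_const => //.
  by have := q0 a; rewrite (size1_polyC sq) hornerC coefC eqxx lexx (ltW ab) => /(_ isT).
have [r] := EVT_min (ltW ab) (continuous_subspaceT (@continuous_horner _ q)).
rewrite in_itv/= => /andP[ar rb] minr.
have mr y : a <= y <= b -> q.[r] <= q.[y] by move=> yab; apply: minr; rewrite in_itv.
rewrite -[q](subrK q.[r]%:P) addrC; apply: certificateD.
  by apply: certificate_const => //; apply: q0; rewrite ar rb.
set p := q - q.[r]%:P.
have p0 y : a <= y <= b -> 0 <= p.[y] by move=> yab; rewrite /p !hornerE subr_ge0 mr.
have sp : (size p <= d.+2)%N.
  rewrite (leq_trans (size_polyD _ _))// geq_max sq size_polyN.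
  by rewrite (leq_trans (size_polyC_leq1 _)).
have /factor_theorem[s pE] : root p r by rewrite /root /p !hornerE subrr.
have [s0|sN0] := eqVneq s 0; first by rewrite pE s0 mul0r; exact: certificate0.
have ss : (size s <= d.+1)%N.
  by move: sp; rewrite pE size_Mmonic ?monicXsubC// size_XsubC addn2.
have sr y : (a <= y <= b) -> 0 <= s.[y] * (y - r).
  by move=> /p0; rewrite pE !hornerE.
have [rE|ra] := eqVneq r a.
  rewrite pE rE -addn1; apply: certificateM; last exact: certificate_left.
  apply: IH => // y /andP[ay yb]; have [ya|ya] := eqVneq y a; last first.
    have := sr y; rewrite ay yb rE => /(_ isT); rewrite pmulr_lge0// subr_gt0.
    by rewrite lt_neqAle eq_sym ya.
  rewrite ya; apply: (horner_ge0_right ab) => z /andP[az zb].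
  by have := sr z; rewrite rE (ltW az) (ltW zb) => /(_ isT); rewrite pmulr_lge0// subr_gt0.
have [rE|rNb] := eqVneq r b.
  rewrite pE rE -addn1 -mulrNN opprB; apply: certificateM; last exact: certificate_right.
  apply: IH; rewrite ?size_polyN// => y /andP[ay yb]; rewrite hornerN oppr_ge0.
  have [yE|yNb] := eqVneq y b; last first.
    have := sr y; rewrite ay yb rE => /(_ isT); rewrite nmulr_lge0// subr_lt0.
    by rewrite lt_neqAle yNb.
  rewrite yE -oppr_ge0 -hornerN; apply: (horner_ge0_left ab) => z /andP[az zb].
  have := sr z; rewrite rE (ltW az) (ltW zb) => /(_ isT).
  by rewrite nmulr_lge0 ?subr_lt0// hornerN oppr_ge0.
have {ra} ra : a < r by rewrite lt_neqAle eq_sym ra.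
have {rNb} rb' : r < b by rewrite lt_neqAle rNb.
have sright y : r < y -> y <= b -> 0 <= s.[y].
  move=> ry yb; have := sr y; rewrite yb andbT (le_trans ar (ltW ry)) => /(_ isT).
  by rewrite pmulr_lge0// subr_gt0.
have sleft y : a <= y -> y < r -> s.[y] <= 0.
  move=> ay yr; have := sr y; rewrite ay (le_trans (ltW yr) rb) => /(_ isT).
  by rewrite nmulr_lge0// subr_lt0.
(* The cofactor is nonpositive to the left of r and nonnegative to the right, so it vanishes at r:
   an interior root of [p] is double. *)
have /factor_theorem[t sE] : root s r.
  rewrite /root eq_le; apply/andP; split.
    rewrite -oppr_ge0 -hornerN; apply: (horner_ge0_left ra) => y /andP[ay yr].
    by rewrite hornerN oppr_ge0 sleft// ltW.
  by apply: (horner_ge0_right rb') => y /andP[ry yb]; rewrite sright// ltW.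
have tN0 : t != 0 by apply: contraNneq sN0; rewrite sE => ->; rewrite mul0r.
have st : (size t + 1 <= d.+1)%N.
  by move: ss; rewrite sE size_Mmonic ?monicXsubC// size_XsubC addn2 addn1.
rewrite -size_poly_gt0 in tN0.
case: d => [|d] in IH sq sp ss st *; first lia.
rewrite pE sE -mulrA -expr2 -[d.+2]addn2; apply: certificateM; last exact: certificate_sqr.
have tr y : a <= y <= b -> y != r -> 0 <= t.[y].
  move=> /andP[ay yb] yr; have := sr y; rewrite sE !hornerE ay yb => /(_ isT).
  by rewrite -mulrA -expr2 pmulr_lge0// exprn_even_gt0//= subr_eq0.
apply: IH => [//||y yab]; first by rewrite addn1 in st.
 have [->|/tr] := eqVneq y r; last exact.
apply: (horner_ge0_right rb') => z /andP[rz zb].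
by apply: tr; [rewrite (le_trans ar (ltW rz)) ltW | rewrite gt_eqF].
Qed.
End MarkovLukacs.

(** * The scenario bound for convex programs *)

Section ConvexFunctions.
Context {R : realType} {d : nat}.
Notation V := 'rV[R]_d.+1.
Implicit Types (f g : V -> R) (w x y : V).

Lemma cvx_funD f g : cvx_fun f -> cvx_fun g -> cvx_fun (fun w => f w + g w).
Proof. by move=> cf cg x y s s0 s1; have := cf x y s s0 s1; have := cg x y s s0 s1; nra. Qed.

Lemma cvx_funZ (a : R) f : 0 <= a -> cvx_fun f -> cvx_fun (fun w => a * f w).
Proof.
move=> a0 cf x y s s0 s1; have := cf x y s s0 s1; rewrite -subr_ge0 => h.
rewrite -subr_ge0; have := mulr_ge0 a0 h; lra.
Qed.

(** [x + h] is the mean of the d + 1 points [x + h 0 i *: D i]; the factor [N] in [D] compensates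
    the averaging. Each of them lies on a segment from x to [x + D i] or [x - D i], where the chord
    bounds the growth of f. *)
Lemma cvx_fun_near_le f x (e : R) : cvx_fun f -> 0 < e ->
  exists2 r : R, 0 < r & forall h : V, `|h| <= r -> f (x + h) <= f x + e.
Proof.
move=> cf e0; pose N : R := d.+1%:R; have N0 : 0 < N by rewrite ltr0n.
pose D i : V := N *: delta_mx 0 i.
pose K := \sum_i (`|f (x + D i) - f x| + `|f (x - D i) - f x|) + 1.
have K0 : 0 < K by rewrite ltr_wpDl// sumr_ge0// => i _; rewrite addr_ge0.
have Ki i : `|f (x + D i) - f x| + `|f (x - D i) - f x| <= K.
  rewrite /K (bigD1 i)//= -[leRHS]addrA lerDl; apply: addr_ge0 => //.
  by apply: sumr_ge0 => j _; apply: addr_ge0.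
have Kp i : f (x + D i) - f x <= K.
  by apply: le_trans (ler_norm _) (le_trans _ (Ki i)); rewrite lerDl.
have Km i : f (x - D i) - f x <= K.
  by apply: le_trans (ler_norm _) (le_trans _ (Ki i)); rewrite lerDr.
have line v (s : R) : 0 <= s -> s <= 1 -> f (x + v) - f x <= K -> s * K <= e ->
    f (x + s *: v) <= f x + e.
  move=> s0 s1 vK sK; have := cf (x + v) x s s0 s1.
  rewrite (_ : s *: (x + v) + (1 - s) *: x = x + s *: v); last first.
    by rewrite scalerDr scalerBl scale1r addrC addrA subrK.
  have : s * (f (x + v) - f x) <= s * K by rewrite ler_wpM2l.
  lra.
pose r := Num.min 1 (e / K).
have r0 : 0 < r by rewrite lt_min ltr01 divr_gt0.
exists r => // h hr.
have hi i : `|h 0 i| <= r.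
  apply: le_trans hr; rewrite [leRHS]/Num.Def.normr/= mx_normrE.
  by apply/bigmax_geP; right => /=; exists (0, i).
have pt i : f (x + h 0 i *: D i) <= f x + e.
  have := hi i; rewrite le_min => /andP[h1 h2].
  have hK : `|h 0 i| * K <= e by rewrite -ler_pdivlMr.
  have [h0|h0] := leP 0 (h 0 i).
    by rewrite ger0_norm// in h1 hK; apply: line.
  rewrite ltr0_norm// in h1 hK.
  rewrite -[h 0 i]opprK scaleNr -scalerN; apply: line => //.
  by rewrite oppr_ge0 ltW.
have cvxS : cvx_set [set w | f w <= f x + e].
  move=> y z s /= fy fz s0 s1; apply: le_trans (cf y z s s0 s1) _.
  have : s * f y <= s * (f x + e) by rewrite ler_wpM2l.
  have : (1 - s) * f z <= (1 - s) * (f x + e) by rewrite ler_wpM2l// subr_ge0.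
  lra.
have := @cvx_set_sum _ _ _ 'I_d.+1 (fun=> 1) (fun i => x + h 0 i *: D i) cvxS.
rewrite sumr_const card_ord -/N => /(_ (fun=> ler01) (fun i _ => pt i) N0) /=.
congr (f _ <= _); under eq_bigr do rewrite scale1r.
rewrite big_split/= sumr_const card_ord scalerDr -[x *+ _]scaler_nat -/N scalerA.
rewrite mulVf ?gt_eqF// scale1r; congr (_ + _).
rewrite scaler_sumr [RHS]row_sum_delta; apply: eq_bigr => i _.
by rewrite /D !scalerA mulrCA mulVf ?gt_eqF// mulr1.
Qed.

(** Reflection turns the upper bound into a lower one, x being the midpoint of x + h and x - h. *)
Lemma cvx_fun_continuous f : cvx_fun f -> continuous f.
Proof.
move=> cf x; apply/(@cvgrPdist_le _ _ _ _ (nbhs_filter x)) => e e0.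
have [r r0 rP] := cvx_fun_near_le x cf e0.
apply/nbhs_ballP; exists r => //= y; rewrite -ball_normE/= => /ltW xy.
pose h := y - x; have hr : `|h| <= r by rewrite /h distrC.
have h1 := rP h hr.
have h2 : f (x - h) <= f x + e by apply: rP; rewrite normrN.
have yE : y = x + h by rewrite /h addrC subrK.
have half1 : (2^-1 : R) <= 1 by lra.
have half0 : (0 : R) <= 2^-1 by [].
have := cf (x + h) (x - h) 2^-1 half0 half1.
rewrite (_ : _ *: _ + _ *: _ = x); last first.
  rewrite (_ : 1 - 2^-1 = 2^-1 :> R); last by field.
  rewrite -scalerDr addrACA subrr addr0 scalerDr -scalerDl.
  by rewrite (_ : 2^-1 + 2^-1 = 1 :> R) ?scale1r//; field.
rewrite -yE in h1 * => h3.
by rewrite ler_norml; apply/andP; split; lra.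
Qed.

Definition sqnorm w : R := \sum_i w 0 i ^+ 2.

Lemma sqnorm_ge0 w : 0 <= sqnorm w.
Proof. by apply: sumr_ge0 => i _; exact: sqr_ge0. Qed.

Lemma cvx_sqnorm : cvx_fun sqnorm.
Proof.
move=> x y s s0 s1; rewrite /sqnorm !mulr_sumr -big_split/=.
apply: ler_sum => i _; rewrite !mxE.
have := mulr_ge0 (mulr_ge0 s0 (_ : 0 <= 1 - s)) (sqr_ge0 (x 0 i - y 0 i)).
by rewrite subr_ge0 => /(_ s1); nra.
Qed.

Lemma sqnorm_strict x y : x != y ->
  sqnorm (2^-1 *: x + (1 - 2^-1) *: y) < 2^-1 * sqnorm x + (1 - 2^-1) * sqnorm y.
Proof.
move=> xy; have [i xyi] : exists i, x 0 i != y 0 i.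
  apply/existsP; apply: contraNT xy; rewrite negb_exists => /forallP H.
  by apply/eqP/rowP => i; have := H i; rewrite negbK => /eqP.
rewrite /sqnorm !mulr_sumr -big_split/= -subr_gt0 -sumrB.
have term j : 2^-1 * x 0 j ^+ 2 + (1 - 2^-1) * y 0 j ^+ 2 -
    (2^-1 *: x + (1 - 2^-1) *: y) 0 j ^+ 2 = (2^-1 * (x 0 j - y 0 j)) ^+ 2.
  by rewrite !mxE; field.
under eq_bigr do rewrite term.
rewrite (bigD1 i)//= ltr_pwDl//; last by apply: sumr_ge0 => j _; exact: sqr_ge0.
by rewrite exprn_even_gt0//= mulf_neq0// subr_eq0.
Qed.

Definition box (r : R) : set V := [set w | forall i, `|w 0 i| <= r].

Lemma box_compact r : compact (box r).
Proof.
have := @rV_compact R d.+1 (fun=> `[- r, r]%classic) (fun=> segment_compact (a := - r) (b := r)).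
by congr compact; apply/seteqP; split=> w /= h i; have := h i; rewrite in_itv/= ler_norml.
Qed.

Lemma cvx_box r : cvx_set (box r).
Proof.
move=> x y s bx b_y s0 s1 i; rewrite !mxE; apply: le_trans (ler_normD _ _) _.
rewrite !normrM (ger0_norm s0) (ger0_norm (_ : 0 <= 1 - s)) ?subr_ge0//.
have : s * `|x 0 i| <= s * r by rewrite ler_wpM2l// bx.
have : (1 - s) * `|y 0 i| <= (1 - s) * r by rewrite ler_wpM2l ?subr_ge0// b_y.
lra.
Qed.

Lemma box0 r : 0 <= r -> box r 0.
Proof. by move=> r0 i; rewrite mxE normr0. Qed.

Lemma box_norm r w : `|w| <= r -> box r w.
Proof.
move=> wr i; apply: le_trans wr; rewrite [leRHS]/Num.Def.normr/= mx_normrE.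
by apply/bigmax_geP; right => /=; exists (0, i).
Qed.

Lemma nbhs_rat_vector w (U : set V) : nbhs w U ->
  exists q : 'rV[rat]_d.+1, U (map_mx ratr q).
Proof.
move=> /nbhs_ballP[e /= e0 eU].
have H i : exists q : rat, w 0 i < ratr q < w 0 i + e.
  have [|q] := @rat_in_itvoo R (w 0 i) (w 0 i + e); first by rewrite ltrDl.
  by rewrite in_itv/=; exists q.
pose q i := projT1 (cid (H i)).
exists (\row_i q i); apply: eU; split=> // i j; rewrite !mxE (ord1 i) /ball/=.
have := projT2 (cid (H j)); rewrite -/(q j) => /andP[h1 h2].
by rewrite ltr_norml; apply/andP; split; lra.
Qed.
End ConvexFunctions.

(** Match two enumerations of T that list A, respectively B, before the complement. *)
Lemma exists_perm_imset (T : finType) (A B : {set T}) : #|A| = #|B| ->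
  exists s : {perm T}, s @: A = B.
Proof.
move=> cAB; pose l (S : {set T}) := enum S ++ enum (~: S).
have lu S : uniq (l S).
  rewrite cat_uniq !enum_uniq andbT/=; apply/hasPn => x.
  by rewrite !mem_enum inE.
have lm S x : x \in l S by rewrite mem_cat !mem_enum inE orbN.
have ls S : size (l S) = #|T| by rewrite size_cat -!cardE cardsC.
pose f x := nth x (l B) (index x (l A)).
have fi : injective f.
  move=> x y; rewrite /f (set_nth_default x y) ?ls -?(ls A) ?index_mem// => /eqP.
  by rewrite nth_uniq ?lu ?ls -?(ls A) ?index_mem// => /eqP/index_inj; apply.
exists (perm fi); apply/eqP; rewrite eqEcard card_imset ?cAB ?leqnn ?andbT; last exact: perm_inj.
apply/fintype.subsetP => y /imsetP[x xA ->]; rewrite permE /f /l !nth_cat index_cat mem_enum xA.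
have h : (index x (enum A) < size (enum B))%N.
  by rewrite -cardE -cAB cardE index_mem mem_enum.
by rewrite h -mem_enum mem_nth.
Qed.

Lemma measurable_cat_tuple d (T : measurableType d) n m (x : n.-tuple T) :
  measurable_fun setT (fun y : m.-tuple T => cat_tuple x y).
Proof.
apply/measurable_fun_tnthP => i; case: (split_ordP i) => j ->.
  rewrite (_ : _ \o _ = fun=> tnth x j); first exact: measurable_cst.
  by apply/funext => y /=; rewrite tnth_lshift.
rewrite (_ : _ \o _ = fun y => tnth y j); first exact: measurable_tnth.
by apply/funext => y /=; rewrite tnth_rshift.
Qed.

(** * Probability that a sampled optimum is often violated *)

Section ScenarioProgram.
Context {dT : measure_display} {T : measurableType dT} {R : realType} {d : nat}.
Notation V := 'rV[R]_d.+1.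
Variables (P : probability T R) (C : T -> set V).
Hypotheses (closedC : forall x, closed (C x)) (cvxC : forall x, cvx_set (C x))
  (nbhsC : forall x, nbhs (0 : V) (C x))
  (measC : forall w, measurable [set x | C x w]).

Section BoundedProgram.
Variables (J : V -> R) (r : R).
Hypotheses (cvxJ : cvx_fun J) (r0 : 0 < r).
Hypothesis strictJ : forall x y, x != y ->
  J (2^-1 *: x + (1 - 2^-1) *: y) < 2^-1 * J x + (1 - 2^-1) * J y.

Let contJ : continuous J. Proof. exact: cvx_fun_continuous. Qed.
Let C0 x : C x 0. Proof. exact: (nbhs_singleton (nbhsC x)). Qed.

Definition sample_region n (w : n.-tuple T) (S : {set 'I_n}) : set V :=
  region (box r) (fun i => C (tnth w i)) S.

Definition value n (w : n.-tuple T) (S : {set 'I_n}) : R :=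
  J (minimizer J (sample_region w S)).

Lemma valueP n (w : n.-tuple T) (S : {set 'I_n}) :
  sample_region w S (minimizer J (sample_region w S)) /\
  forall v, sample_region w S v -> value w S <= J v.
Proof.
exact: (@optP R d J contJ n (box r) (fun i => C (tnth w i)) (@box_compact R d r)
  (box0 (ltW r0)) (fun i => @closedC (tnth w i)) (fun i => C0 (tnth w i)) S).
Qed.

Lemma value_ltP n (w : n.-tuple T) (S : {set 'I_n}) u :
  value w S < u <-> exists2 v, sample_region w S v & J v < u.
Proof.
have [rm minv] := valueP w S; split=> [vu|[v /minv vv vu]]; last exact: le_lt_trans vu.
by exists (minimizer J (sample_region w S)).
Qed.

Lemma sample_region_interior n (w : n.-tuple T) (S : {set 'I_n}) :
  nbhs (0 : V) (sample_region w S).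
Proof.
rewrite (_ : sample_region w S =
    box r `&` [set v | forall i, (i \in S -> C (tnth w i) v)]); last by [].
apply: filterI.
  apply/nbhs_ballP; exists r => //= v; rewrite -ball_normE/= sub0r normrN => /ltW.
  exact: box_norm.
apply: (@filter_forall _ _ (fun i => [set v | i \in S -> C (tnth w i) v])
  (nbhs (0 : V)) (nbhs_filter (0 : V))) => i.
by apply: filterS (nbhsC (tnth w i)) => v Cv _.
Qed.

Lemma sample_region_cvx n (w : n.-tuple T) (S : {set 'I_n}) : cvx_set (sample_region w S).
Proof.
apply: region_cvx => [|i]; [exact: cvx_box | exact: cvxC].
Qed.

(* Every feasible point is a limit of interior ones, so rational points suffice. *)
Lemma value_lt_rat n (w : n.-tuple T) (S : {set 'I_n}) u : value w S < u ->
  exists q : 'rV[rat]_d.+1, sample_region w S (map_mx ratr q) /\ J (map_mx ratr q) < u.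
Proof.
move=> /value_ltP[v rv Jv]; have cr := @sample_region_cvx n w S.
have [s [s0 s1 Js]] : exists s : R, [/\ 0 < s, s < 1 & J ((1 - s) *: v) < u].
  pose K := `|J 0 - J v| + 1; have K0 : 0 < K by rewrite ltr_wpDl.
  have uv : 0 < u - J v by rewrite subr_gt0.
  pose s := Num.min 2^-1 ((u - J v) / K / 2).
  have s0 : 0 < s by rewrite lt_min invr_gt0 ltr0n/= !divr_gt0.
  have shalf : s <= 2^-1 by rewrite ge_min lexx.
  have sK : s * K <= (u - J v) / 2.
    by rewrite -ler_pdivlMr// mulrAC ge_min lexx orbT.
  exists s; split=> //; first lra.
  have := cvxJ 0 v (ltW s0) (_ : s <= 1); rewrite scaler0 add0r => h.
  apply: le_lt_trans (h _) _; first lra.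
  have : s * (J 0 - J v) <= s * K.
    by rewrite ler_pM2l// (le_trans (ler_norm _))// lerDl.
  lra.
have nU : nbhs ((1 - s) *: v) [set y | sample_region w S y /\ J y < u].
  apply: filterI; last first.
    apply: (@contJ ((1 - s) *: v) [set x | x < u]).
    exact: open_nbhs_nbhs.
  have /nbhs_ballP[e /= e0 eS] := sample_region_interior w S.
  apply/nbhs_ballP; exists (s * e); first by rewrite /= mulr_gt0.
  move=> y; rewrite -ball_normE/= => yb.
  have : sample_region w S (s^-1 *: (y - (1 - s) *: v)).
    apply: eS; rewrite -ball_normE/= sub0r normrN normrZ gtr0_norm ?invr_gt0//.
    by rewrite mulrC ltr_pdivrMr// distrC mulrC.
  move=> /cr/(_ rv (ltW s0) (ltW s1)).
  by rewrite scalerA mulfV ?gt_eqF// scale1r subrK.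
by have [q [qr Jq]] := nbhs_rat_vector nU; exists q.
Qed.

Lemma measurable_value_lt n (S : {set 'I_n}) u :
  measurable [set w : n.-tuple T | value w S < u].
Proof.
pose F (q : 'rV[rat]_d.+1) : set (n.-tuple T) :=
  [set w | sample_region w S (map_mx ratr q) /\ J (map_mx ratr q) < u].
rewrite (_ : mkset _ = \bigcup_q F q).
  apply: countable_bigcupT_measurable => [|q]; first exact: countableP.
  have [[bq Jq]|nq] := pselect (box r (map_mx ratr q) /\ J (map_mx ratr q) < u); last first.
    rewrite (_ : F q = set0)//; apply/seteqP; split=> // w [[bq _] Jq].
    by case: nq.
  rewrite (_ : F q = \bigcap_(i in [set i | i \in S])
      ((fun w : n.-tuple T => tnth w i) @^-1` [set x | C x (map_mx ratr q)])).
    apply: fin_bigcap_measurable; first exact: finite_finset.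
    move=> i _; rewrite -[X in measurable X]setTI.
    exact: (@measurable_tnth _ T n i measurableT _ (measC (map_mx ratr q))).
  by apply/seteqP; split=> w /= => [[[_ h] _] i /h//|h]; split=> //; split.
apply/seteqP; split=> w /=; first by move=> /value_lt_rat[q qP]; exists q.
by move=> [q _ [rq Jq]]; apply/value_ltP; exists (map_mx ratr q).
Qed.

Lemma measurable_value_ltv n (S S' : {set 'I_n}) :
  measurable [set w : n.-tuple T | value w S < value w S'].
Proof.
rewrite (_ : mkset _ = \bigcup_(q : rat)
    ([set w | value w S < ratr q] `\` [set w | value w S' < ratr q])).
  apply: bigcupT_measurable_rat => q.
  by apply: measurableD; exact: measurable_value_lt.
apply/seteqP; split=> w /=.
  move=> /rat_in_itvoo[q]; rewrite in_itv/= => /andP[h1 h2].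
  by exists q => //; split=> //=; apply/negP; rewrite -leNgt ltW.
move=> [q _ [/= h1 /negP]]; rewrite -leNgt; exact: lt_le_trans.
Qed.

Lemma sample_region_perm n (w : n.-tuple T) (s : {perm 'I_n}) (S : {set 'I_n}) :
  sample_region [tuple tnth w (s i) | i < n] S = sample_region w (s @: S).
Proof.
apply/seteqP; split=> v [bv Cv]; split=> // i.
  by move=> /imsetP[j jS ->]; have := Cv j jS; rewrite tnth_mktuple.
by move=> iS; rewrite tnth_mktuple; apply: Cv; rewrite imset_f.
Qed.

(** Stated through values rather than through the minimizer, so that measurability reduces to that
    of [value]. *)
Definition violators n (w : n.-tuple T) : set T :=
  [set z | value w [set: _]%SET < value [tuple of z :: w] [set: _]%SET].

Lemma sample_region_cat n m (x : n.-tuple T) (y : m.-tuple T) :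
  sample_region (cat_tuple x y) (@lshift n m @: [set: _]%SET) = sample_region x [set: _]%SET.
Proof.
apply/seteqP; split=> v [bv Cv]; split=> // i.
  by move=> _; rewrite -(tnth_lshift x y); apply: Cv; rewrite imset_f.
by move=> /imsetP[j _ ->]; rewrite tnth_lshift; exact: Cv.
Qed.

Lemma sample_region_cat_cons n m (x : n.-tuple T) (y : m.-tuple T) j :
  sample_region (cat_tuple x y) (rshift n j |: (@lshift n m @: [set: _]%SET)) =
  sample_region [tuple of tnth y j :: x] [set: _]%SET.
Proof.
apply/seteqP; split=> v [bv Cv]; split=> // i.
  move=> _; case: (unliftP ord0 i) => [k ->|->].
    rewrite tnthS -(tnth_lshift x y); apply: Cv; rewrite !inE imset_f ?orbT//.
  by rewrite tnth0 -(tnth_rshift x y); apply: Cv; rewrite !inE eqxx.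
rewrite !inE => /orP[/eqP->|/imsetP[k _ ->]].
  by rewrite tnth_rshift; have := Cv ord0; rewrite tnth0; apply; rewrite inE.
by rewrite tnth_lshift; have := Cv (lift ord0 k); rewrite tnthS; apply; rewrite inE.
Qed.

(** Expresses both values in [violators] on the same tuple, as [measurable_value_ltv] requires. *)
Lemma sample_region_behead n (z : T) (x : n.-tuple T) :
  sample_region [tuple of z :: x] [set~ ord0]%SET = sample_region x [set: _]%SET.
Proof.
apply/seteqP; split=> v [bv Cv]; split=> // i.
  by move=> _; have := Cv (lift ord0 i); rewrite tnthS; apply; rewrite !inE eq_sym neq_lift.
rewrite !inE; case: (unliftP ord0 i) => [k -> _|->]; last by rewrite eqxx.
by rewrite tnthS; apply: Cv; rewrite inE.
Qed.

Lemma measurable_violators_pair n :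
  measurable [set zx : T * n.-tuple T | violators zx.2 zx.1].
Proof.
have mc : measurable_fun [set: T * n.-tuple T] (fun zx => [tuple of zx.1 :: zx.2]).
  exact: measurable_cons.
have := mc measurableT _ (@measurable_value_ltv n.+1 [set~ ord0]%SET [set: _]%SET).
rewrite setTI; congr measurable; apply/seteqP; split=> -[z x];
  by rewrite /violators /value/= sample_region_behead.
Qed.

Lemma measurable_violators n (x : n.-tuple T) : measurable (violators x).
Proof.
have := measurable_ysection x (@measurable_violators_pair n).
by congr measurable; apply/seteqP; split=> z; rewrite /ysection/= inE.
Qed.

Definition risky n (e : R) : set (n.-tuple T) :=
  [set x | (e%:E <= P (violators x))%E].

Lemma measurable_risky n e : measurable (@risky n e).
Proof.
have mf : measurable_fun [set: n.-tuple T] ((fun x => P (violators x)) : _ -> \bar R).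
  have := measurable_fun_ysection P (@measurable_violators_pair n).
  congr (measurable_fun _ _); apply/funext => x; congr (P _).
  by apply/seteqP; split=> z; rewrite /ysection/= inE.
have := mf measurableT _ (emeasurable_itv `[e%:E, +oo[).
rewrite setTI; congr measurable; apply/seteqP; split=> x /=.
  by rewrite in_itv/= andbT.
by rewrite /risky/= in_itv/= andbT.
Qed.

Lemma risky_probability_le N M k (c e : R) : (d < N)%N -> (d + k <= N + M)%N ->
  0 <= e -> 1 <= c ->
  fine (tuple_probability P N (@risky N e)) * (1 - c ^+ k * (e / c + 1 - e) ^+ M) <=
  (\sum_(i < d.+1) 'C(d + k, i) * 'C(N + M - (d + k), N - i))%:R / 'C(N + M, N)%:R.
Proof.
move=> dN dkn e0 c1.
set n := (N + M)%N; set H := (\sum_(i < d.+1) _)%N.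
set p := 1 - _; set b := fine _.
have CN0 : 0 < 'C(n, N)%:R :> R by rewrite ltr0n bin_gt0 leq_addr.
have bE : tuple_probability P N (@risky N e) = b%:E.
  by rewrite fineK// fin_num_measure//; exact: measurable_risky.
have b0 : 0 <= b by rewrite fine_ge0.
(* The Chernoff bound may exceed 1; the left-hand side is then at most 0. *)
have [p0|p0] := ltP p 0.
  by apply: (@le_trans _ _ 0); [rewrite mulr_ge0_le0// ltW | rewrite divr_ge0].
pose A (S : {set 'I_n}) : set (n.-tuple T) :=
  [set w | (k <= #|[set z | (z \notin S) && (value w S < value w (z |: S))%R]%SET|)%N].
have mA S : measurable (A S).
  have := @measurable_pattern _ _ 'I_n
    (fun z => [set w : n.-tuple T | value w S < value w (z |: S)])
    (fun Z => (k <= #|[set z | (z \notin S) && (z \in Z)]%SET|)%N)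
    (fun z => measurable_value_ltv S (z |: S)).
  have AE w : [set z | (z \notin S) && (z \in
      [set z0 | `[< value w S < value w (z0 |: S) >]])]%SET =
      [set z | (z \notin S) && (value w S < value w (z |: S))%R]%SET.
    by apply/setP => z; rewrite !inE asboolb.
  by congr measurable; apply/seteqP; split=> w; rewrite /A/= AE.
pose T0 : {set 'I_n} := @lshift N M @: [set: _]%SET.
have cT0 : #|T0| = N.
  by rewrite card_imset ?cardsT ?card_ord//; exact: lshift_inj.
(* Exchangeability: a permutation carrying the first N indices onto S carries one event onto the
   other. *)
have PA (S : {set 'I_n}) : #|S| = N -> tuple_probability P n (A S) = tuple_probability P n (A T0).
  move=> cS; have [s sE] := @exists_perm_imset _ T0 S (etrans cT0 (esym cS)).
  rewrite -(tuple_probability_perm P s (mA T0)); congr (tuple_probability P n _).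
  apply/seteqP; split=> w; rewrite /A/= => /leq_trans; apply; rewrite -sE.
    rewrite -[leqRHS](card_imset _ (@perm_inj _ s)); apply/subset_leq_card/fintype.subsetP.
    move=> z; rewrite !inE => /andP[zS vz]; apply/imsetP; exists ((s^-1)%g z); last by rewrite permKV.
    rewrite inE /value !sample_region_perm imsetU1 permKV vz andbT.
    by apply: contra zS => h; rewrite -[z](permKV s) imset_f.
  rewrite -[leqLHS](card_imset _ (@perm_inj _ s)); apply/subset_leq_card/fintype.subsetP.
  move=> z /imsetP[y]; rewrite !inE => /andP[yS vy] ->.
  move: vy; rewrite /value !sample_region_perm imsetU1 => ->; rewrite andbT.
  by apply: contra yS => /imsetP[x xT0 /perm_inj ->].
have cardA w : (#|[set S : {set 'I_n} | (#|S| == N) && `[< A S w >]]%SET| <= H)%N.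
  have := @card_violations_le R d J cvxJ contJ strictJ n (box r) (fun i => C (tnth w i))
    (@box_compact R d r) (@cvx_box R d r) (box0 (ltW r0)) (fun i => @closedC (tnth w i))
    (fun i => @cvxC (tnth w i)) (fun i => nbhsC (tnth w i)) N k dN dkn.
  apply: leq_trans; apply/subset_leq_card/fintype.subsetP => S.
  rewrite !inE => /andP[-> /asboolP]; rewrite /A/= => /leq_trans; apply.
  apply/subset_leq_card/fintype.subsetP => z; rewrite !inE => /andP[->/=].
  rewrite /value /opt /sample_region.
  suff -> : scaled (fun i => C (tnth w i)) (fun=> 1) = (fun i => C (tnth w i)) by [].
  by apply/funext => i; apply/seteqP; split=> v; rewrite /scaled/= scale1r.
pose Ss := enum [set S : {set 'I_n} | #|S| == N]%SET.
(* Integrate the pointwise count [cardA]; by [PA] all N-subsets contribute equally. *)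
have sumA : 'C(n, N)%:R * fine (tuple_probability P n (A T0)) <= H%:R.
  set q := fine _.
  have qE : tuple_probability P n (A T0) = q%:E by rewrite fineK// fin_num_measure.
  rewrite -lee_fin.
  have -> : ('C(n, N)%:R * q)%:E =
      (\sum_(S <- Ss) \int[tuple_probability P n]_w (\1_(A S) w)%:E)%E.
    rewrite (eq_big_seq (fun=> q%:E)); last first.
      move=> S; rewrite mem_enum inE => /eqP cS.
      by rewrite integral_indic// setIT -qE; exact: PA.
    rewrite sumEFin big_const_seq count_predT iter_addr_0 -cardE card_draws.
    by rewrite card_ord mulr_natl.
  have mI S : measurable_fun setT (fun w => (\1_(A S) w)%:E : \bar R).
    by apply/measurable_EFinP; exact: measurable_indic.
  have I0 S w : (0 <= (\1_(A S) w)%:E :> \bar R)%E by rewrite lee_fin.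
  rewrite -(ge0_integral_sum _ measurableT mI (fun S w _ => I0 S w)).
  apply: (@le_trans _ _ (\int[tuple_probability P n]_(w in setT) H%:R%:E)%E).
    apply: ge0_le_integral => //.
    - by move=> w _; apply: sume_ge0 => S _; rewrite lee_fin.
    - apply: emeasurable_sum => S.
      by apply/measurable_EFinP; exact: measurable_indic.
    move=> w _; rewrite sumEFin lee_fin; apply: le_trans (_ : _ <= (#|[set S : {set 'I_n} |
        (#|S| == N) && `[< A S w >]]%SET|)%:R) _; last by rewrite ler_nat.
    rewrite -sum1_card natr_sum big_enum/= [leLHS]big_mkcond [leRHS]big_mkcond/=.
    apply: ler_sum => S _; rewrite !inE indicE; case: (_ == N) => //=.
    by rewrite /in_mem/= /in_set; case: asboolP.
  by rewrite integral_cst// [X in (_ * X <= _)%E](probability_setT (tuple_probability P n)) mule1.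
(* Given a risky first block, at least k of the M fresh samples violate its optimum with probability
   at least p. *)
have splitA : (p%:E * tuple_probability P N (@risky N e) <= tuple_probability P n (A T0))%E.
  apply: tuple_probability_split => //; first exact: measurable_risky.
  move=> x rx; have mW := measurable_violators x.
  have mB : measurable [set y : M.-tuple T |
      (#|[set i | `[< violators x (tnth y i) >]]%SET| < k)%N].
    apply: (measurable_pattern (E := fun i => (fun y : M.-tuple T => tnth y i) @^-1` violators x)
      (fun S => #|S| < k)%N).
    by move=> i; rewrite -[X in measurable X]setTI; exact: (@measurable_tnth _ T M i measurableT _ mW).
  apply: (@le_trans _ _ (tuple_probability P M (~` [set y : M.-tuple T |
      (#|[set i | `[< violators x (tnth y i) >]]%SET| < k)%N]))).
    rewrite probability_setC// /p EFinB leeB//.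
    exact: tuple_probability_count.
  apply: le_measure; rewrite ?inE.
  - exact: measurableC.
  - have := measurable_cat_tuple x measurableT (mA T0); by rewrite setTI.
  move=> y /= /negP; rewrite -leqNgt => /leq_trans; apply.
  rewrite -(card_imset _ (@rshift_inj N M)); apply/subset_leq_card/fintype.subsetP.
  move=> z /imsetP[j]; rewrite !inE => /asboolP vj ->.
  rewrite /value sample_region_cat sample_region_cat_cons.
  move: vj; rewrite /violators/= /value ?asboolb => ->; rewrite andbT.
  by apply/negP => /imsetP[l _ /eqP]; rewrite eq_rlshift.
rewrite ler_pdivlMr// mulrC; apply: le_trans sumA.
rewrite ler_pM2l// mulrC -lee_fin fineK ?fin_num_measure//.
by rewrite EFinM -bE.
Qed.
End BoundedProgram.
End ScenarioProgram.

(** * From strictly convex to lexicographic objectives *)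

Section PenalizedObjective.
Context {R : realType} {d : nat}.
Notation V := 'rV[R]_d.+1.
Variables (c t : V -> R).
Hypotheses (cvxc : cvx_fun c) (cvxt : cvx_fun t).

(* Strictly convex approximation of the lexicographic objective (c, t). *)
Definition penalized (j : nat) (w : V) : R :=
  c w + j.+1%:R^-1 * t w + j.+1%:R^-1 ^+ 2 * sqnorm w.

Lemma cvx_penalized j : cvx_fun (penalized j).
Proof.
apply: cvx_funD; [apply: cvx_funD => //|]; apply: cvx_funZ => //.
exact: cvx_sqnorm.
Qed.

Lemma penalized_strict j x y : x != y ->
  penalized j (2^-1 *: x + (1 - 2^-1) *: y) <
  2^-1 * penalized j x + (1 - 2^-1) * penalized j y.
Proof.
move=> xy; rewrite /penalized; set e := j.+1%:R^-1.
have e0 : 0 < e by rewrite invr_gt0.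
have h1 : (2^-1 : R) <= 1 by lra.
have h0 : (0 : R) <= 2^-1 by [].
have := cvxc x y h0 h1; have := cvxt x y h0 h1; have := sqnorm_strict xy.
rewrite -(ltr_pM2l (exprn_gt0 2 e0)) -(ler_pM2l e0); lra.
Qed.

(** D avoids a ball around [th]. The sphere of that ball meets F in a compact set, on which the
    comparison holds uniformly for large j, and convexity along segments from [th] carries it
    outwards to D. *)
Lemma penalized_separation (F D : set V) th : closed F -> cvx_set F -> closed D ->
  F th -> ~ D th ->
  (forall w, F w -> c th <= c w) ->
  (forall w, F w -> c w = c th -> w != th -> t th < t w) ->
  \forall j \near \oo, forall w, F w -> D w -> penalized j th < penalized j w.
Proof.
move=> clF cvxF clD Fth Dth minc mint.
have [r r0 rD] : exists2 r : R, 0 < r & forall w, D w -> r < `|w - th|.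
  have : nbhs th (~` D) by apply: open_nbhs_nbhs; split=> //; exact: closed_openC.
  move=> /nbhs_ballP[e /= e0 eD]; exists (e / 2); first by rewrite divr_gt0.
  move=> w Dw; rewrite ltNge; apply/negP => wth; apply: (eD w) => //.
  rewrite -ball_normE/= distrC; apply: le_lt_trans wth _; lra.
pose K := F `&` [set w | `|w - th| = r].
have compK : compact K.
  apply: bounded_closed_compact.
    exists (`|th| + r); split; first exact: num_real.
    move=> M MM w [_ /= wr]; rewrite -(subrK th w); apply: le_trans (ler_normD _ _) _.
    by rewrite wr addrC ltW.
  apply: closedI => //.
  apply: (@preimage_closed _ _ (fun w : V => `|w - th|) [set r]); last exact: closed_eq.
  by move=> w _; apply: (@cvg_norm _ _ _ (nbhs w)); apply: cvgB; [exact: cvg_id | exact: cvg_cst].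
have contc := cvx_fun_continuous cvxc; have contt := cvx_fun_continuous cvxt.
have small (x : R) : 0 < x -> \forall j \near \oo, (j.+1%:R^-1 : R) < x.
  by move=> x0; exact: (near_infty_natSinv_lt (PosNum x0)).
pose Q := sqnorm th; have Q0 : 0 <= Q by exact: sqnorm_ge0.
have nearK : \forall j \near \oo, forall w, K w -> penalized j th < penalized j w.
  have /compact_near_coveringP/near_covering_withinP := compK; apply.
  move=> w [Fw /= wr].
  have wN : w != th by apply: contraTneq r0 => wE; rewrite -wr wE subrr normr0 ltxx.
  (* At equal cost the gap in t, weighted by 1 / (j+1), beats the quadratic term of weight 1 /
     (j+1)^2; at larger cost the fixed gap in c beats both. *)
  have [cE|cN] := eqVneq (c w) (c th).
    pose dl := t w - t th; have dl0 : 0 < dl by rewrite subr_gt0 mint.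
    exists ([set x | t w - dl / 2 < t x],
        [set j : nat | (j.+1%:R^-1 : R) < dl / 2 / (Q + 1)]).
      split=> /=; last by apply: small; rewrite !divr_gt0// ltr_wpDl.
      apply: (@contt w [set x | t w - dl / 2 < x]).
      by apply: open_nbhs_nbhs; split=> //=; rewrite gtrBl divr_gt0.
    move=> [w' j] /= [h1 ej] [Fw' _].
    set e := (j.+1%:R^-1 : R) in ej *.
    have e0 : 0 < e by rewrite invr_gt0.
    have h2 : e * (Q + 1) < dl / 2 by rewrite -ltr_pdivlMr ?ltr_wpDl.
    have h3 := minc _ Fw'; have h4 := sqnorm_ge0 w'.
    have h5 : 0 <= e ^+ 2 * sqnorm w' by rewrite mulr_ge0// sqr_ge0.
    have h6 : 0 < e * (t w' - t th - e * Q).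
      rewrite mulr_gt0//; move: h1 h2; rewrite /dl; lra.
    by rewrite /penalized -/Q -/e; move: h6; lra.
  have dl0 : 0 < c w - c th by rewrite subr_gt0 lt_neqAle eq_sym cN minc.
  pose dl := c w - c th; pose tau := `|t w - 1 - t th|.
  have tau0 : 0 <= tau by exact: normr_ge0.
  have S0 : 0 < tau + Q + 1 by rewrite ltr_wpDl// addr_ge0.
  exists ([set x | c w - dl / 2 < c x] `&` [set x | t w - 1 < t x],
      [set j : nat | (j.+1%:R^-1 : R) < dl / 2 / (tau + Q + 1)]).
    split=> /=; last by apply: small; rewrite !divr_gt0.
    apply: filterI.
      apply: (@contc w [set x | c w - dl / 2 < x]).
      by apply: open_nbhs_nbhs; split=> //=; rewrite gtrBl divr_gt0.
    apply: (@contt w [set x | t w - 1 < x]).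
    by apply: open_nbhs_nbhs; split=> //=; rewrite gtrBl.
  move=> [w' j] /= [[h1 h2] ej] [Fw' _].
  set e := (j.+1%:R^-1 : R) in ej *.
  have e0 : 0 < e by rewrite invr_gt0.
  have e1 : e <= 1 by rewrite invf_le1// ler1n.
  have h3 : e * (tau + Q + 1) < dl / 2 by rewrite -ltr_pdivlMr.
  have h4 : 0 <= e ^+ 2 * sqnorm w' by rewrite mulr_ge0 ?sqr_ge0 ?sqnorm_ge0.
  have h5 : - tau < t w' - t th.
    by have := ler_norm (- (t w - 1 - t th)); rewrite normrN -/tau; lra.
  have h6 : e * - tau <= e * (t w' - t th) by rewrite ler_pM2l// ltW.
  have h7 : e ^+ 2 * Q <= e * Q by rewrite ler_wpM2r// expr2 ler_piMr// ltW.
  by move: h1 h3; rewrite /penalized -/Q -/e /dl; lra.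
near=> j => w Fw Dw.
have jK : forall w, K w -> penalized j th < penalized j w by near: j.
have wr := rD w Dw; have w0 : 0 < `|w - th| by exact: lt_trans wr.
pose s := r / `|w - th|.
have s0 : 0 < s by rewrite divr_gt0.
have s1 : s <= 1 by rewrite ler_pdivrMr// mul1r ltW.
have : penalized j th < penalized j (s *: w + (1 - s) *: th).
  apply: jK; split; first exact: (cvxF _ _ _ Fw Fth (ltW s0) s1).
  rewrite /= (_ : _ - th = s *: (w - th)); last first.
    by rewrite scalerBl scale1r scalerBr addrA addrAC addrK.
  by rewrite normrZ gtr0_norm// /s divfK// gt_eqF.
move=> /lt_le_trans/(_ (cvx_penalized j w th (ltW s0) s1)).
have -> : s * penalized j w + (1 - s) * penalized j th =
  penalized j th + s * (penalized j w - penalized j th) by ring.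
by rewrite ltrDl pmulr_rgt0// subr_gt0.
Unshelve. all: by end_near. Qed.
End PenalizedObjective.

Section ScenarioTheorem.
Context {dT : measure_display} {T : measurableType dT} {R : realType} {d : nat}.
Notation V := 'rV[R]_d.+1.
Variables (P : probability T R) (C : T -> set V).
Hypotheses (closedC : forall x, closed (C x)) (cvxC : forall x, cvx_set (C x))
  (nbhsC : forall x, nbhs (0 : V) (C x))
  (measC : forall w, measurable [set x | C x w]).
Variables (c t : V -> R).
Hypotheses (cvxc : cvx_fun c) (cvxt : cvx_fun t).

Definition lex_optimal n (xs : n.-tuple T) (th : V) :=
  [/\ forall i, C (tnth xs i) th,
      forall w, (forall i, C (tnth xs i) w) -> c th <= c w &
      forall w, (forall i, C (tnth xs i) w) -> c w = c th -> w != th -> t th < t w].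

Let G N e j : set (N.-tuple T) := risky P C (penalized c t j) j.+1%:R e.
Arguments G : clear implicits.

Let mG N e j : measurable (G N e j).
Proof.
by apply: measurable_risky => //; exact: cvx_penalized.
Qed.
Arguments mG : clear implicits.

Let G_le N e j : (d < N)%N -> 0 < e < 1 ->
  (tuple_probability P N (G N e j) <= (binomial_tail N d.+1 e)%:E)%E.
Proof.
move=> dN e01; have fin : tuple_probability P N (G N e j) \is a fin_num.
  by apply: fin_num_measure; exact: mG.
rewrite -(fineK fin) lee_fin; apply: binomial_tail_limit => //.
  by rewrite fine_ge0.
move=> M k b kM b1; apply: risky_probability_le => //.
- exact: cvx_penalized.
- exact: penalized_strict.
- by lia.
- by case/andP: e01 => /ltW.
Qed.

(** The lower limit of the events: the j-th program is risky for all large j. Continuity from below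
    transfers the common bound to it. *)
Let limG (N : nat) (e : R) : set (N.-tuple T) := \bigcup_m \bigcap_(j in [set j | (m <= j)%N]) G N e j.
Arguments limG : clear implicits.

Let mbigcapG N e m : measurable (\bigcap_(j in [set j | (m <= j)%N]) G N e j).
Proof. by apply: bigcap_measurable; [exists m; exact: leqnn | move=> j _; exact: mG]. Qed.
Arguments mbigcapG : clear implicits.

Let mlimG N e : measurable (limG N e).
Proof. by apply: bigcupT_measurable => m; exact: mbigcapG. Qed.
Arguments mlimG : clear implicits.

Let limG_le N e : (d < N)%N -> 0 < e < 1 ->
  (tuple_probability P N (limG N e) <= (binomial_tail N d.+1 e)%:E)%E.
Proof.
move=> dN e01.
have := @nondecreasing_cvg_mu _ _ _ (tuple_probability P N)
  (fun m => \bigcap_(j in [set j | (m <= j)%N]) G N e j) (mbigcapG N e) (mlimG N e).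
have nd : {homo (fun m => \bigcap_(j in [set j | (m <= j)%N]) G N e j) : m n / (m <= n)%N >-> (m <= n)%O}.
  by move=> m n mn; apply/subsetPset => x xm j /= nj; apply: xm => /=; exact: leq_trans nj.
move=> /(_ nd) cv; rewrite -(cvg_lim _ cv)//.
apply: lime_le; first by apply/cvg_ex; eexists; exact: cv.
near=> m; apply: le_trans (G_le m dN e01); apply: le_measure; rewrite ?inE.
- exact: mbigcapG.
- exact: mG.
- by move=> x; apply => /=.
Unshelve. all: by end_near. Qed.

(** Each point violating [th] violates the j-th program for all large j, but from which j on depends
    on the point. Continuity from below makes this uniform at the price of passing from e to e' <
    e. *)
Lemma lex_optimal_limG N e e' (xs : N.-tuple T) th : lex_optimal xs th ->
  e' < e -> (e%:E <= P [set x | ~ C x th])%E -> limG N e' xs.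
Proof.
move=> [Cth minc mint] ee eP.
pose W j := violators C (penalized c t j) j.+1%:R xs.
have mW j : measurable (W j).
  by apply: measurable_violators => //; exact: cvx_penalized.
pose H m := \bigcap_(j in [set j | (m <= j)%N]) W j.
have mH m : measurable (H m) by apply: bigcap_measurable; [exists m; exact: leqnn | move=> j _; exact: mW].
have mUH : measurable (\bigcup_m H m) by exact: bigcupT_measurable.
pose F := [set w : V | forall i, C (tnth xs i) w].
have clF : closed F.
  rewrite (_ : F = \bigcap_(i in [set: 'I_N]) C (tnth xs i)).
    by apply: closed_bigI => i _; exact: closedC.
  by apply/seteqP; split=> w /= h i; [move=> _; exact: h | exact: h].
have cvxF : cvx_set F by move=> x y s Fx Fy s0 s1 i; apply: cvxC.
have sub : [set x | ~ C x th] `<=` \bigcup_m H m.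
  move=> z Cz.
  have sep := penalized_separation cvxc cvxt clF cvxF (@closedC z) Cth Cz minc mint.
  have : \forall j \near \oo, W j z.
    near=> j; have sepj : forall w, F w -> C z w -> penalized c t j th < penalized c t j w by near: j.
    rewrite /W /violators/=.
    (* For large j the box of radius j + 1 contains [th], which thus competes in the j-th
       program. *)
    have vle : value C (penalized c t j) j.+1%:R xs [set: 'I_N]%SET <= penalized c t j th.
      have [_] := valueP closedC nbhsC (cvx_penalized cvxc cvxt j) (ltr0Sn R j) xs [set: 'I_N]%SET.
      apply; split=> [|i _]; last exact: Cth.
      by apply: box_norm; rewrite -natr1 ler_wpDr//; near: j; exact: nbhs_infty_ger.
    apply: le_lt_trans vle _.
    have [[_ Cm] _] := valueP closedC nbhsC (cvx_penalized cvxc cvxt j) (ltr0Sn R j)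
      [tuple of z :: xs] [set: 'I_N.+1]%SET.
    apply: sepj.
      by move=> i; have := Cm (lift ord0 i); rewrite tnthS; apply; rewrite inE.
    by have := Cm ord0; rewrite tnth0; apply; rewrite inE.
  by move=> [m _ mW']; exists m => // j /= mj; exact: mW'.
have cv : P (H m) @[m --> \oo] --> P (\bigcup_m H m).
  apply: nondecreasing_cvg_mu => // m n mn; apply/subsetPset => x xm j /= nj.
  by apply: xm => /=; exact: leq_trans nj.
have lt : (e'%:E < P (\bigcup_m H m))%E.
  apply: (@lt_le_trans _ _ e%:E); first by rewrite lte_fin.
  apply: le_trans eP _; apply: le_measure; rewrite ?inE//.
  by rewrite -[X in measurable X]/(~` [set x | C x th]); apply: measurableC.
have : \forall m \near \oo, (e'%:E < P (H m))%E.
  by apply: (cv [set y | (e'%:E < y)%E]); apply: open_nbhs_nbhs; split=> //; exact: open_ereal_gt_ereal.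
move=> [m _ mH']; exists m => // j /= mj.
rewrite /G /risky/=; apply: (@le_trans _ _ (P (H m))); first by apply/ltW/mH' => /=.
by apply: le_measure; rewrite ?inE; [exact: mH | exact: mW | move=> x; apply].
Unshelve. all: by end_near. Qed.

Theorem scenario_bound N (e : R) : 0 < e < 1 ->
  exists E : set (N.-tuple T), [/\ measurable E,
    ((1 - binomial_tail N d.+1 e)%:E <= tuple_probability P N E)%E &
    forall xs, E xs -> forall th, lex_optimal xs th -> (P [set x | ~ C x th] < e%:E)%E].
Proof.
move=> /andP[e0 e1].
have [Nd|dN] := leqP N d.
  (* With N <= d the tail is the whole binomial sum, so the empty event suffices. *)
  exists set0; split=> //; rewrite measure0 lee_fin subr_le0.
  by apply: binomial_tail_total; rewrite ?ltnS// !ltW.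
(* [lex_optimal_limG] needs thresholds strictly below e; the shift in [harmonic l.+1] keeps them
   positive from l = 0 on. *)
pose el (l : nat) := e * (1 - harmonic l.+1).
have h0 l : 0 < (harmonic l.+1 : R) < 1.
  by rewrite /harmonic/= invr_gt0 ltr0n/= invf_lt1// ltr1n.
have el01 l : 0 < el l < 1.
  have /andP[? ?] := h0 l; rewrite /el mulr_gt0 ?subr_gt0//=.
  by rewrite (lt_trans _ e1)// gtr_pMr// gtrBl.
have ele l : el l < e by have /andP[? ?] := h0 l; rewrite /el gtr_pMr// gtrBl.
have elcv : el l @[l --> \oo] --> e.
  rewrite -[X in _ --> X]mulr1; apply: cvgM; first exact: cvg_cst.
  rewrite -[X in _ --> X]subr0; apply: cvgB; first exact: cvg_cst.
  by have := @cvg_harmonic R; rewrite -cvg_shiftS.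
pose Z := \bigcap_l limG N (el l).
have mZ : measurable Z by apply: bigcapT_measurable => l; exact: mlimG.
exists (~` Z); split; first exact: measurableC.
  rewrite probability_setC// EFinB leeB//.
  have fin : tuple_probability P N Z \is a fin_num by exact: fin_num_measure.
  rewrite -(fineK fin) lee_fin.
  apply: (@ler_cvg_to _ \oo _ _ (fun=> fine (tuple_probability P N Z))
    (fun l => binomial_tail N d.+1 (el l))).
  - exact: cvg_cst.
  - exact: (cvg_comp _ _ elcv (@binomial_tail_continuous R N d.+1 e)).
  near=> l; rewrite -lee_fin fineK//; apply: le_trans (limG_le dN (el01 l)).
  by apply: le_measure; rewrite ?inE//; [exact: mlimG | move=> x; apply].
move=> xs nZ th lth; rewrite ltNge; apply/negP => eP; apply: nZ => l _.
exact: (lex_optimal_limG lth (ele l) eP).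
Unshelve. all: by end_near. Qed.
End ScenarioTheorem.

(** * The sample-based program as a convex program *)

Section BoundedPolynomials.
Context {R : realType} {n k : nat}.

Definition mpoly_of_coef (cf : bmultinom n k -> R) : mpoly n R :=
  \sum_(m : bmultinom n k) cf m *: mpolyX R m.

Lemma mcoeff_of_coef cf (m : bmultinom n k) : mcoeff m (mpoly_of_coef cf) = cf m.
Proof.
rewrite /mpoly_of_coef raddf_sum (bigD1 m)//= mcoeffZ mcoeffX eqxx mulr1.
rewrite big1 ?addr0// => m' mm'; rewrite mcoeffZ mcoeffX.
by rewrite (inj_eq val_inj) (negPf mm') mulr0.
Qed.

Lemma msize_of_coef cf : (mmeasure (@mdeg n) (mpoly_of_coef cf) <= k)%N.
Proof.
apply: leq_trans (mmeasure_sum _ _ _ _) _; apply/bigmax_leqP => m _.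
apply: leq_trans (mmeasureZ_le _ _ _) _; rewrite mmeasureX; exact: bmdeg.
Qed.

Lemma mpoly_of_coefK (p : mpoly n R) : (mmeasure (@mdeg n) p <= k)%N ->
  mpoly_of_coef (fun m => mcoeff m p) = p.
Proof. by move=> pk; rewrite [RHS](mpolywE pk). Qed.

Lemma mpoly_of_coef_lin (s u : R) cf cf' :
  mpoly_of_coef (fun m => s * cf m + u * cf' m) =
  s *: mpoly_of_coef cf + u *: mpoly_of_coef cf'.
Proof.
rewrite /mpoly_of_coef !scaler_sumr -big_split/=; apply: eq_bigr => m _.
by rewrite scalerDl !scalerA.
Qed.
End BoundedPolynomials.

Section DecisionCoordinates.
Context {R : realType} {n dx dy dg d : nat}.
Notation V := 'rV[R]_d.+1.

Let I : finType := ('I_dy * bmultinom n dx.+1 + bmultinom n.+1 dg.+1)%type.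

Lemma n_thetaE : n_theta n dx dy dg = #|{: I}|.
Proof. by rewrite card_sum card_prod card_ord. Qed.

Hypothesis hd : n_theta n dx dy dg = d.+1.

Let hI : #|{: I}| = d.+1. Proof. by rewrite -n_thetaE. Qed.

Let coord (w : V) (i : I) : R := w 0 (cast_ord hI (enum_rank i)).

Definition decision_of (w : V) : decision R n dy :=
  ([ffun k => mpoly_of_coef (fun m => coord w (inl (k, m)))],
   mpoly_of_coef (fun m => coord w (inr m))).

Definition coords (th : decision R n dy) : V :=
  \row_j match enum_val (cast_ord (esym hI) j) with
         | inl (k, m) => mcoeff m (th.1 k)
         | inr m => mcoeff m th.2
         end.

Let coord_coords th i : coord (coords th) i =
  match i with inl (k, m) => mcoeff m (th.1 k) | inr m => mcoeff m th.2 end.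
Proof. by rewrite /coord mxE cast_ordK enum_rankK. Qed.

Lemma decision_of_space w : decision_space dx dg (decision_of w).
Proof. by split=> [k|]; rewrite ?ffunE; exact: msize_of_coef. Qed.

Lemma coordsK th : decision_space dx dg th -> decision_of (coords th) = th.
Proof.
case: th => h g [/= hdx gdg]; congr (_, _).
  apply/ffunP => k; rewrite ffunE -[RHS](mpoly_of_coefK (hdx k)).
  by congr mpoly_of_coef; apply/funext => m; rewrite coord_coords.
rewrite -[RHS](mpoly_of_coefK gdg).
by congr mpoly_of_coef; apply/funext => m; rewrite coord_coords.
Qed.

Lemma decision_ofK w : coords (decision_of w) = w.
Proof.
apply/rowP => j; rewrite mxE -[in RHS](cast_ordKV hI j).
case E : (enum_val (cast_ord (esym hI) j)) => [[k m]|m].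
  by rewrite /= ffunE mcoeff_of_coef /coord -E enum_valK.
by rewrite /= mcoeff_of_coef /coord -E enum_valK.
Qed.

Lemma decision_of_lin (s u : R) (x y : V) :
  decision_of (s *: x + u *: y) = s *: decision_of x + u *: decision_of y.
Proof.
rewrite /decision_of; congr (_, _).
  apply/ffunP => k; rewrite !ffunE -mpoly_of_coef_lin.
  by congr mpoly_of_coef; apply/funext => m; rewrite /coord !mxE.
by rewrite /= -mpoly_of_coef_lin; congr mpoly_of_coef; apply/funext => m; rewrite /coord !mxE.
Qed.
End DecisionCoordinates.

Section DecisionEvaluation.
Context {R : realType} {n dy : nat}.
Implicit Types (th : decision R n dy) (x : 'R[R]^n) (y : R).

Lemma p_at_lin (s u : R) th th' x :
  p_at (s *: th + u *: th') x = s *: p_at th x + u *: p_at th' x.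
Proof.
rewrite /p_at !scaler_sumr -big_split/=; apply: eq_bigr => k _.
by rewrite !ffunE mevalD !mevalZ scalerDl !scalerA.
Qed.

Lemma gamma_at_lin (s u : R) th th' x y :
  gamma_at (s *: th + u *: th') x y = s * gamma_at th x y + u * gamma_at th' x y.
Proof. by rewrite /gamma_at/= mevalD !mevalZ. Qed.

Lemma size_p_at th x : (size (p_at th x) <= dy.+1)%N.
Proof.
apply: leq_trans (size_sum _ _ _) _; apply/bigmax_leqP => k _.
by apply: leq_trans (size_scale_leq _ _) _; rewrite size_polyXn ltnS.
Qed.

Lemma measurable_meval m dT (T : measurableType dT) (v : T -> 'I_m -> R) (p : mpoly m R) :
  (forall i, measurable_fun setT (fun z => v z i)) ->
  measurable_fun setT (fun z => meval (v z) p).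
Proof.
move=> mv; rewrite (_ : (fun z => _) = (fun z =>
    \sum_(k <- msupp p) mcoeff k p * \prod_i v z i ^+ k i)).
  apply: measurable_sum => k; apply: measurable_funM; first exact: measurable_cst.
  by apply: measurable_prod => i _; exact: measurable_funX.
by apply/funext => z; exact: mevalE.
Qed.

Lemma measurable_horner_p_at th (g : 'R[R]^n -> R) : measurable_fun setT g ->
  measurable_fun setT (fun x => (p_at th x).[g x]).
Proof.
move=> mg; rewrite (_ : (fun x => _) = (fun x =>
    \sum_(k < dy) meval (tnth x) (th.1 k) * g x ^+ k.+1)).
  apply: measurable_sum => k; apply: measurable_funM; last exact: measurable_funX.
  by apply: measurable_meval => i; exact: measurable_tnth.
apply/funext => x; rewrite /p_at horner_sum; apply: eq_bigr => k _.
by rewrite hornerZ hornerXn.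
Qed.

Lemma measurable_gamma_at th (g : 'R[R]^n -> R) : measurable_fun setT g ->
  measurable_fun setT (fun x => gamma_at th x (g x)).
Proof.
move=> mg; apply: measurable_meval => i; case: (unliftP ord_max i) => [j ->|->].
  rewrite (_ : (fun x => _) = (fun x => tnth x j)); first exact: measurable_tnth.
  by apply/funext => x; rewrite !(tnth_nth 0) lift_max nth_rcons size_tuple ltn_ord.
apply: eq_measurable_fun mg => x _.
by rewrite (tnth_nth 0) nth_rcons size_tuple ltnn eqxx.
Qed.
End DecisionEvaluation.

Section IntervalMinimum.
Context {R : realType}.
Variables (a b : R).
Hypothesis ab : a <= b.

Definition interval_min (q : {poly R}) : R :=
  q.[xget a [set y | a <= y <= b /\ forall z, a <= z <= b -> q.[y] <= q.[z]]].

Lemma interval_minP q : (exists2 y, a <= y <= b & interval_min q = q.[y]) /\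
  forall z, a <= z <= b -> interval_min q <= q.[z].
Proof.
rewrite /interval_min; case: xgetP => [y -> [yab miny]|noP].
  by split; [eexists; [exact: yab|] | exact: miny].
have [y] := EVT_min ab (continuous_subspaceT (@continuous_horner _ q)).
rewrite in_itv/= => yab miny; exfalso; exact: (noP y).
Qed.

Lemma interval_min_ge c q : c <= interval_min q <-> forall y, a <= y <= b -> c <= q.[y].
Proof.
have [[y yab qE] minq] := interval_minP q; split=> [cq z zab|]; last by rewrite qE; apply.
exact: le_trans (minq _ zab).
Qed.
End IntervalMinimum.

(** * Linearity of the objective *)

Lemma product_sigma_finite d1 d2 (T1 : measurableType d1) (T2 : measurableType d2)
    (R : realType) (m1 : {sigma_finite_measure set T1 -> \bar R})
    (m2 : {sigma_finite_measure set T2 -> \bar R}) : sigma_finite setT (m1 \x m2)%E.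
Proof.
have /sigma_finiteP[F [UF ndF Ffin]] := sigma_finiteT m1.
have /sigma_finiteP[G [UG ndG Gfin]] := sigma_finiteT m2.
exists (fun n => F n `*` G n).
  apply/esym/seteqP; split=> // -[x y] _.
  have [k _ Fx] : (\bigcup_k F k) x by rewrite -UF.
  have [l _ Gy] : (\bigcup_k G k) y by rewrite -UG.
  exists (maxn k l) => //; split=> /=.
    by move: x Fx; exact/subsetPset/ndF/leq_maxl.
  by move: y Gy; exact/subsetPset/ndG/leq_maxr.
move=> k; have [mF Fk] := Ffin k; have [mG Gk] := Gfin k.
split; first exact: measurableX.
by rewrite product_measure1E// lte_mul_pinfty// ge0_fin_numE.
Qed.

Section SigmaFiniteTupleMeasure.
Context {d : measure_display} {T : measurableType d} {R : realType}.
Variable mu : {sigma_finite_measure set T -> \bar R}.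
Local Open Scope ereal_scope.

Section Cons.
Variables (m : nat) (nu : {sigma_finite_measure set (m.-tuple T) -> \bar R}).

Let cons_pair (z : T * m.-tuple T) : m.+1.-tuple T := [tuple of z.1 :: z.2].

Let measurable_cons_pair : measurable_fun setT cons_pair.
Proof. exact: measurable_cons. Qed.

Let M : {measure set (m.+1.-tuple T) -> \bar R} :=
  measure_function_pushforward__canonical__measure_function_Measure
    (mu \x nu) measurable_cons_pair.

Definition cons_measure : set (m.+1.-tuple T) -> \bar R := pushforward (mu \x nu) cons_pair.

HB.instance Definition _ := isMeasure.Build _ _ _ cons_measure
  (measure0 M) (measure_ge0 M) (@measure_semi_sigma_additive _ _ _ M).

Let cons_sigma_finite : sigma_finite setT cons_measure.
Proof.
have [F UF Ffin] := product_sigma_finite mu nu.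
pose g (w : m.+1.-tuple T) := (tnth w ord0, [tuple of behead w]).
have mg : measurable_fun setT g.
  apply/measurable_fun_pairP; split; first exact: measurable_tnth.
  exact: measurable_behead.
exists (fun k => g @^-1` F k).
  apply/esym/seteqP; split=> // w _; have : setT (g w) by [].
  by rewrite UF => -[k _ Fk]; exists k.
move=> k; have [mF Fk] := Ffin k; split.
  by rewrite -[X in measurable X]setTI; exact: mg.
rewrite /cons_measure /pushforward (_ : _ @^-1` _ = F k)//.
apply/seteqP; split=> -[x w]; rewrite /g/=.
  by congr (F k (_, _)); exact: val_inj.
by congr (F k (_, _)); exact: val_inj.
Qed.

HB.instance Definition _ := Measure_isSigmaFinite.Build _ _ _ cons_measure cons_sigma_finite.
End Cons.

(** [lebesgue_tuple] is a bare set function, while linearity of the integral needs a measure;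
    sigma-finiteness is carried along so that the recursion can form the next product. *)
Lemma tuple_measure_sigma_finite n :
  exists M : {sigma_finite_measure set (n.-tuple T) -> \bar R},
    tuple_measure mu n = M.
Proof.
elim: n => [|n [M ME]].
  by exists [the {sigma_finite_measure set _ -> \bar R} of \d_([tuple] : 0.-tuple T)].
exists [the {sigma_finite_measure set _ -> \bar R} of cons_measure M].
by rewrite /= ME.
Qed.
End SigmaFiniteTupleMeasure.

Lemma decision_space_lin (R : realType) (n dx dy dg : nat) (s u : R)
    (th th' : decision R n dy) : decision_space dx dg th -> decision_space dx dg th' ->
  decision_space dx dg (s *: th + u *: th').
Proof.
move=> [h g] [h' g']; split=> [k|]; rewrite ?ffunE /mdegree_le;
  apply: leq_trans (mmeasureD_le _ _ _) _; rewrite geq_max; apply/andP; split;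
  (apply: leq_trans (mmeasureZ_le _ _ _) _); by [exact: h|exact: h'|exact: g|exact: g'].
Qed.

Section Objective.
Context {R : realType} {n dx dy dg : nat}.
Variables (X : set 'R[R]^n) (a b : R).
Hypothesis mX : measurable X.
Hypothesis objective_finite : forall th : decision R n dy, decision_space dx dg th ->
  ((lebesgue_tuple R n) \x (@lebesgue_measure R))%E.-integrable
    (X `*` `[a, b]) (fun z => (gamma_at th z.1 z.2)%:E).

Lemma objective_fineK (th : decision R n dy) : decision_space dx dg th ->
  (fine (objective X a b th))%:E = objective X a b th.
Proof.
move=> /objective_finite ith; rewrite fineK//.
move: ith; rewrite /objective /lebesgue_tuple.
have [M ->] := tuple_measure_sigma_finite (@lebesgue_measure R) n.
by move=> ith; apply: integrable_fin_num => //; exact: measurableX.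
Qed.

Lemma objective_lin (s u : R) (th th' : decision R n dy) :
  decision_space dx dg th -> decision_space dx dg th' ->
  fine (objective X a b (s *: th + u *: th')) =
  s * fine (objective X a b th) + u * fine (objective X a b th').
Proof.
move=> Dth Dth'; apply: EFin_inj.
rewrite EFinD !EFinM !objective_fineK//; last exact: decision_space_lin.
have [ith ith'] := (objective_finite Dth, objective_finite Dth').
move: ith ith'; rewrite /objective /lebesgue_tuple.
have [M ->] := tuple_measure_sigma_finite (@lebesgue_measure R) n.
move=> ith ith'.
have mD : measurable (X `*` `[a, b]%classic) by exact: measurableX.
rewrite -!integralZl// -integralD//; [|exact: integrableZl..].
by apply: eq_integral => z _; rewrite gamma_at_lin.
Qed.
End Objective.

(** * Constraint sets of the sample-based program *)

Section Program.
Context {R : realType} {n dx dy dg d : nat}.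
Notation V := 'rV[R]_d.+1.
Hypothesis hd : n_theta n dx dy dg = d.+1.
Variables (a b alpha : R).
Hypotheses (ab : a < b) (alpha0 : 0 < alpha) (dy2 : (1 < dy)%N).

Definition constraint_poly (th : decision R n dy) (x : 'R[R]^n) (y : R) : {poly R} :=
  p_at th x - (p_at th x).[y]%:P + (gamma_at th x y)%:P - alpha *: ('X - y%:P) ^+ 2.

Lemma horner_constraint_poly th x y z : (constraint_poly th x y).[z] =
  (p_at th x).[z] - (p_at th x).[y] + gamma_at th x y - alpha * (z - y) ^+ 2.
Proof. by rewrite !(hornerD, hornerN, hornerZ, horner_exp, hornerC, hornerX). Qed.

(** At z = y the constraint polynomial takes the value gamma, which gives the sign condition. The
    degree bound for [markov_lukacs] uses dy >= 2 because of the quadratic term in alpha. *)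
Lemma sample_constraintP th x y : a <= y <= b ->
  sample_constraint a b alpha th x y <->
  0 <= interval_min a b (constraint_poly th x y).
Proof.
move=> yab; split=> [[_ cert]|/(interval_min_ge (ltW ab)) q0].
  by apply/(interval_min_ge (ltW ab)) => z; exact: certificate_ge0 cert.
split.
  by have := q0 y yab; rewrite horner_constraint_poly !subrr add0r expr0n/= mulr0 subr0.
apply: (markov_lukacs ab _ q0).
apply: leq_trans (size_polyD _ _) _; rewrite geq_max size_polyN; apply/andP; split.
  apply: leq_trans (size_polyD _ _) _; rewrite geq_max (leq_trans (size_polyC_leq1 _))// andbT.
  apply: leq_trans (size_polyD _ _) _; rewrite geq_max size_p_at size_polyN.
  by rewrite (leq_trans (size_polyC_leq1 _)).
apply: leq_trans (size_scale_leq _ _) _; apply: leq_trans (size_poly_exp_leq _ _) _.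
by rewrite size_XsubC.
Qed.

Lemma constraint_poly_lin (s : R) th th' x y :
  constraint_poly (s *: th + (1 - s) *: th') x y =
  s *: constraint_poly th x y + (1 - s) *: constraint_poly th' x y.
Proof.
rewrite /constraint_poly p_at_lin gamma_at_lin hornerD !hornerZ.
by rewrite -!mul_polyC !(polyCD, polyCM, polyCN, polyC1); ring.
Qed.

(** Index 1 stands for h_2, the coefficient of y^2. *)
Definition feasible_point : decision R n dy :=
  ([ffun k : 'I_dy => mpolyC n (if k == 1%N :> nat then 2 * alpha else 0)],
   mpolyC n.+1 (1 + 4 * alpha * (a ^+ 2 + b ^+ 2))).

Lemma feasible_point_space : decision_space dx dg feasible_point.
Proof.
split=> [k|] /=; rewrite ?ffunE /mdegree_le mmeasureC.
  by apply: leq_trans (leq_b1 _) _.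
by apply: leq_trans (leq_b1 _) _.
Qed.

(* With p = 2 alpha y^2, the constraint polynomial is
   alpha (y + y_i)^2 - 4 alpha y_i^2 + gamma, and y_i^2 <= a^2 + b^2. *)
Lemma feasible_point_ge1 x y : a <= y <= b ->
  1 <= interval_min a b (constraint_poly feasible_point x y).
Proof.
move=> /andP[ay yb]; apply/(interval_min_ge (ltW ab)) => z _.
have pE : p_at feasible_point x = (2 * alpha) *: 'X^2.
  rewrite /p_at (bigD1 (Ordinal dy2))//= big1 ?addr0 ?ffunE ?mevalC//.
  move=> k k1; rewrite ffunE mevalC ifF ?scale0r//; apply/negP => /eqP kE.
  by move/eqP: k1; apply; exact: val_inj.
have gE : gamma_at feasible_point x y = 1 + 4 * alpha * (a ^+ 2 + b ^+ 2).
  by rewrite /gamma_at mevalC.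
rewrite horner_constraint_poly pE gE !(hornerZ, hornerXn).
have y2 : y ^+ 2 <= a ^+ 2 + b ^+ 2.
  have [y0|y0] := leP 0 y.
    by apply: (@le_trans _ _ (b ^+ 2)); [nra | rewrite lerDr sqr_ge0].
  by apply: (@le_trans _ _ (a ^+ 2)); [nra | rewrite lerDl sqr_ge0].
have h1 : 0 <= alpha * (z + y) ^+ 2 by rewrite mulr_ge0 ?(ltW alpha0) ?sqr_ge0.
have h2 : 0 <= alpha * (a ^+ 2 + b ^+ 2 - y ^+ 2) by rewrite mulr_ge0 ?(ltW alpha0) ?subr_ge0.
nra.
Qed.

Let w0 : V := coords hd feasible_point.

Definition program_decision (w : V) : decision R n dy := decision_of hd (w0 + w).

Lemma program_decision_lin (s : R) v w :
  program_decision (s *: v + (1 - s) *: w) =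
  s *: program_decision v + (1 - s) *: program_decision w.
Proof.
rewrite /program_decision -decision_of_lin; congr decision_of.
by rewrite !scalerDr addrACA -scalerDl [s + _]addrC subrK scale1r.
Qed.

Variable f : 'R[R]^n -> R.
Hypotheses (f_ab : forall x, a <= f x <= b) (mf : measurable_fun setT f).

Definition program_set (x : 'R[R]^n) : set V :=
  [set w | 0 <= interval_min a b (constraint_poly (program_decision w) x (f x))].

Let gap x w : R := - interval_min a b (constraint_poly (program_decision w) x (f x)).

(** For fixed z the constraint polynomial at z is affine in w, so its minimum over z is concave.
    Convexity of [gap] then yields closedness and interior points through continuity. *)
Let cvx_gap x : cvx_fun (gap x).
Proof.
move=> v w s s0 s1; rewrite /gap program_decision_lin constraint_poly_lin.
rewrite !mulrN -opprD lerN2; apply/(interval_min_ge (ltW ab)) => z zab.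
rewrite hornerD !hornerZ.
have [_ hv] := interval_minP (ltW ab) (constraint_poly (program_decision v) x (f x)).
have [_ hw] := interval_minP (ltW ab) (constraint_poly (program_decision w) x (f x)).
by rewrite lerD// ler_wpM2l ?subr_ge0// ?hv ?hw.
Qed.

Let program_setE x : program_set x = gap x @^-1` [set r | r <= 0].
Proof. by apply/seteqP; split=> w; rewrite /program_set /gap/= oppr_le0. Qed.

Lemma program_set_closed x : closed (program_set x).
Proof.
rewrite program_setE; apply: preimage_closed; last exact: closed_le.
by move=> w _; apply: cvx_fun_continuous; exact: cvx_gap.
Qed.

Lemma program_set_cvx x : cvx_set (program_set x).
Proof.
rewrite program_setE => v w s /= gv gw s0 s1; apply: le_trans (cvx_gap x v w s0 s1) _.
have h1 : s * gap x v <= 0 by rewrite mulr_ge0_le0.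
have h2 : (1 - s) * gap x w <= 0 by rewrite mulr_ge0_le0// subr_ge0.
lra.
Qed.

Lemma program_set_nbhs x : nbhs (0 : V) (program_set x).
Proof.
have g0 : gap x 0 < 0.
  rewrite oppr_lt0; apply: (@lt_le_trans _ _ 1) => //.
  rewrite /program_decision addr0 coordsK ?feasible_point_ge1//.
  exact: feasible_point_space.
have : nbhs (0 : V) (gap x @^-1` [set r | r < 0]).
  apply: (cvx_fun_continuous (cvx_gap x)).
  by apply: open_nbhs_nbhs; split=> //; exact: open_lt.
by apply: filterS => w /= gw; rewrite program_setE/= ltW.
Qed.

(** By continuity, nonnegativity on [a, b] is decided at the rational points of ]a, b[; the
    endpoints are reached as one-sided limits. *)
Lemma program_set_measurable w : measurable [set x | program_set x w].
Proof.
pose q x := constraint_poly (program_decision w) x (f x).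
pose N z := if a < ratr z < b then [set x | (q x).[ratr z] < 0] else set0.
rewrite (_ : mkset _ = ~` \bigcup_(z : rat) N z).
  apply: measurableC; apply: bigcupT_measurable_rat => z.
  rewrite /N; case: ifP => // _.
  have mq : measurable_fun setT (fun x => (q x).[ratr z]).
    rewrite (_ : (fun x => _) = (fun x => (p_at (program_decision w) x).[ratr z] -
      (p_at (program_decision w) x).[f x] + gamma_at (program_decision w) x (f x) -
      alpha * (ratr z - f x) ^+ 2)); last first.
      by apply/funext => x; exact: horner_constraint_poly.
    apply: measurable_funB; last first.
      apply: measurable_funM; first exact: measurable_cst.
      by apply: measurable_funX; apply: measurable_funB.
    apply: measurable_funD; last exact: measurable_gamma_at.
    by apply: measurable_funB; exact: measurable_horner_p_at.
  have := mq measurableT _ (measurable_itv `]-oo, 0[).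
  rewrite setTI; congr measurable; apply/seteqP; split=> x /=; by rewrite in_itv/=.
apply/seteqP; split=> x /=.
  move=> /(interval_min_ge (ltW ab)) q0 [z _]; rewrite /N; case: ifP => // /andP[az zb] /=.
  by rewrite ltNge q0// !ltW.
move=> nN; apply/(interval_min_ge (ltW ab)).
have H z : a < ratr z < b -> 0 <= (q x).[ratr z].
  move=> zab; rewrite leNgt; apply/negP => qz; apply: nN; exists z => //.
  by rewrite /N zab.
have oo y : a < y < b -> 0 <= (q x).[y].
  move=> /andP[ay yb]; rewrite leNgt; apply/negP => qy.
  have : nbhs y [set z | (q x).[z] < 0].
    apply: (@continuous_horner _ (q x) y [set r | r < 0]).
    by apply: open_nbhs_nbhs; split=> //; exact: open_lt.
  move=> /nbhs_ballP[e /= e0 eP].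
  have [|z] := @rat_in_itvoo R y (Num.min b (y + e)).
    by rewrite lt_min yb ltrDl.
  rewrite in_itv/= lt_min => /andP[yz /andP[zb ze]].
  have : (q x).[ratr z] < 0.
    apply: eP; rewrite /ball/= ltr_norml; apply/andP; split; lra.
  by rewrite ltNge H//= zb andbT (lt_trans ay).
have ge0 y : a <= y -> y < b -> 0 <= (q x).[y].
  move=> ay yb; apply: (horner_ge0_right yb) => z /andP[yz zb].
  by apply: oo; rewrite zb andbT (le_lt_trans ay).
move=> y /andP[ay yb]; have [yE|yN] := eqVneq y b; last first.
  by apply: ge0 => //; rewrite lt_neqAle yN.
rewrite yE; apply: (horner_ge0_left ab) => z /andP[az zb].
by apply: ge0 => //; exact: ltW.
Qed.
End Program.

(** * The generalization bound *)

Lemma n_theta_gt0 n dx dy dg : (0 < n_theta n dx dy dg)%N.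
Proof.
rewrite /n_theta addn_gt0; apply/orP; right; apply/card_gt0P.
have m0 : (mdeg (@mnm0 n.+1) < dg.+1)%N by rewrite mdeg0.
by exists (BMultinom m0).
Qed.

Section Conclusion.
Context {R : realType} {n dy : nat}.
Variables (a b alpha : R) (th : decision R n dy).

(* The right-hand side of the certificate is then affine in y, while the
   left-hand side has leading term - alpha y^2. *)
Lemma low_degree_infeasible x y : 0 < alpha -> (dy < 2)%N ->
  ~ sample_constraint a b alpha th x y.
Proof.
move=> alpha0 dy2 [_]; rewrite -/(constraint_poly alpha th x y) => -[s0 [s1]].
set q := constraint_poly _ _ _ _ => cert.
have q2 : q`_2 = - alpha.
  rewrite /q /constraint_poly !coefD !coefN coefZ !coefC /= oppr0 !addr0.
  rewrite (_ : ('X - y%:P) ^+ 2 = 'X^2 - (2 * y) *: 'X + (y ^+ 2)%:P); last first.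
    by rewrite -mul_polyC !(polyCM, polyC_exp, polyC_natr); ring.
  rewrite !coefD coefN coefZ coefX coefXn coefC/= mulr0 subr0 addr0 mulr1.
  by rewrite (leq_sizeP _ 2 (leq_trans (size_p_at _ _) _)) ?add0r.
suff sq : (size q <= 2)%N.
  by move: q2; rewrite (leq_sizeP _ 2 sq)// => /eqP; rewrite eq_sym oppr_eq0 (gt_eqF alpha0).
have affine (s r : {poly R}) : (size s <= 1)%N -> (size r <= 2)%N -> (size (s * r)%R <= 2)%N.
  move=> ss sr; apply: leq_trans (size_polyMleq _ _) _; lia.
have sX c : (size (c%:P - 'X : {poly R})%R <= 2)%N.
  by rewrite -opprB size_polyN size_XsubC.
case: (dy) dy2 cert => [|[|//]] _ /=.
  move=> [[_ sz0] [_]]; rewrite leqn0 size_poly_eq0 => /eqP -> ->.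
  by rewrite mul0r addr0 (leq_trans sz0).
move=> [[_ sz0] [_ sz1] ->]; apply: leq_trans (size_polyD _ _) _.
by rewrite geq_max !affine// size_XsubC.
Qed.

Lemma argmin_error_le (X : set 'R[R]^n) x y z : 0 < alpha ->
  X x -> a <= y <= b -> argmin `[a, b] (fun u => (p_at th x).[u]) z ->
  0 <= (constraint_poly alpha th x y).[z] ->
  (`|z - y|%:E <= sqrte (gamma_max X a b th * alpha^-1%:E))%E.
Proof.
move=> alpha0 Xx yab [zab zmin]; rewrite horner_constraint_poly => q0.
have pzy : (p_at th x).[z] <= (p_at th x).[y] by apply: zmin; rewrite /= in_itv.
have err : (z - y) ^+ 2 <= gamma_at th x y * alpha^-1.
  by rewrite ler_pdivlMr// mulrC; lra.
have gle : ((gamma_at th x y)%:E <= gamma_max X a b th)%E.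
  by apply: ereal_sup_ubound; exists (x, y) => //; split=> //=; rewrite in_itv.
have le2 : (((z - y) ^+ 2)%:E <= gamma_max X a b th * alpha^-1%:E)%E.
  apply: (@le_trans _ _ ((gamma_at th x y)%:E * alpha^-1%:E)%E).
    by rewrite -EFinM lee_fin.
  by rewrite lee_wpmul2r// lee_fin invr_ge0 ltW.
rewrite -[`|_|%:E]/(`|(z - y)%:E|)%E -sqrte_sqr lee_sqrt//.
by apply: le_trans le2; rewrite lee_fin sqr_ge0.
Qed.

Lemma measurable_error_le (X : set 'R[R]^n) (f g : 'R[R]^n -> R) (s : \bar R) :
  measurable X -> measurable_fun X f -> measurable_fun X g ->
  measurable [set x | X x /\ (`|g x - f x|%:E <= s)%E].
Proof.
move=> mX mf mg.
have m : measurable_fun X (fun x => `|g x - f x|%:E).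
  apply/measurable_EFinP; apply: measurableT_comp => //.
  exact: measurable_funB.
have := m mX _ (emeasurable_itv `]-oo, s]).
by congr measurable; apply/seteqP; split=> x [Xx]/=; rewrite in_itv.
Qed.
End Conclusion.

Section Guarantee.
Context {R : realType} {n dx dy dg : nat}.
Variables (a b alpha : R).
Hypotheses (ab : a < b) (alpha0 : 0 < alpha) (dy2 : (1 < dy)%N).
Variable f : 'R[R]^n -> R.
Hypotheses (f_ab : forall x, a <= f x <= b) (mf : measurable_fun setT f).
Variable X : set 'R[R]^n.
Hypothesis mX : measurable X.
Hypothesis objective_finite : forall th : decision R n dy, decision_space dx dg th ->
  ((lebesgue_tuple R n) \x (@lebesgue_measure R))%E.-integrable
    (X `*` `[a, b]) (fun z => (gamma_at th z.1 z.2)%:E).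
Variable t : decision R n dy -> R.
Hypothesis convex_t : convex_function (decision_space dx dg) t.
Variable P : probability 'R[R]^n R.

Lemma selected_constraint_probability N eps : 0 < eps < 1 ->
  exists E : set (N.-tuple 'R[R]^n),
    [/\ measurable E,
        ((1 - binomial_tail N (n_theta n dx dy dg) eps)%:E <= tuple_probability P N E)%E
      & forall xs, E xs -> forall th,
          selected_optimal X f a b alpha dx dg t xs th ->
          measurable [set x | 0 <= interval_min a b (constraint_poly alpha th x (f x))] /\
          (P [set x | ~ (0 <= interval_min a b (constraint_poly alpha th x (f x)))%R]
             < eps%:E)%E].
Proof.
move=> eps01.
have [d hd] : exists d, n_theta n dx dy dg = d.+1.
  by exists (n_theta n dx dy dg).-1; rewrite prednK// n_theta_gt0.
pose D w : decision R n dy := program_decision hd a b alpha w.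
pose C := program_set hd a b alpha f.
have Dspace w : decision_space dx dg (D w) by exact: decision_of_space.
pose c w := fine (objective X a b (D w)).
have cvxc : cvx_fun c.
  move=> v w s s0 s1; rewrite /c {1}/D program_decision_lin.
  by rewrite (objective_lin mX objective_finite).
have cvxt : cvx_fun (t \o D).
  move=> v w s s0 s1; rewrite /= {1}/D program_decision_lin.
  by apply: (convex_t (Itv01 s0 s1)); exact: mem_set.
have [E [mE PE EP]] := @scenario_bound _ _ R d P C
  (fun x => @program_set_closed R n dx dy dg d hd a b alpha ab f x)
  (fun x => @program_set_cvx R n dx dy dg d hd a b alpha ab f x)
  (program_set_nbhs hd ab alpha0 dy2 f_ab)
  (fun w => @program_set_measurable R n dx dy dg d hd a b alpha ab f mf w)
  _ _ cvxc cvxt N eps eps01.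
exists E; split=> //; first by rewrite hd.
move=> xs Exs th [[[thS thC] thO] thT].
have [w DwE] : exists w, D w = th.
  exists (coords hd th - coords hd (feasible_point a b alpha)).
  by rewrite /D /program_decision addrC subrK coordsK.
have Dinj : injective D.
  by move=> u v /(congr1 (coords hd)); rewrite !decision_ofK => /addrI.
have CP v : (forall i : 'I_N, C (tnth xs i) v) <-> feasible f a b alpha dx dg xs (D v).
  split=> [Cv|[_ Cv] i]; last by apply/sample_constraintP.
  by split=> // i; apply/sample_constraintP => //; exact: Cv.
(* [selected_optimal] compares t among optimal decisions, [lex_optimal] among feasible ones of equal
   cost; finiteness of the objective lets the two agree. *)
have lexw : lex_optimal C c (t \o D) xs w.
  have cE v : (c v)%:E = objective X a b (D v).
    by rewrite (objective_fineK mX objective_finite).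
  split.
  - by apply/CP; rewrite DwE.
  - by move=> v /CP Cv; rewrite -lee_fin !cE DwE; exact: thO.
  - move=> v /CP Cv cv vw; rewrite /= DwE; apply: thT.
      by split=> // th' /thO; rewrite -cE cv cE DwE.
    by rewrite -DwE => /Dinj vE; move: vw; rewrite vE eqxx.
have := EP xs Exs w lexw; rewrite -DwE; split => //.
exact: (@program_set_measurable R n dx dy dg d hd a b alpha ab f mf w).
Qed.
End Guarantee.

Lemma probability_setI_full d (T : measurableType d) (R : realType)
    (P : probability T R) (A B : set T) :
  measurable A -> measurable B -> P B = 1%E -> (P A <= P (A `&` B))%E.
Proof.
move=> mA mB PB.
have PBc : P (~` B) = 0%E by rewrite probability_setC// PB subee.
rewrite -[X in (_ <= X)%E]adde0 -PBc.
apply: (@le_trans _ _ (P ((A `&` B) `|` ~` B))); last first.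
  by apply: measureU2; [exact: measurableI | exact: measurableC].
apply: le_measure; rewrite ?inE//.
  by apply: measurableU; [exact: measurableI | exact: measurableC].
by move=> x Ax; have [Bx|nBx] := pselect (B x); [left | right].
Qed.

Theorem theorem3p7 (R : realType) (n : nat) (a b : R)
    (f : 'R[R]^n -> R) (f_ab : forall x, a <= f x <= b)
    (X : set 'R[R]^n) (mX : measurable X) (mf : measurable_fun X f)
    (dx dy dg : nat) (alpha : R) (alpha0 : 0 < alpha)
    (objective_finite : forall th : decision R n dy,
      decision_space dx dg th ->
      ((lebesgue_tuple R n) \x (@lebesgue_measure R))%E.-integrable
        (X `*` `[a, b]) (fun z => (gamma_at th z.1 z.2)%:E))
    (P : probability 'R[R]^n R) (PX : P X = 1%E)
    (t : decision R n dy -> R)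
    (convex_t : convex_function (decision_space dx dg) t)
    (eps delta : R) (N : nat)
    (eps01 : 0 < eps < 1) (delta01 : 0 < delta < 1) :
  let m := n_theta n dx dy dg in
  let cond_a :=
    \sum_(k < m) 'C(N, k)%:R * eps ^+ k * (1 - eps) ^+ (N - k) <= delta in
  let cond_b :=
    eps^-1 * (m%:R - 1 + ln delta^-1 + Num.sqrt (2 * (m%:R - 1) * ln delta^-1))
      <= N%:R in
  (cond_b -> cond_a) /\
  (cond_a \/ cond_b ->
   exists E : set (N.-tuple 'R[R]^n),
     [/\ measurable E,
         ((1 - delta)%:E <= tuple_measure P N E)%E
       & forall xs, E xs -> forall th : decision R n dy,
         selected_optimal X f a b alpha dx dg t xs th ->
         forall fhat : 'R[R]^n -> R,
         measurable_fun X fhat ->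
         (forall x, X x -> argmin `[a, b] (fun y => (p_at th x).[y]) (fhat x)) ->
         ((1 - eps)%:E <
           P [set x | X x /\ `|fhat x - f x|%:E
                               <= sqrte (gamma_max X a b th * alpha^-1%:E)])%E]).
Proof.
move=> m cond_a cond_b.
have m0 : (0 < m)%N by exact: n_theta_gt0.
have ba : cond_b -> cond_a by exact: sample_size_sufficient.
split=> // conds; have tail : binomial_tail N m eps <= delta by case: conds => [|/ba].
have [eps0 eps1] := andP eps01; have [delta0 delta1] := andP delta01.
(* For N < m the tail would be at least 1, hence above delta. A sample is needed to refute
   feasibility when dy < 2. *)
have N0 : (0 < N)%N.
  apply: leq_trans m0 _; rewrite leqNgt; apply/negP => Nm.
  have := binomial_tail_total Nm (introT andP (conj (ltW eps0) (ltW eps1))).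
  by rewrite leNgt (le_lt_trans tail).
rewrite tuple_measureE.
have total : ((1 - delta)%:E <= tuple_probability P N setT)%E.
  by rewrite probability_setT lee_fin lerBlDr lerDl ltW.
have := f_ab (nseq_tuple n 0); have [ab|ba_|abE] := ltgtP a b; last first.
(* If a = b, both f and fhat take the only available value. *)
- move=> _; exists setT; split=> // xs _ th _ fhat _ argfhat.
  rewrite (_ : mkset _ = X) ?PX ?lte_fin ?ltrBlDr ?ltrDl//.
  apply/seteqP; split=> [x []//|x Xx]; split=> //.
  have [fab _] := argfhat x Xx; move: fab (f_ab x); rewrite /= in_itv/= -abE.
  by rewrite -!eq_le => /eqP <- /eqP <-; rewrite subrr normr0 sqrte_ge0.
- by move=> /andP[/le_trans h /h]; rewrite leNgt ba_.
move=> _; have [dy2|dy2] := ltnP dy 2.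
  exists setT; split=> // xs _ th [[[_ thC] _] _].
  by case: (low_degree_infeasible alpha0 dy2 (thC (Ordinal N0))).
(* f is measurable on X only; g extends its restriction by the constant a, staying measurable and
   within [a, b]. *)
pose g x := a + ((fun x => f x - a) \_ X) x.
have gX x : X x -> g x = f x by move=> Xx; rewrite /g patchE mem_set// addrC subrK.
have g_ab x : a <= g x <= b.
  have [Xx|nXx] := pselect (X x); first by rewrite gX.
  by rewrite /g patchE memNset// addr0 lexx ltW.
have mg : measurable_fun setT g.
  apply: measurable_funD => //; apply/(measurable_restrictT _ mX).
  exact: measurable_funB.
have [E [mE PE EP]] := selected_constraint_probability ab alpha0 dy2 g_ab mg mX
  objective_finite convex_t P N eps01.
(* Almost every sample lies in X, where g and f impose the same constraints. *)
pose XN := [set xs : N.-tuple 'R[R]^n | forall i, X (tnth xs i)].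
have mXN : measurable XN by apply: (@measurable_box _ _ N (fun=> X)).
have PXN : tuple_probability P N XN = 1%E.
  rewrite (tuple_probability_box P (A := fun=> X))//.
  by rewrite big1.
exists (E `&` XN); split; first exact: measurableI.
  apply: le_trans (probability_setI_full mE mXN PXN); apply: le_trans PE.
  by rewrite lee_fin lerD2l lerN2.
move=> xs [Exs Xxs] th sel fhat mfhat argfhat.
have feasE (th' : decision R n dy) :
    feasible g a b alpha dx dg xs th' <-> feasible f a b alpha dx dg xs th'.
  split=> -[Dth C]; split=> // i.
    by rewrite -gX.
  by rewrite gX.
pose G := [set x | 0 <= interval_min a b (constraint_poly alpha th x (g x))].
have [mG PG] : measurable G /\ (P (~` G) < eps%:E)%E.
  have optE (th' : decision R n dy) :
      optimal X g a b alpha dx dg xs th' <-> optimal X f a b alpha dx dg xs th'.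
    split=> -[F O]; split=> [|u Fu]; [exact/feasE|apply: O; exact/feasE|
      exact/feasE|apply: O; exact/feasE].
  apply: (EP xs Exs); case: sel => Oth S.
  by split=> [|u Ou]; [exact/optE | apply: S; exact/optE].
set A := mkset _; have mA : measurable A.
  exact: (@measurable_error_le R n X f fhat _ mX mf mfhat).
apply: (@lt_le_trans _ _ (P G)).
  have := probability_setC P mG; rewrite -(fineK (fin_num_measure P _ mG)).
  move=> PGc; move: PG; rewrite PGc !lte_fin; lra.
apply: le_trans (probability_setI_full mG mX PX) _.
apply: le_measure; rewrite ?inE//; first exact: measurableI.
move=> x [Gx Xx]; split=> //; apply: (argmin_error_le alpha0 Xx (f_ab x) (argfhat x Xx)).
move: Gx; rewrite /G/= gX// => /(interval_min_ge (ltW ab)) Gx; apply: Gx.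
by have [] := argfhat x Xx; rewrite /= in_itv.
Qed.
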